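(* Let $\Omega$ be a domain of $\mathbb{R}^2$, let $\mathscr{A}^{hk}(x)=\{a^{hk}_{ij}(x)\}$ ($1\le i,j\le m$, $1\le h,k\le2$) be $m\times m$ matrices with complex valued $L^\infty(\Omega)$ entries, and let $\varphi$ satisfy conditions (i)-(vi) of the context. If the operator $A=\partial_h(\mathscr{A}^{hk}(x)\partial_k)$ is strict $L^\Phi$-dissipative, then there exists $\kappa>0$ such that $$\operatorname{Re}\Big(\langle(\mathscr{A}^{hk}(x)\xi_h\xi_k)\eta,\eta\rangle-\Lambda_\infty^2\langle(\mathscr{A}^{hk}(x)\xi_h\xi_k)\omega,\omega\rangle(\operatorname{Re}\langle\eta,\omega\rangle)^2+\Lambda_\infty\big(\langle(\mathscr{A}^{hk}(x)\xi_h\xi_k)\omega,\eta\rangle-\langle(\mathscr{A}^{hk}(x)\xi_h\xi_k)\eta,\omega\rangle\big)\operatorname{Re}\langle\eta,\omega\rangle\Big)\ge\kappa\,|\xi|^2|\eta|^2$$ for almost every $x\in\Omega$ and for any $\xi\in\mathbb{R}^2$, $\eta,\omega\in\mathbb{C}^m$, $|\omega|=1$.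
   Context: Conditions on $\varphi:(0,+\infty)\to(0,+\infty)$: (i) $\varphi\in C^1((0,+\infty))$; (ii) $(s\varphi(s))'>0$ for all $s>0$; (iii) the range of the strictly increasing function $s\varphi(s)$ is $(0,+\infty)$; (iv) there exist constants $C_1,C_2>0$, $r>-1$ and $s_0>0$ such that $C_1s^r\le(s\varphi(s))'\le C_2s^r$ for $s\in(0,s_0)$; if $r=0$ one requires moreover that the finite limit $\lim_{s\to0^+}\varphi(s)$ exists and is $>0$, and $\lim_{s\to0^+}s\varphi'(s)=0$; (v) there exists $s_1>s_0$ such that either $\varphi'(s)\ge0$ for all $s\ge s_1$ or $\varphi'(s)\le0$ for all $s\ge s_1$; (vi) the function $|s\varphi'(s)/\varphi(s)|$ is non-decreasing on $(0,+\infty)$. The function $s\mapsto s\sqrt{\varphi(s)}$ is a strictly increasing bijection of $(0,+\infty)$; $\Lambda:(0,+\infty)\to\mathbb{R}$ is defined by $\Lambda(s\sqrt{\varphi(s)})=-\frac{s\varphi'(s)}{s\varphi'(s)+2\varphi(s)}$ for $s>0$. Under (vi), $\Lambda$ is monotone and bounded, and $\Lambda_\infty:=\lim_{t\to+\infty}\Lambda(t)$ exists and is finite. $\Phi(s)=\int_0^s\sigma\varphi(\sigma)d\sigma$ is only used in the name ''$L^\Phi$-dissipative''. Summation over repeated indices is understood; $\langle\cdot,\cdot\rangle$ is the standard Hermitian inner product of $\mathbb{C}^m$. $\mathring{H}^1(\Omega)$ is the closure of the complex valued $C_c^\infty(\Omega)$ in the $H^1$ norm. $A$ is strict $L^\Phi$-dissipative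 if there exists $\kappa>0$ such that $\operatorname{Re}\int_\Omega\langle\mathscr{A}^{hk}\partial_ku,\partial_h(\varphi(|u|)u)\rangle dx\ge\kappa\int_\Omega|\nabla(\sqrt{\varphi(|u|)}\,u)|^2dx$ for any $u\in[\mathring{H}^1(\Omega)]^m$ such that $\varphi(|u|)u\in[\mathring{H}^1(\Omega)]^m$ (with $\varphi(|u|)u$ and $\sqrt{\varphi(|u|)}\,u$ equal to $0$ where $u=0$). *)

(* Defs.v *)
From HB Require Import structures.
From mathcomp Require Import all_boot all_order all_algebra.
From mathcomp Require Import all_classical all_reals all_analysis.
From mathcomp Require Import complex.

Set Implicit Arguments.
Unset Strict Implicit.
Unset Printing Implicit Defensive.

Import Order.TTheory GRing.Theory Num.Theory.
Import numFieldNormedType.Exports.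

Local Open Scope classical_set_scope.
Local Open Scope complex_scope.
Local Open Scope ring_scope.

(* The plane is the product R * R.  Its library norm, like that of column
   vectors, is the sup norm, so Euclidean norms are written out below. *)

Definition leb2 (R : realType) :
    {measure set (measurableTypeR R * measurableTypeR R) -> \bar R} :=
  ((@lebesgue_measure R) \x (@lebesgue_measure R))%E.

Definition domain (R : realType) (Omega : set (R * R)) : Prop :=
  [/\ Omega !=set0, open Omega & connected Omega].

Definition coord2 (R : realType) (x : R * R) (k : 'I_2) : R :=
  if k == ord0 then x.1 else x.2.

Definition basis2 (R : realType) (k : 'I_2) : R * R :=
  if k == ord0 then (1, 0) else (0, 1).

Definition hdot (R : realType) (m : nat) (v w : 'cV[R[i]]_m) : R[i] :=
  \sum_(i < m) v i ord0 * (w i ord0)^*%C.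

Definition vnorm (R : realType) (m : nat) (v : 'cV[R[i]]_m) : R :=
  Num.sqrt (\sum_(i < m) Normc.normc (v i ord0) ^+ 2).

Definition iter_partial (R : realType) (s : seq 'I_2) (f : R * R -> R)
    : R * R -> R :=
  foldr (fun k (g : R * R -> R) x => 'D_(basis2 R k) g x) f s.

Definition smooth (R : realType) (f : R * R -> R) : Prop :=
  forall s : seq 'I_2, continuous (iter_partial s f) /\
    forall (k : 'I_2) (x : R * R), derivable (iter_partial s f) x (basis2 R k).

(* Complex-valued elements of C_c^infty(Omega), extended by 0. *)
Definition test_fun (R : realType) (Omega : set (R * R))
    (psi : R * R -> R[i]) : Prop :=
  [/\ smooth (fun x => complex.Re (psi x)), smooth (fun x => complex.Im (psi x)),
      compact (closure [set x | psi x != 0]) &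
      closure [set x | psi x != 0] `<=` Omega].

Definition cpartial (R : realType) (k : 'I_2) (psi : R * R -> R[i])
    (x : R * R) : R[i] :=
  ('D_(basis2 R k) (fun y => complex.Re (psi y)) x)
    +i* ('D_(basis2 R k) (fun y => complex.Im (psi y)) x).

Definition cintegral (R : realType) (Omega : set (R * R))
    (f : R * R -> R[i]) : R[i] :=
  (\int[@leb2 R]_(x in Omega) complex.Re (f x))
    +i* (\int[@leb2 R]_(x in Omega) complex.Im (f x)).

(* Classes in L^p(Omega) are represented by Borel functions; only the values
   taken on Omega matter. *)
Definition cLfun (R : realType) (Omega : set (R * R)) (p : \bar R)
    (f : R * R -> R[i]) : Prop :=
  ((fun x => complex.Re (f x)) \_ Omega \in Lfun (@leb2 R) p) /\
  ((fun x => complex.Im (f x)) \_ Omega \in Lfun (@leb2 R) p).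

Definition cloc_integrable (R : realType) (Omega : set (R * R))
    (f : R * R -> R[i]) : Prop :=
  forall K : set (R * R), compact K -> K `<=` Omega ->
    (@leb2 R).-integrable K (fun x => (complex.Re (f x))%:E) /\
    (@leb2 R).-integrable K (fun x => (complex.Im (f x))%:E).

Definition weak_partial (R : realType) (Omega : set (R * R)) (k : 'I_2)
    (f g : R * R -> R[i]) : Prop :=
  [/\ cloc_integrable Omega f, cloc_integrable Omega g &
      forall psi : R * R -> R[i], test_fun Omega psi ->
        cintegral Omega (fun x => f x * cpartial k psi x) =
        - cintegral Omega (fun x => g x * psi x)].

(* Sobolev functions are handled together with a representative of their weak
   gradient, which is unique almost everywhere. *)
Definition sobolev_H1 (R : realType) (Omega : set (R * R))
    (f : R * R -> R[i]) (df : 'I_2 -> R * R -> R[i]) : Prop :=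
  cLfun Omega 2%:E f /\
  forall k : 'I_2, cLfun Omega 2%:E (df k) /\ weak_partial Omega k f (df k).

Definition sobolev_H10 (R : realType) (Omega : set (R * R))
    (f : R * R -> R[i]) (df : 'I_2 -> R * R -> R[i]) : Prop :=
  sobolev_H1 Omega f df /\
  forall eps : R, 0 < eps ->
    exists2 psi : R * R -> R[i], test_fun Omega psi &
      (\int[@leb2 R]_(x in Omega)
         (Normc.normc (f x - psi x) ^+ 2 +
          \sum_(k < 2) Normc.normc (df k x - cpartial k psi x) ^+ 2)%:E
       < (eps ^+ 2)%:E)%E.

Definition vweak_grad (R : realType) (m : nat) (Omega : set (R * R))
    (u : R * R -> 'cV[R[i]]_m) (du : 'I_2 -> R * R -> 'cV[R[i]]_m) : Prop :=
  forall (i : 'I_m) (k : 'I_2),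
    weak_partial Omega k (fun x => u x i ord0) (fun x => du k x i ord0).

Definition vsobolev_H10 (R : realType) (m : nat) (Omega : set (R * R))
    (u : R * R -> 'cV[R[i]]_m) (du : 'I_2 -> R * R -> 'cV[R[i]]_m) : Prop :=
  forall i : 'I_m,
    sobolev_H10 Omega (fun x => u x i ord0) (fun k x => du k x i ord0).

Record phi_conditions (R : realType) (phi : R -> R) : Prop := PhiConditions {
  phi_gt0 : forall s : R, 0 < s -> 0 < phi s;
  phi_C1 : forall s : R, 0 < s ->
    derivable phi s 1 /\ {for s, continuous (derive1 phi)};
  phi_mul_incr : forall s : R, 0 < s -> 0 < derive1 (fun t => t * phi t) s;
  phi_mul_range :
    [set s * phi s | s in `]0, +oo[%classic] = `]0, +oo[%classic :> set R;
  phi_zero_infty : exists C1 C2 r s0 : R,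
    [/\ [/\ 0 < C1, 0 < C2, -1 < r & 0 < s0],
        forall s : R, 0 < s < s0 ->
          C1 * s `^ r <= derive1 (fun t => t * phi t) s <= C2 * s `^ r,
        r = 0 ->
          (exists2 l : R, 0 < l & phi s @[s --> 0^'+] --> l) /\
          s * derive1 phi s @[s --> 0^'+] --> (0 : R) &
        exists2 s1 : R, s0 < s1 &
          (forall s : R, s1 <= s -> 0 <= derive1 phi s) \/
          (forall s : R, s1 <= s -> derive1 phi s <= 0)];
  phi_ratio : forall s t : R, 0 < s -> s <= t ->
    `| s * derive1 phi s / phi s | <= `| t * derive1 phi t / phi t |
}.

(* The values of [Lambda] on the non-positive half-line are irrelevant. *)
Definition is_Lambda (R : realType) (phi Lambda : R -> R) : Prop :=
  forall s : R, 0 < s ->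
    Lambda (s * Num.sqrt (phi s)) =
    - (s * derive1 phi s / (s * derive1 phi s + 2 * phi s)).

Definition Lambda_infty (R : realType) (Lambda : R -> R) : R :=
  lim (Lambda t @[t --> +oo]).

(* g(|u|) u; it vanishes where u does, whatever the value g 0. *)
Definition modulate (R : realType) (m : nat) (g : R -> R)
    (u : R * R -> 'cV[R[i]]_m) (x : R * R) : 'cV[R[i]]_m :=
  (g (vnorm (u x)))%:C *: u x.

(* [du], [dw], [dv] are the weak gradients of u, phi(|u|) u, sqrt(phi(|u|)) u;
   each is determined up to null sets.  Under the conditions on phi, the first
   two existing in L^2 entails that the third one exists. *)
Definition strict_dissipative (R : realType) (m : nat) (Omega : set (R * R))
    (a : 'I_2 -> 'I_2 -> R * R -> 'M[R[i]]_m) (phi : R -> R) : Prop :=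
  exists2 kappa : R, 0 < kappa &
    forall (u : R * R -> 'cV[R[i]]_m) (du dw dv : 'I_2 -> R * R -> 'cV[R[i]]_m),
      vsobolev_H10 Omega u du ->
      vsobolev_H10 Omega (modulate phi u) dw ->
      vweak_grad Omega (modulate (fun s => Num.sqrt (phi s)) u) dv ->
      (kappa%:E * \int[@leb2 R]_(x in Omega)
         (\sum_(k < 2) vnorm (dv k x) ^+ 2)%:E
       <= (complex.Re (cintegral Omega (fun x =>
             \sum_(h < 2) \sum_(k < 2)
               hdot (a h k x *m du k x) (dw h x))))%:E)%E.

Definition symbol (R : realType) (m : nat)
    (a : 'I_2 -> 'I_2 -> R * R -> 'M[R[i]]_m) (x xi : R * R) : 'M[R[i]]_m :=
  \sum_(h < 2) \sum_(k < 2) (coord2 xi h * coord2 xi k)%:C *: a h k x.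

(* Main.v *)
(* Test the dissipativity inequality on u = tau^(N+1) U + psi eta, where U and eta are constant vectors, tau
   is a cutoff equal to 1 around the support of psi, and N is so large that phi(|u|) u and sqrt(phi(|u|)) u
   are C^1 despite the possible blow-up of phi at 0.  Taking psi = chi cos(n^2 xi.x) / n, then the same with
   sin, adding the two inequalities and letting n tend to infinity leaves a quadratic inequality in xi
   weighted by chi^2, which localizes to almost every x.  It involves the differentials at U of phi(|u|) u
   and sqrt(phi(|u|)) u in the direction eta.  For U = M omega with |omega| = 1 and
   eta = zeta + Lambda Re<zeta, omega> omega, Lambda being taken at M sqrt(phi(M)), these are phi(M) (zeta -
   Lambda Re<zeta, omega> omega) and sqrt(phi(M)) zeta; dividing by phi(M) and letting M tend to infinity
   gives the claim for zeta. *)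
Require Import Defs.
From HB Require Import structures.
From mathcomp Require Import all_boot all_order all_algebra.
From mathcomp Require Import all_classical all_reals all_analysis measurable_realfun ess_sup_inf.
From mathcomp Require Import complex lra ring zify.

Set Implicit Arguments.
Unset Strict Implicit.
Unset Printing Implicit Defensive.

Import Order.TTheory GRing.Theory Num.Theory.
Import numFieldNormedType.Exports.

Local Open Scope classical_set_scope.
Local Open Scope complex_scope.
Local Open Scope ring_scope.

(** The plateau keeps u = U + psi eta away from 0, where phi may blow up; elsewhere u is a multiple
    of U, so only one-variable profiles of tau need care. The gradients of tau and psi are never
    both nonzero, so there are no cross terms and tau contributes a constant fixed before psi is
    chosen. With amplitude 1/n and frequency n^2, psi tends to 0 uniformly while its gradient has
    size n: division by n^2 removes that constant and the derivatives of chi, and freezes the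
    coefficients at U. The products of partial derivatives oscillate without converging, but cos^2 +
    sin^2 = 1 makes the sum of the two energies converge pointwise, so dominated convergence
    suffices. The term Lambda Re<zeta, omega> omega in eta is there to cancel the radial part of the
    differential of sqrt(phi(|u|)) u; what stands beside kappa is then |xi|^2 |zeta|^2, so the
    constant of the conclusion is that of the hypothesis. The null set is fixed for rational xi, U,
    eta and serves all others by continuity, before the amplitude M tends to infinity. *)

(** * Measurability, directional derivatives and integrals in the plane *)

(** The product sigma-algebra is generated by measurable rectangles, so U is written as the
    countable union of the open boxes with rational endpoints that it contains. *)
Lemma open_plane_measurable (R : realType) (U : set (R * R)) :
  open U -> measurable (U : set (measurableTypeR R * measurableTypeR R)).
Proof.
move=> oU.
pose box (q : rat * rat * rat * rat) : set (R * R) :=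
  `]ratr q.1.1.1, ratr q.1.1.2[%classic `*` `]ratr q.1.2, ratr q.2[%classic.
have -> : U = \bigcup_q (if `[< box q `<=` U >] then box q else set0).
  apply/seteqP; split => [[x y] Uxy|z [q _]]; last first.
    by case: ifPn => // /asboolP qU; exact: qU.
  have /nbhs_ballP[e /= e0 eU] := open_nbhs_nbhs (conj oU Uxy).
  have ratl (t : R) : exists q : rat, t - e < ratr q < t.
    have [|q] := @rat_in_itvoo R (t - e) t; first by lra.
    by rewrite in_itv; exists q.
  have ratu (t : R) : exists q : rat, t < ratr q < t + e.
    have [|q] := @rat_in_itvoo R t (t + e); first by lra.
    by rewrite in_itv; exists q.
  have [[q1 /andP[q1l q1u]] [q2 /andP[q2l q2u]]] := (ratl x, ratu x).
  have [[q3 /andP[q3l q3u]] [q4 /andP[q4l q4u]]] := (ratl y, ratu y).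
  exists (q1, q2, q3, q4) => //; rewrite asboolT; last first.
    move=> [s t] [] /=; rewrite !in_itv/= => /andP[s1 s2] /andP[t1 t2].
    by apply: eU; split; rewrite /ball/= ltr_norml; lra.
  by split; rewrite /= in_itv /=; apply/andP.
apply: countable_bigcupT_measurable; first exact: countableP.
move=> q; case: ifPn => _; last exact: measurable0.
by apply: measurableX; exact: measurable_itv.
Qed.

Lemma continuous_plane_measurable (R : realType) (f : R * R -> R) :
  continuous f ->
  measurable_fun [set: measurableTypeR R * measurableTypeR R] f.
Proof.
move=> cf; apply: (measurability _ (@measurable_realfun.RGenOpens.measurableE R)).
move=> _ [_ [a [b ->] <-]]; rewrite setTI; apply: open_plane_measurable.
by apply: open_comp; [move=> x _; exact: cf|exact: interval_open].
Qed.
(** Reduces a directional derivative to an ordinary one along a line, so that the one-variable chain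
    rule applies to functions that are only known to be derivable in one direction. *)
Lemma is_derive_slice (R : realType) (V W : normedModType R) (f : V -> W) (p v : V) (l : W) :
  is_derive p v f l <-> is_derive (0 : R) 1 (fun t : R => f (t *: v + p)) l.
Proof.
have E : (fun h : R => h^-1 *: ((f \o shift p) (h *: v) - f p)) =
  (fun h : R => h^-1 *: (((fun t : R => f (t *: v + p)) \o shift 0) (h *: 1) - f (0 *: v + p))).
  by apply/funext => h /=; rewrite addr0 scale0r add0r /GRing.scale /= mulr1.
by split=> -[df dl]; split; rewrite /derivable /derive ?E ?scaler1 // -?E.
Qed.

Lemma is_derive_comp_dir (R : realType) (V : normedModType R) (h : R -> R) (f : V -> R) (p v : V) (dh df : R) :
  is_derive (f p) 1 h dh -> is_derive p v f df -> is_derive p v (h \o f) (dh * df).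
Proof.
move=> Hh /is_derive_slice Hf; apply/is_derive_slice.
apply: (@is_derive1_comp R h (fun t : R => f (t *: v + p))) => //.
by rewrite scale0r add0r.
Qed.

Notation mplane R := (measurableTypeR R * measurableTypeR R)%type.

Lemma continuous_bounded_on (R : realType) (T : topologicalType) (K : set T) (f : T -> R) :
  compact K -> continuous f -> exists2 M : R, 0 < M & forall x, K x -> `|f x| <= M.
Proof.
move=> cK cf.
have /compact_bounded [M [_ HM]] : compact [set f x | x in K].
  by apply: continuous_compact => //; exact: continuous_subspaceT.
exists (`|M| + 1); first by rewrite ltr_wpDl.
by move=> x Kx; apply: (HM (`|M| + 1)); [rewrite (le_lt_trans (ler_norm M))// ltrDl|exists x].
Qed.

Lemma compact_norm_le (R : realType) (V : normedModType R) (K : set V) :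
  compact K -> exists2 M : R, 0 < M & forall p, K p -> `|p| <= M.
Proof.
move=> /compact_bounded[M [_ HM]]; exists (`|M| + 1); first by rewrite ltr_wpDl.
by move=> x Kx; apply: (HM (`|M| + 1)); [rewrite (le_lt_trans (ler_norm M))// ltrDl|].
Qed.

(** The closed ball of the sup norm, written as a product so that its compactness and its measure
    come from those of a segment. *)
Definition square (R : realType) (M : R) : set (R * R) :=
  `[- M, M]%classic `*` `[- M, M]%classic.

Lemma squareE (R : realType) (M : R) (p : R * R) : square M p <-> `|p| <= M.
Proof.
rewrite /square prod_normE ge_max /= !in_itv/= -!ler_norml.
by split=> [[-> ->]|/andP[]].
Qed.

Lemma square_compact (R : realType) (M : R) : compact (square M).
Proof. by apply: compact_setX; exact: segment_compact. Qed.

Lemma square_measurable (R : realType) (M : R) : measurable (square M : set (mplane R)).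
Proof. by apply: measurableX; exact: measurable_itv. Qed.

Lemma square_finite (R : realType) (M : R) : (@leb2 R (square M) < +oo)%E.
Proof.
pose I : set R := `[- M, M]%classic.
have -> : @leb2 R (square M) = (@lebesgue_measure R I * @lebesgue_measure R I)%E.
  by apply: product_measure1E; exact: measurable_itv.
have /= -> := @lebesgue_measure_itv R `[- M, M].
by case: ifP => _; rewrite ?mule0 ?ltry// -EFinB -EFinM ltry.
Qed.

Lemma bounded_square_integrable (R : realType) (f : R * R -> R) (A M : R) :
  measurable_fun [set: mplane R] f -> (forall p, `|f p| <= A) ->
  (forall p, M < `|p| -> f p = 0) ->
  (@leb2 R).-integrable [set: mplane R] (fun p => (f p)%:E).
Proof.
move=> mf fA f0.
have -> : (fun p => (f p)%:E) = (EFin \o f) \_ (square M).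
  apply/funext => p; rewrite patchE; case: ifPn => // /negP; rewrite inE squareE => /negP.
  by rewrite -ltNge => /f0 /= ->.
apply: (integrable_mkcond _ (square_measurable M)).1.
apply: measurable_bounded_integrable.
- exact: square_measurable.
- exact: square_finite.
- exact: measurable_funS mf.
- by exists A; split; [exact: num_real|move=> y Ay x _ /=; exact: le_trans (ltW Ay)].
Qed.

Lemma continuous_supp_bounded (R : realType) (f : R * R -> R) (M : R) :
  continuous f -> (forall p, M < `|p| -> f p = 0) -> exists2 A : R, 0 < A & forall p, `|f p| <= A.
Proof.
move=> cf f0; have [A A0 HA] := continuous_bounded_on (@square_compact R M) cf.
exists A => // p; have [/squareE/HA//|/f0 ->] := leP `|p| M.
by rewrite normr0 ltW.
Qed.

Lemma continuous_supp_integrable (R : realType) (f : R * R -> R) (M : R) :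
  continuous f -> (forall p, M < `|p| -> f p = 0) ->
  (@leb2 R).-integrable [set: mplane R] (fun p => (f p)%:E).
Proof.
move=> cf f0; have [A _ HA] := continuous_supp_bounded cf f0.
exact: bounded_square_integrable (continuous_plane_measurable cf) HA f0.
Qed.

(** Fundamental theorem of calculus on [-A, A], with f equal to 0 at both ends; beyond them the
    derivative vanishes because f is locally 0. *)
Lemma integral_deriv_compact (R : realType) (f : R -> R) (A : R) : 0 < A ->
  (forall t, derivable f t 1) -> continuous f^`()%classic ->
  (forall t, A <= `|t| -> f t = 0) ->
  (\int[@lebesgue_measure R]_t (f^`()%classic t)%:E = 0)%E.
Proof.
move=> A0 df cdf f0.
have d0 t : A < `|t| -> f^`()%classic t = 0.
  move=> At; rewrite derive1E.
  have : \near t, f t = (cst 0 : R -> R) t.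
    near=> s; rewrite f0 //; apply: ltW; near: s.
    have : {for t, continuous (fun s : R => `|s|)} by apply: norm_continuous.
    by move=> /(_ _ (lt_nbhsr At)).
  by move=> /near_eq_derive ->; rewrite ?derive_cst // oner_neq0.
have -> : (\int[@lebesgue_measure R]_t (f^`()%classic t)%:E =
    \int[@lebesgue_measure R]_(t in `[(- A)%R, A]) (f^`()%classic t)%:E)%E.
  rewrite [RHS]integral_mkcond; apply: eq_integral => t _.
  rewrite patchE; case: ifPn => // /negP; rewrite inE /= in_itv/= -ler_norml => /negP.
  by rewrite -ltNge => /d0 ->.
have df' t : {for t, continuous f} by apply/differentiable_continuous/derivable1_diffP.
rewrite (@continuous_FTC2 _ _ f); [|lra|exact: continuous_subspaceT| |by []].
- by rewrite !f0 ?normrN ?gtr0_norm// subee.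
- split=> [t _||]; first exact: df.
  + by apply: cvg_at_right_filter; exact: df'.
  + by apply: cvg_at_left_filter; exact: df'.
Unshelve. all: by end_near. Qed.

Lemma coord2_basis2 (R : realType) (k : 'I_2) (t : R) (p : R * R) :
  t *: basis2 R k + p = if k == ord0 then (t + p.1, p.2) else (p.1, t + p.2).
Proof.
rewrite /basis2; case: ifP => _; case: p => x y;
 congr pair; rewrite /= /GRing.scale /= ?mulr1 ?mulr0 ?add0r //.
Qed.

Lemma is_derive_fst (R : realType) (f : R * R -> R) (x y l : R) :
  is_derive (x, y) (basis2 R ord0) f l <-> is_derive x 1 (fun s => f (s, y)) l.
Proof.
have E : (fun t : R => f (t *: basis2 R ord0 + (x, y))) =
    (fun t : R => f (t *: (1 : R) + x, y)).
  by apply/funext => t; rewrite coord2_basis2 eqxx /= [t *: _]mulr1.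
by split => /is_derive_slice H; apply/is_derive_slice; move: H; rewrite E.
Qed.

Lemma is_derive_snd (R : realType) (f : R * R -> R) (x y l : R) (k : 'I_2) : k != ord0 ->
  is_derive (x, y) (basis2 R k) f l <-> is_derive y 1 (fun s => f (x, s)) l.
Proof.
move=> /negPf k0.
have E : (fun t : R => f (t *: basis2 R k + (x, y))) =
    (fun t : R => f (x, t *: (1 : R) + y)).
  by apply/funext => t; rewrite coord2_basis2 k0 /= [t *: _]mulr1.
by split => /is_derive_slice H; apply/is_derive_slice; move: H; rewrite E.
Qed.

(** Fubini's theorem, integrating first in the direction of differentiation: each inner integral is
    that of the derivative of a compactly supported function. *)
Lemma integral_partial_eq0 (R : realType) (f g : R * R -> R) (k : 'I_2) (M : R) :
  (forall p, is_derive p (basis2 R k) f (g p)) -> continuous g ->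
  (forall p, M < `|p| -> f p = 0) ->
  (forall p, M < `|p| -> g p = 0) ->
  (\int[@leb2 R]_p (g p)%:E = 0)%E.
Proof.
move=> df cg f0 g0.
have ig := continuous_supp_integrable cg g0.
(* M may be negative, and the slices need a non-strict inequality on the norm. *)
have A0 : 0 < `|M| + 1 by rewrite ltr_wpDl.
have big (t : R) : `|M| + 1 <= `|t| -> M < `|t|.
  by move=> H; rewrite (le_lt_trans (ler_norm M))// (lt_le_trans _ H)// ltrDl.
case: (eqVneq k ord0) => [k0|k0].
  rewrite -(integral21_prod_meas1 ig); apply: integral0_eq => y _.
  have dfy (x : R) : is_derive x 1 (fun s : R => f (s, y : R)) (g (x, y : R)).
    by apply/is_derive_fst; rewrite -k0.
  have E : (fun s : R => f (s, y : R))^`()%classic = (fun x => g (x, y)).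
    by apply/funext => x; rewrite derive1E; exact: derive_val.
  rewrite /fubini_G.
  have := @integral_deriv_compact R (fun s => f (s, y)) _ A0.
  rewrite E; apply.
  - by move=> x; have [] := dfy x.
  - by move=> x; apply: (@continuous_comp _ _ _ (fun s => (s, y)) g); [exact: cvg_pair cvg_id (cvg_cst _)|exact: cg].
  - by move=> t /big Mt; rewrite f0// prod_normE lt_max Mt.
rewrite -(integral12_prod_meas1 ig); apply: integral0_eq => x _.
have dfx (y : R) : is_derive y 1 (fun s : R => f (x : R, s)) (g (x : R, y)).
  exact/(is_derive_snd _ _ _ _ k0).
have E : (fun s : R => f (x : R, s))^`()%classic = (fun y => g (x, y)).
  by apply/funext => y; rewrite derive1E; exact: derive_val.
rewrite /fubini_F.
have := @integral_deriv_compact R (fun s => f (x, s)) _ A0.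
rewrite E; apply.
- by move=> y; have [] := dfx y.
- by move=> y; apply: (@continuous_comp _ _ _ (fun s => (x, s)) g); [exact: cvg_pair (cvg_cst _) cvg_id|exact: cg].
- by move=> t /big Mt; rewrite f0// prod_normE lt_max Mt orbT.
Qed.

(** * Smooth functions of two variables *)

(** [smooth] cut at a finite order and peeled from the innermost derivative, so that closure under
    products and composition goes by induction on the order. *)
Fixpoint Ck (R : realType) (n : nat) (f : R * R -> R) : Prop :=
  [/\ continuous f, forall (k : 'I_2) (x : R * R), derivable f x (basis2 R k) &
      if n is n'.+1 then forall k : 'I_2, Ck n' (fun x => 'D_(basis2 R k) f x) else True].

Lemma CkW (R : realType) (n : nat) (f : R * R -> R) : Ck n.+1 f -> Ck n f.
Proof.
elim: n f => [|n IH] f [cf df Df]; split => // k; exact: IH.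
Qed.

Lemma smoothP (R : realType) (f : R * R -> R) : smooth f <-> forall n, Ck n f.
Proof.
split=> [+ n|].
  elim: n f => [|n IH] f sf; have [cf df] := sf [::].
    by split.
  split=> // k.
  (* [foldr] puts the head of the sequence outermost, so the derivative taken first is the last
     entry. *)
  apply: IH => s; have := sf (rcons s k).
  by rewrite /iter_partial foldr_rcons.
move=> Cf s; have := Cf (size s); elim/last_ind: s f {Cf} => [|s k IH] f; first by case.
rewrite size_rcons => -[cf df Df]; rewrite /iter_partial foldr_rcons.
exact: (IH _ (Df k)).
Qed.

Lemma Ck_cst (R : realType) (n : nat) (c : R) : Ck n (fun=> c).
Proof.
elim: n c => [|n IH] c; split; rewrite //; do ?by [move=> ?; exact: cvg_cst|move=> *; exact: derivable_cst].
move=> k.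
have -> : (fun x : R * R => 'D_(basis2 R k) (fun=> c) x) = (fun=> 0); last exact: IH.
by apply/funext => x; rewrite derive_cst.
Qed.

Lemma CkD (R : realType) (n : nat) (f g : R * R -> R) : Ck n f -> Ck n g -> Ck n (fun x => f x + g x).
Proof.
elim: n f g => [|n IH] f g [cf df Df] [cg dg Dg].
  split; [by move=> x; apply: cvgD; [exact: cf|exact: cg]| |exact: I].
  by move=> k x; apply: derivableD; [exact: df|exact: dg].
split; [by move=> x; apply: cvgD; [exact: cf|exact: cg]| |].
  by move=> k x; apply: derivableD; [exact: df|exact: dg].
move=> k.
have -> : (fun x => 'D_(basis2 R k) (fun x => f x + g x) x) =
   (fun x => 'D_(basis2 R k) f x + 'D_(basis2 R k) g x); last exact: (IH _ _ (Df k) (Dg k)).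
by apply/funext => x; apply: deriveD; [exact: df|exact: dg].
Qed.

Lemma CkM (R : realType) (n : nat) (f g : R * R -> R) : Ck n f -> Ck n g -> Ck n (fun x => f x * g x).
Proof.
elim: n f g => [|n IH] f g Cf Cg; have [cf df Df] := Cf; have [cg dg Dg] := Cg.
  split; [by move=> x; apply: cvgM; [exact: cf|exact: cg]| |exact: I].
  by move=> k x; apply: derivableM; [exact: df|exact: dg].
split; [by move=> x; apply: cvgM; [exact: cf|exact: cg]| |].
  by move=> k x; apply: derivableM; [exact: df|exact: dg].
move=> k.
have -> : (fun x => 'D_(basis2 R k) (fun x => f x * g x) x) =
   (fun x => f x * 'D_(basis2 R k) g x + g x * 'D_(basis2 R k) f x).
  by apply/funext => x; apply: deriveM; [exact: df|exact: dg].
by apply: CkD; [exact: (IH _ _ (CkW Cf) (Dg k))|exact: (IH _ _ (CkW Cg) (Df k))].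
Qed.

Fixpoint Ck1 (R : realType) (n : nat) (h : R -> R) : Prop :=
  (forall t : R, derivable h t 1) /\ (if n is n'.+1 then Ck1 n' h^`()%classic else True).

Lemma Ck_comp (R : realType) (n : nat) (h : R -> R) (f : R * R -> R) :
  Ck1 n h -> Ck n f -> Ck n (h \o f).
Proof.
elim: n h f => [|n IH] h f Ch Cf; have [dh Dh] := Ch; have [cf df Df] := Cf.
all: have dhf k x : is_derive x (basis2 R k) (h \o f) (h^`()%classic (f x) * 'D_(basis2 R k) f x)
  by apply: is_derive_comp_dir; [rewrite derive1E|]; exact/derivableP.
all: have chf : continuous (h \o f)
  by move=> x; apply: continuous_comp; [exact: cf|apply/differentiable_continuous/derivable1_diffP; exact: dh].
  by split; [exact: chf|move=> k x; have [] := dhf k x|exact: I].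
split; [exact: chf|by move=> k x; have [] := dhf k x|move=> k].
have -> : (fun x => 'D_(basis2 R k) (h \o f) x) =
   (fun x => (h^`()%classic \o f) x * 'D_(basis2 R k) f x).
  by apply/funext => x; apply: derive_val.
by apply: CkM (Df k); exact: (IH _ _ Dh (CkW Cf)).
Qed.

Lemma is_derive_affine (R : realType) (a b x : R) : is_derive x 1 (fun t : R => t * a + b) a.
Proof.
have H : is_derive x 1 (fun t : R => t * a) a.
  have -> : (fun t : R => t * a) = a \*: id by apply/funext => t; rewrite /= /GRing.scale /= mulrC.
  by apply: is_derive_eq; rewrite /GRing.scale /= mulr1.
have -> : (fun t : R => t * a + b) = ((fun t : R => t * a) + cst b) by apply/funext.
by apply: is_derive_eq; rewrite addr0.
Qed.

Lemma Ck_coord2 (R : realType) (n : nat) (i : 'I_2) : Ck n (fun x : R * R => coord2 x i).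
Proof.
have cc : continuous (fun x : R * R => coord2 x i).
  by rewrite /coord2; case: (i == ord0) => x; [exact: cvg_fst|exact: cvg_snd].
have dc k x : is_derive x (basis2 R k) (fun x : R * R => coord2 x i) (i == k)%:R.
  apply/is_derive_slice.
  have -> : (fun t : R => coord2 (t *: basis2 R k + x) i) = (fun t : R => t * (i == k)%:R + coord2 x i).
    apply/funext => t; rewrite coord2_basis2 /coord2.
    move: {cc} x; case: i k => [[|[|//]] ?] [[|[|//]] ?] x;
      by rewrite -!(inj_eq val_inj) /= ?mulr1 ?mulr0 ?add0r.
  exact: is_derive_affine.
case: n => [|n]; split; rewrite //; do ?by move=> k x; have [] := dc k x.
move=> k; rewrite (_ : (fun _ => _) = (fun=> (i == k)%:R)); first exact: Ck_cst.
by apply/funext => x; have := dc k x => ?; apply: derive_val.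
Qed.

(** * A smooth function that is flat at 0 *)

(** The exponential dominates powers: y^(k+1) <= (k+1)! exp(y). The induction on P carries an
    additional factor y^k, because multiplying P by X raises k by one. *)
Lemma horner_expRN_bound (R : realType) (P : {poly R}) :
  exists2 C : R, 0 <= C & forall y : R, 0 < y -> `|P.[y]| * expR (- y) <= C / y.
Proof.
suff H (k : nat) : exists2 C : R, 0 <= C & forall y : R, 0 < y -> `|P.[y]| * y ^+ k * expR (- y) <= C / y.
  by have [C C0 HC] := H 0%N; exists C => // y /HC; rewrite expr0 mulr1.
elim/poly_ind: P k => [|P c IH] k.
  by exists 0 => // y _; rewrite horner0 normr0 !mul0r.
have [C C0 HC] := IH k.+1.
exists (C + `|c| * (k.+1)`!%:R); first by rewrite addr_ge0 // mulr_ge0.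
move=> y y0; rewrite hornerD hornerMX hornerC.
have Hk : y ^+ k * expR (- y) <= (k.+1)`!%:R / y.
  rewrite expRN ler_pdivrMr ?expR_gt0// mulrC mulrA ler_pdivlMr// -exprSr.
  have := expR_ge1Dxn k (ltW y0).
  move=> H1.
  have f0 : 0 < (k.+1)`!%:R :> R by rewrite ltr0n fact_gt0.
  have : y ^+ k.+1 / (k.+1)`!%:R <= expR y by lra.
  by rewrite ler_pdivrMr.
rewrite mulrDl -mulrA (le_trans (ler_wpM2r _ (ler_normD _ _)))//.
  by rewrite mulr_ge0 ?exprn_ge0 ?expR_ge0 ?ltW.
rewrite mulrDl lerD//.
  rewrite normrM (gtr0_norm y0) -mulrA [X in _ * X]mulrA -exprS mulrA; exact: HC.
by rewrite -mulrA ler_wpM2l.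
Qed.

(** Used to differentiate, at the gluing point 0, functions extended by 0 to the left. *)
Lemma is_derive_sqr_bound (R : realType) (f : R -> R) (x C : R) :
  (\forall h \near (0 : R), `|f (h + x) - f x| <= C * h ^+ 2) -> is_derive x 1 f 0.
Proof.
move=> H.
have Hc : (fun h : R => h^-1 *: ((f \o shift x) (h *: (1 : R)) - f x)) @ 0^' --> (0 : R).
  apply/cvgr0Pnorm_lt => e e0; near=> h.
  have h0 : h != 0 by near: h; exact: nbhs_dnbhs_neq.
  have Hh : `|f (h + x) - f x| <= C * h ^+ 2 by near: h; apply: nbhs_dnbhs.
  rewrite /= [h *: _]mulr1 normrM normfV.
  rewrite mulrC ltr_pdivrMr ?normr_gt0//; apply: le_lt_trans Hh _.
  apply: (@le_lt_trans _ _ (`|C| * h ^+ 2)); first by rewrite ler_wpM2r ?sqr_ge0// ler_norm.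
  rewrite -(real_normK (num_real h)) expr2 mulrA ltr_pM2r ?normr_gt0//.
  have C0 : 0 < `|C| + 1 by rewrite ltr_wpDl.
  have : `|h| < e / (`|C| + 1).
    by near: h; apply: dnbhs0_lt; rewrite divr_gt0.
  rewrite ltr_pdivlMr// mulrDr mulr1 mulrC.
  have : 0 <= `|h| by []. lra.
by split; [apply: cvgP Hc|apply: cvg_lim Hc].
Unshelve. all: by end_near. Qed.

(* The polynomial factor makes this class of functions closed under differentiation. *)
Definition flat_exp (R : realType) (P : {poly R}) (x : R) : R :=
  if 0 < x then P.[x^-1] * expR (- x^-1) else 0.

(** For x > 0 and y = 1/x, the chain rule multiplies the exponential by y^2 (P(y) - P'(y)), again a
    polynomial in y; at 0 the function is bounded by a multiple of x^2. *)
Lemma is_derive_flat_exp (R : realType) (P : {poly R}) (x : R) :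
  is_derive x 1 (flat_exp P) (flat_exp ('X^2 * (P - P^`())) x).
Proof.
case: (ltgtP x 0) => x0.
- have E : \near x, (cst 0 : R -> R) x = flat_exp P x.
    near=> t; rewrite /flat_exp ltNge (_ : t <= 0)//; apply: ltW; near: t; exact: lt_nbhsl.
  rewrite {2}/flat_exp ltNge (ltW x0) /=.
  by split; [apply: near_eq_derivable E _|rewrite -(near_eq_derive _ E) derive_cst].
- have x1 : x != 0 by rewrite gt_eqF.
  have E : \near x, (fun t => (horner P \o GRing.inv) t * (expR \o (-%R \o GRing.inv)) t) x = flat_exp P x.
    near=> t; rewrite /flat_exp (_ : 0 < t)//; near: t; exact: lt_nbhsr.
  have dV : is_derive x 1 GRing.inv (- x ^- 2).
    by have := @is_deriveV R id x 1 1 x1 (is_derive_id _ _); rewrite /GRing.scale /= mulr1.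
  have d1 : is_derive x 1 (horner P \o GRing.inv) (P^`().[x^-1] * - x ^- 2).
    exact: (is_derive1_comp (is_derive_poly _ _) dV).
  have dN : is_derive x 1 (-%R \o GRing.inv) (- - x ^- 2) by exact: is_deriveN.
  have d2 : is_derive x 1 (expR \o (-%R \o GRing.inv)) (expR (- x^-1) * - - x ^- 2).
    exact: (is_derive1_comp (is_derive_expR _) dN).
  have d3 := is_deriveM d1 d2.
  rewrite {2}/flat_exp x0.
  split; first by apply: near_eq_derivable E _; case: d3.
  rewrite -(near_eq_derive _ E); have [_ ->] := d3.
  rewrite /= !hornerE /GRing.scale /= exprVn; ring.
(* For P X in place of P and y = 1/h, the bound C / y becomes |P(1/h)| exp(-1/h) <= C h^2. *)
- rewrite x0 {2}/flat_exp ltxx; have [C C0 HC] := horner_expRN_bound (P * 'X).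
  apply: (@is_derive_sqr_bound _ _ _ C); near=> h; rewrite addr0 /flat_exp ltxx subr0.
  case: ifPn => h0; last by rewrite normr0 mulr_ge0// sqr_ge0.
  have := HC h^-1; rewrite invr_gt0 => /(_ h0).
  have hV0 : 0 <= h^-1 by rewrite invr_ge0 ltW.
  rewrite hornerMX invrK !normrM (gtr0_norm (expR_gt0 _)) (ger0_norm hV0).
  by rewrite mulrAC ler_pdivrMr// -mulrA -expr2.
Unshelve. all: by end_near. Qed.

Lemma Ck1_flat_exp (R : realType) (n : nat) (P : {poly R}) : Ck1 n (flat_exp P).
Proof.
have d (Q : {poly R}) (x : R) := is_derive_flat_exp Q x.
elim: n P => [|n IH] P; split; rewrite //; do ?by move=> t; have [] := d P t.
rewrite (_ : (flat_exp P)^`()%classic = flat_exp ('X^2 * (P - P^`()))); first exact: IH.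
by apply/funext => t; rewrite derive1E; have [] := d P t.
Qed.

Lemma Ck1_horner (R : realType) (n : nat) (P : {poly R}) : Ck1 n (horner P).
Proof.
elim: n P => [|n IH] P; split; rewrite //; do ?by move=> t; exact: derivable_horner.
by rewrite -derivE.
Qed.

Lemma Ck1_cos_sin (R : realType) (n : nat) (a b : R) :
  Ck1 n (fun t => a * cos t + b * sin t).
Proof.
have d u v (t : R) : is_derive t 1 (fun t => u * cos t + v * sin t) (v * cos t + (- u) * sin t).
  have -> : (fun t => u * cos t + v * sin t) = (u \*: cos) + (v \*: sin) by [].
  apply: is_derive_eq; rewrite /GRing.scale /=; ring.
elim: n a b => [|n IH] a b; split; rewrite //; do ?by move=> t; have [] := d a b t.
rewrite (_ : _^`()%classic = (fun t => b * cos t + (- a) * sin t)); first exact: IH.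
by apply/funext => t; rewrite derive1E; have [] := d a b t.
Qed.

(** * Weierstrass approximation by Bernstein polynomials *)

(* De Casteljau's recursion for [sum_k C(n, k) X^k (1 - X)^(n - k) f k]. *)
Fixpoint bernstein (R : realType) (n : nat) (f : nat -> R) : {poly R} :=
  if n is n'.+1 then (1 - 'X) * bernstein n' f + 'X * bernstein n' (f \o succn)
  else (f 0%N)%:P.

(** Bernstein's argument with the binomial variance n x (1 - x), obtained from the recursion instead
    of from sums of binomial coefficients. *)
Lemma bernstein_bound (R : realType) (n : nat) (f : nat -> R) (x a C c : R) :
  0 <= x <= 1 -> (forall k, (k <= n)%N -> `|f k - a| <= c + C * (k%:R - n%:R * x) ^+ 2) ->
  `|(bernstein n f).[x] - a| <= c + C * (n%:R * x * (1 - x)).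
Proof.
move=> /andP[x0 x1].
(* The centre y is free because shifting f by one turns y into y - 1. The factor of C is the second
   moment about y of a binomial variable: its variance plus its squared bias. *)
suff H y : (forall k, (k <= n)%N -> `|f k - a| <= c + C * (k%:R - y) ^+ 2) ->
    `|(bernstein n f).[x] - a| <= c + C * (n%:R * x * (1 - x) + (n%:R * x - y) ^+ 2).
  by move=> /H; rewrite subrr expr0n addr0.
elim: n f y => [|n IH] f y Hf /=.
  by have := Hf 0%N isT; rewrite hornerC mulr0n !mul0r !add0r.
rewrite !hornerE.
have H1 := IH f y (fun k kn => Hf k (leqW kn)).
have H2 : `|(bernstein n (f \o succn)).[x] - a| <=
    c + C * (n%:R * x * (1 - x) + (n%:R * x - (y - 1)) ^+ 2).
  by apply: IH => k kn; have := Hf k.+1 kn; rewrite -natr1 opprB addrCA addrC addrAC.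
set u := (bernstein n f).[x] in H1 *; set v := (bernstein n (f \o succn)).[x] in H2 *.
have -> : (1 - x) * u + x * v - a = (1 - x) * (u - a) + x * (v - a) by ring.
apply: le_trans (ler_normD _ _) _; rewrite !normrM (ger0_norm x0) ger0_norm ?subr_ge0//.
have x1' : 0 <= 1 - x by rewrite subr_ge0.
apply: le_trans (lerD (ler_wpM2l x1' H1) (ler_wpM2l x0 H2)) _.
by rewrite -natr1 le_eqVlt; apply/orP; left; apply/eqP; ring.
Qed.

(** Uniform continuity in the shape that [bernstein_bound] consumes. The pairs with |g s - g x| >= e
    form a compact set on which (s - x)^2 is at least some d > 0; there 2 B / d times (s - x)^2
    exceeds 2 B, where B bounds |g|. *)
Lemma uniform_quadratic_modulus (R : realType) (g : R -> R) (e : R) : 0 < e -> continuous g ->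
  exists2 C : R, 0 <= C & forall s x, 0 <= s <= 1 -> 0 <= x <= 1 -> `|g s - g x| <= e + C * (s - x) ^+ 2.
Proof.
move=> e0 cg.
pose I : set R := `[0, 1]%classic.
have [B B0 HB] := continuous_bounded_on (@segment_compact R 0 1) cg.
have cG : continuous (fun p : R * R => `|g p.1 - g p.2|).
  move=> p; apply: cvg_norm; apply: cvgB.
    by apply: (@continuous_comp _ _ _ fst g); [exact: cvg_fst|exact: cg].
  by apply: (@continuous_comp _ _ _ snd g); [exact: cvg_snd|exact: cg].
pose D : set (R * R) := (I `*` I) `&` [set p : R * R | e <= `|g p.1 - g p.2|].
have cD : compact D.
  apply: compact_closedI; first by apply: compact_setX; exact: segment_compact.
  by apply: (closed_comp (D := [set y : R | e <= y])) => [p _|]; [exact: cG|exact: closed_ge].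
have cE : compact [set (p.1 - p.2) ^+ 2 | p in D].
  apply: continuous_compact => //; apply: continuous_subspaceT => p.
  by apply: cvgM; apply: cvgB; [exact: cvg_fst|exact: cvg_snd|exact: cvg_fst|exact: cvg_snd].
have nE0 : ~ [set (p.1 - p.2) ^+ 2 | p in D] 0.
  move=> [[s t] [_ /= H] /eqP]; rewrite sqrf_eq0 subr_eq0 => /eqP st.
  by move: H; rewrite st subrr normr0 leNgt e0.
have : open_nbhs 0 (~` [set (p.1 - p.2) ^+ 2 | p in D]).
  by split => //; apply: closed_openC; apply: compact_closed => //; exact: norm_hausdorff.
move=> /open_nbhs_nbhs/nbhs_ballP[d /= d0 Hd].
exists (2 * B / d); first by rewrite divr_ge0 ?mulr_ge0 ?ltW.
move=> s x s01 x01.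
have [|le] := leP `|g s - g x| e.
  by move=> /le_trans; apply; rewrite lerDl mulr_ge0 ?sqr_ge0 ?divr_ge0 ?mulr_ge0 ?ltW.
have : d <= (s - x) ^+ 2.
  rewrite leNgt; apply/negP => H; apply: (Hd ((s - x) ^+ 2)).
    by rewrite /ball/= sub0r normrN ger0_norm ?sqr_ge0.
  by exists (s, x) => //; split => /=; [split; rewrite /I/= in_itv/=|exact: ltW].
rewrite -(ler_pM2l (_ : 0 < 2 * B / d)) ?divr_gt0 ?mulr_gt0// divfK ?gt_eqF// => H.
have := HB s; rewrite /= in_itv => /(_ s01); have := HB x; rewrite /= in_itv => /(_ x01).
have := ler_normB (g s) (g x); lra.
Qed.

(** After an affine change of variable to [0, 1], the nodes are k/n and the quadratic part of the
    modulus contributes C x (1 - x) / n. *)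
Lemma weierstrass (R : realType) (g : R -> R) (T e : R) : 0 < T -> 0 < e -> continuous g ->
  exists Q : {poly R}, forall t, `|t| <= T -> `|g t - Q.[t]| <= e.
Proof.
move=> T0 e0 cg.
pose h (x : R) := g (2 * T * x - T).
have ch : continuous h.
  move=> x; apply: continuous_comp; last exact: cg.
  by apply: cvgB; [apply: cvgMr; exact: cvg_id|exact: cvg_cst].
have e20 : 0 < e / 2 by rewrite divr_gt0.
have [C C0 HC] := uniform_quadratic_modulus e20 ch.
(* Large enough for C / n <= e / 2. *)
pose n := (Num.truncn (2 * C / e)).+1.
have n0 : 0 < n%:R :> R by rewrite ltr0n.
have nC : C / n%:R <= e / 2.
  have : 2 * C / e < n%:R by exact: truncnS_gt.
  rewrite ltr_pdivrMr// => H; rewrite ler_pdivrMr//; lra.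
pose P := bernstein n (fun k => h (k%:R / n%:R)).
exists (P \Po ((2 * T)^-1 *: ('X + T%:P))) => t tT.
pose x := (t + T) / (2 * T).
have T20 : 0 < 2 * T by rewrite mulr_gt0.
have x01 : 0 <= x <= 1.
  move: tT; rewrite ler_norml => /andP[t1 t2].
  by apply/andP; split; [apply: divr_ge0; lra|rewrite ler_pdivrMr//; lra].
have -> : g t = h x by rewrite /h /x mulrC divfK ?gt_eqF// addrK.
have -> : (P \Po ((2 * T)^-1 *: ('X + T%:P))).[t] = P.[x].
  rewrite horner_comp (hornerZ _ ('X + T%:P)) (hornerD 'X) hornerX hornerC; congr horner.
  by rewrite mulrC.
rewrite distrC.
apply: le_trans (bernstein_bound (a := h x) (c := e / 2) (C := C / n%:R ^+ 2) x01 _) _.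
  move=> k kn; have kn01 : 0 <= (k%:R / n%:R : R) <= 1.
    by rewrite divr_ge0//= ler_pdivrMr// mul1r ler_nat.
  apply: le_trans (HC _ _ kn01 x01) _; rewrite lerD2l le_eqVlt; apply/orP; left; apply/eqP.
  by field; rewrite gt_eqF.
have -> : C / n%:R ^+ 2 * (n%:R * x * (1 - x)) = C / n%:R * (x * (1 - x)).
  by field; rewrite gt_eqF.
have Cn0 : 0 <= C / n%:R by rewrite divr_ge0// ltW.
have [xa xb] := andP x01.
have : x * (1 - x) <= 1 by nra.
move/(ler_wpM2l Cn0); lra.
Qed.

(** * Compactly supported functions of class C^1 and their weak derivatives *)

Definition C1supp (R : realType) (K : set (R * R)) (f : R * R -> R)
    (df : 'I_2 -> R * R -> R) : Prop :=
  [/\ continuous f, forall k, continuous (df k),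
      forall k x, is_derive x (basis2 R k) f (df k x) &
      forall x, ~ K x -> f x = 0 /\ forall k, df k x = 0].

Lemma Rintegral_supp (R : realType) (Omega : set (R * R)) (f : R * R -> R) :
  (forall x, ~ Omega x -> f x = 0) ->
  \int[@leb2 R]_(x in Omega) f x = \int[@leb2 R]_x f x.
Proof.
move=> f0; rewrite /Rintegral [in LHS]integral_mkcond; congr fine.
apply: eq_integral => x _; rewrite patchE; case: ifPn => // /negP.
by rewrite inE => /f0 ->.
Qed.

Lemma compact_plane_measurable (R : realType) (K : set (R * R)) :
  compact K -> measurable (K : set (mplane R)).
Proof.
move=> cK; rewrite -[K]setCK; apply: measurableC; apply: open_plane_measurable.
by apply: closed_openC; apply: compact_closed => //; exact: norm_hausdorff.
Qed.

Lemma compact_supp_norm (R : realType) (K : set (R * R)) : compact K ->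
  exists2 M : R, 0 < M & forall p, M < `|p| -> ~ K p.
Proof.
move=> /compact_norm_le[M M0 HM]; exists M => // p Mp /HM.
by rewrite leNgt Mp.
Qed.

Lemma continuous_compact_supp_integrable (R : realType) (K : set (R * R)) (f : R * R -> R) :
  compact K -> continuous f -> (forall x, ~ K x -> f x = 0) ->
  (@leb2 R).-integrable [set: mplane R] (fun p => (f p)%:E).
Proof.
move=> /compact_supp_norm[M _ HM] cf f0.
by apply: continuous_supp_integrable cf _ => p /HM/f0.
Qed.

(** F stands for a product, or a sum of products, and X + Y for its expansion by the Leibniz
    rule. *)
Lemma Rintegral_by_parts (R : realType) (K : set (R * R)) (k : 'I_2) (F X Y : R * R -> R) :
  compact K -> (forall x, is_derive x (basis2 R k) F (X x + Y x)) ->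
  continuous X -> continuous Y ->
  (forall x, ~ K x -> [/\ F x = 0, X x = 0 & Y x = 0]) ->
  \int[@leb2 R]_x X x = - \int[@leb2 R]_x Y x.
Proof.
move=> cK dF cX cY H0; have [M _ HM] := compact_supp_norm cK.
have iX : (@leb2 R).-integrable [set: mplane R] (fun p => (X p)%:E).
  by apply: continuous_compact_supp_integrable cK cX _ => x /H0[].
have iY : (@leb2 R).-integrable [set: mplane R] (fun p => (Y p)%:E).
  by apply: continuous_compact_supp_integrable cK cY _ => x /H0[].
apply/eqP; rewrite -addr_eq0 -RintegralD//.
rewrite /Rintegral (integral_partial_eq0 dF (M := M))//.
- by move=> x; apply: cvgD; [exact: cX|exact: cY].
- by move=> p /HM/H0[].
- by move=> p /HM/H0[_ -> ->]; rewrite addr0.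
Qed.

Lemma C1suppD (R : realType) (K : set (R * R)) f df g dg : @C1supp R K f df -> C1supp K g dg ->
  C1supp K (fun x => f x + g x) (fun k x => df k x + dg k x).
Proof.
move=> [cf cdf Df f0] [cg cdg Dg g0]; split.
- by move=> x; apply: cvgD; [exact: cf|exact: cg].
- by move=> k x; apply: cvgD; [exact: cdf|exact: cdg].
- by move=> k x; apply: is_deriveD.
- move=> x Kx; have [-> Hf] := f0 x Kx; have [-> Hg] := g0 x Kx.
  by split; rewrite ?addr0// => k; rewrite Hf Hg addr0.
Qed.

Lemma C1suppZ (R : realType) (K : set (R * R)) f df (c : R) : @C1supp R K f df ->
  C1supp K (fun x => c * f x) (fun k x => c * df k x).
Proof.
move=> [cf cdf Df f0]; split.
- by move=> x; apply: cvgM; [exact: cvg_cst|exact: cf].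
- by move=> k x; apply: cvgM; [exact: cvg_cst|exact: cdf].
- by move=> k x; exact: (is_deriveZ c (Df k x)).
- move=> x Kx; have [-> Hf] := f0 x Kx.
  by split; rewrite ?mulr0// => k; rewrite Hf mulr0.
Qed.

Lemma smooth_continuous (R : realType) (f : R * R -> R) : smooth f -> continuous f.
Proof. by move=> /(_ [::]) []. Qed.

Lemma smooth_is_derive (R : realType) (f : R * R -> R) (k : 'I_2) x : smooth f ->
  is_derive x (basis2 R k) f ('D_(basis2 R k) f x).
Proof. by move=> /(_ [::])[_ H]; exact/derivableP. Qed.

Lemma smooth_derive_continuous (R : realType) (f : R * R -> R) (k : 'I_2) : smooth f ->
  continuous (fun x => 'D_(basis2 R k) f x).
Proof. by move=> /(_ [:: k]) []. Qed.

(** Two products at once, since the real and the imaginary part of a complex product are each a sum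
    of two real products. *)
Lemma C1supp_smooth_by_parts (R : realType) (K : set (R * R)) (f g a b : R * R -> R) df dg (k : 'I_2) :
  compact K -> C1supp K f df -> C1supp K g dg -> smooth a -> smooth b ->
  \int[@leb2 R]_x (f x * 'D_(basis2 R k) a x + g x * 'D_(basis2 R k) b x) =
  - \int[@leb2 R]_x (df k x * a x + dg k x * b x).
Proof.
move=> cK [cf cdf Df f0] [cg cdg Dg g0] sa sb.
apply: (@Rintegral_by_parts _ K k (fun x => f x * a x + g x * b x)) => //.
- move=> x; have := is_deriveD (is_deriveM (Df k x) (smooth_is_derive k x sa))
    (is_deriveM (Dg k x) (smooth_is_derive k x sb)).
  move=> H; apply: is_derive_eq; rewrite /GRing.scale /=; ring.
- move=> x; apply: cvgD; apply: cvgM;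
    [exact: cf|exact: smooth_derive_continuous|exact: cg|exact: smooth_derive_continuous].
- move=> x; apply: cvgD; apply: cvgM;
    [exact: cdf|exact: smooth_continuous|exact: cdg|exact: smooth_continuous].
- move=> x Kx; have [-> Hf] := f0 x Kx; have [-> Hg] := g0 x Kx.
  by rewrite Hf Hg; split; rewrite !mul0r addr0.
Qed.

Lemma C1supp_cloc_integrable (R : realType) (Omega K : set (R * R)) (f g : R * R -> R) :
  compact K -> continuous f -> continuous g ->
  (forall x, ~ K x -> f x = 0) -> (forall x, ~ K x -> g x = 0) ->
  cloc_integrable Omega (fun x => f x +i* g x).
Proof.
move=> cK cf cg f0 g0 L cL _; split => /=;
  apply: (integrableS (E := [set: mplane R])) => //;
  do ?[exact: compact_plane_measurable]; exact: (continuous_compact_supp_integrable cK).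
Qed.

Lemma C1supp_weak_partial (R : realType) (Omega K : set (R * R)) (f g : R * R -> R) df dg (k : 'I_2) :
  compact K -> K `<=` Omega -> C1supp K f df -> C1supp K g dg ->
  weak_partial Omega k (fun x => f x +i* g x) (fun x => df k x +i* dg k x).
Proof.
move=> cK KO Hf Hg; have [cf cdf Df f0] := Hf; have [cg cdg Dg g0] := Hg.
have O0 x : ~ Omega x -> [/\ f x = 0, g x = 0, df k x = 0 & dg k x = 0].
  move=> Ox; have Kx : ~ K x by move=> /KO /Ox.
  by have [-> Hf'] := f0 x Kx; have [-> Hg'] := g0 x Kx; split.
split.
- by apply: (C1supp_cloc_integrable cK) => // x; [case/f0|case/g0].
- apply: (C1supp_cloc_integrable cK) => [||x /f0[_]|x /g0[_]]; [exact: cdf|exact: cdg|exact|exact].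
move=> psi [sa sb _ _].
(* The real part of (f + i g) psi is f Re psi + g (- Im psi), which has the shape of
   [C1supp_smooth_by_parts]. *)
have sNb : smooth (fun x => - complex.Im (psi x)).
  apply/smoothP => n; rewrite (_ : (fun _ => _) = (fun x => (-1) * complex.Im (psi x))).
    by apply: CkM; [exact: Ck_cst|exact: (smoothP _).1].
  by apply/funext => x; rewrite mulN1r.
have DN x : 'D_(basis2 R k) (fun x => - complex.Im (psi x)) x = - 'D_(basis2 R k) (fun x => complex.Im (psi x)) x.
  by apply: deriveN; have [_] := sb [::]; exact.
rewrite /cintegral -[RHS]/(_ +i* _); congr Complex.
- rewrite (@Rintegral_supp _ Omega); last by move=> x /O0[-> -> _ _] /=; rewrite !mul0r subr0.
  rewrite (@Rintegral_supp _ Omega); last by move=> x /O0[_ _ -> ->]; case: (psi x) => ? ? /=; rewrite !mul0r subr0.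
  have := C1supp_smooth_by_parts k cK Hf Hg sa sNb.
  under eq_Rintegral do rewrite DN mulrN.
  move=> ->; congr (- _); apply: eq_Rintegral => x _.
  by case: (psi x) => ? ? /=; rewrite mulrN.
- rewrite (@Rintegral_supp _ Omega); last by move=> x /O0[-> -> _ _] /=; rewrite !mul0r addr0.
  rewrite (@Rintegral_supp _ Omega); last by move=> x /O0[_ _ -> ->]; case: (psi x) => ? ? /=; rewrite !mul0r addr0.
  rewrite (C1supp_smooth_by_parts k cK Hf Hg sb sa); congr (- _); apply: eq_Rintegral => x _.
  by case: (psi x) => ? ? /=.
Qed.

(** * Compactly supported approximable functions *)

Lemma C1supp_cLfun2 (R : realType) (Omega K : set (R * R)) (f g : R * R -> R) :
  compact K -> K `<=` Omega -> continuous f -> continuous g ->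
  (forall x, ~ K x -> f x = 0) -> (forall x, ~ K x -> g x = 0) ->
  cLfun Omega 2%:E (fun x => f x +i* g x).
Proof.
move=> cK KO; suff H h : continuous h -> (forall x, ~ K x -> h x = 0) -> h \_ Omega \in Lfun (@leb2 R) 2%:E.
  by move=> cf cg f0 g0; split; exact: H.
move=> ch h0.
have -> : h \_ Omega = h.
  by apply/funext => x; rewrite patchE; case: ifPn => // /negP; rewrite inE => Ox; rewrite h0// => /KO.
rewrite inE; apply/andP; split; rewrite inE /=.
  exact: continuous_plane_measurable.
rewrite /finite_norm unlock; apply: poweR_lty.
have h2 : continuous (fun x => h x ^+ 2) by move=> x; apply: cvgM; exact: ch.
have h20 x : ~ K x -> h x ^+ 2 = 0 by move=> /h0 ->; rewrite expr0n.
have /integrableP[_] := continuous_compact_supp_integrable cK h2 h20.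
apply: le_lt_trans; rewrite le_eqVlt; apply/orP; left; apply/eqP.
apply: eq_integral => x _ /=.
by rewrite powR_mulrn// normrX.
Qed.

(* Uniform [C^1] limits of smooth functions supported in [K]: for [K] compact in [Omega] these belong to
   [H^1_0], with no need for mollifiers. *)
Definition H10supp (R : realType) (K : set (R * R)) (f : R * R -> R)
    (df : 'I_2 -> R * R -> R) : Prop :=
  C1supp K f df /\ forall e, 0 < e -> exists p : R * R -> R,
    [/\ smooth p, forall x, ~ K x -> p x = 0 &
        forall x, `|f x - p x| <= e /\ forall k, `|df k x - 'D_(basis2 R k) p x| <= e].

Lemma smoothD (R : realType) (p q : R * R -> R) : smooth p -> smooth q -> smooth (fun x => p x + q x).
Proof. by move=> /smoothP sp /smoothP sq; apply/smoothP => n; exact: CkD. Qed.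

Lemma smoothM (R : realType) (p q : R * R -> R) : smooth p -> smooth q -> smooth (fun x => p x * q x).
Proof. by move=> /smoothP sp /smoothP sq; apply/smoothP => n; exact: CkM. Qed.

Lemma smooth_cst (R : realType) (c : R) : smooth (fun=> c).
Proof. by apply/smoothP => n; exact: Ck_cst. Qed.

Lemma smooth_comp (R : realType) (h : R -> R) (p : R * R -> R) :
  (forall n, Ck1 n h) -> smooth p -> smooth (h \o p).
Proof. by move=> sh /smoothP sp; apply/smoothP => n; exact: Ck_comp. Qed.

Lemma H10suppD (R : realType) (K : set (R * R)) f df g dg : @H10supp R K f df -> H10supp K g dg ->
  H10supp K (fun x => f x + g x) (fun k x => df k x + dg k x).
Proof.
move=> [Cf Af] [Cg Ag]; split; first exact: C1suppD.
move=> e e0; have e20 : 0 < e / 2 by rewrite divr_gt0.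
have [p [sp p0 Hp]] := Af _ e20; have [q [sq q0 Hq]] := Ag _ e20.
exists (fun x => p x + q x); split; first exact: smoothD.
  by move=> x Kx; rewrite p0// q0// addr0.
move=> x; have [p1 p2] := Hp x; have [q1 q2] := Hq x; split=> [|k].
  rewrite opprD addrACA; apply: le_trans (ler_normD _ _) _; lra.
have -> : 'D_(basis2 R k) (fun x => p x + q x) x = 'D_(basis2 R k) p x + 'D_(basis2 R k) q x.
  by have := is_deriveD (smooth_is_derive k x sp) (smooth_is_derive k x sq) => -[].
have := p2 k; have := q2 k; rewrite opprD addrACA => ? ?; apply: le_trans (ler_normD _ _) _; lra.
Qed.

Lemma H10suppZ (R : realType) (K : set (R * R)) f df (c : R) : @H10supp R K f df ->
  H10supp K (fun x => c * f x) (fun k x => c * df k x).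
Proof.
move=> [Cf Af]; split; first exact: C1suppZ.
move=> e e0; have c0 : 0 < `|c| + 1 by rewrite ltr_wpDl.
have ec : 0 < e / (`|c| + 1) by rewrite divr_gt0.
have [p [sp p0 Hp]] := Af _ ec.
have Hc y : `|y| <= e / (`|c| + 1) -> `|c * y| <= e.
  rewrite ler_pdivlMr// normrM => H; have := normr_ge0 y; lra.
exists (fun x => c * p x); split; first exact: smoothM (smooth_cst c) _.
  by move=> x Kx; rewrite p0// mulr0.
move=> x; have [p1 p2] := Hp x; split=> [|k].
  by rewrite -mulrBr; exact: Hc.
have -> : 'D_(basis2 R k) (fun x => c * p x) x = c * 'D_(basis2 R k) p x.
  by have := is_deriveZ c (smooth_is_derive k x sp) => -[].
by rewrite -mulrBr; exact: Hc.
Qed.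

Lemma smooth_partial_supp (R : realType) (K : set (R * R)) (p : R * R -> R) (k : 'I_2) x :
  compact K -> (forall x, ~ K x -> p x = 0) -> ~ K x -> 'D_(basis2 R k) p x = 0.
Proof.
move=> cK p0 Kx.
have : \near x, p x = (cst 0 : R * R -> R) x.
  have : open_nbhs x (~` K).
    split=> //; apply: closed_openC; apply: compact_closed => //; exact: norm_hausdorff.
  by move=> /open_nbhs_nbhs; apply: filterS => y; exact: p0.
by move=> /near_eq_derive ->; rewrite derive_cst.
Qed.

Lemma smooth_C1supp (R : realType) (K : set (R * R)) (p : R * R -> R) :
  compact K -> smooth p -> (forall x, ~ K x -> p x = 0) ->
  C1supp K p (fun k x => 'D_(basis2 R k) p x).
Proof.
move=> cK sp p0; split.
- exact: smooth_continuous.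
- by move=> k; exact: smooth_derive_continuous.
- by move=> k x; exact: smooth_is_derive.
- by move=> x Kx; split; [exact: p0|move=> k; exact: smooth_partial_supp cK p0 Kx].
Qed.

Lemma C1supp_bounded (R : realType) (K : set (R * R)) f df : compact K -> @C1supp R K f df ->
  exists2 B, 0 < B & forall x, `|f x| <= B /\ forall k, `|df k x| <= B.
Proof.
move=> /compact_supp_norm[M _ HM] [cf cdf _ f0].
have [B0 B00 H0] := continuous_supp_bounded cf (fun p Mp => (f0 p (HM p Mp)).1).
have Hk k := continuous_supp_bounded (cdf k) (fun p Mp => (f0 p (HM p Mp)).2 k).
have [B1 B10 H1] := Hk ord0; have [B2 B20 H2] := Hk ord_max.
exists (B0 + B1 + B2); first by rewrite !addr_gt0.
move=> x; split; first by have := H0 x; lra.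
move=> k; have [->|->] : k = ord0 \/ k = ord_max.
    by case: k => [[|[|//]] ?]; [left|right]; exact: val_inj.
  by have := H1 x; lra.
by have := H2 x; lra.
Qed.

Lemma poly_antiderivative (R : numFieldType) (Q : {poly R}) :
  exists2 P : {poly R}, P.[0] = 0 & P^`() = Q.
Proof.
(* At i = 0 the coefficient is 0, because the inverse of 0 is 0. *)
exists (\poly_(i < (size Q).+1) (Q`_(i.-1) / i%:R)).
  by rewrite horner_coef0 coef_poly /= invr0 mulr0.
apply/polyP => i; rewrite coef_deriv coef_poly ltnS.
case: ltnP => [_|/(nth_default 0) ->]; last by rewrite mul0rn.
by rewrite -[LHS]mulr_natr divfK// pnatr_eq0.
Qed.

(** Approximation acts on the outer function: Q approximates g uniformly on [-T, T], and its
    antiderivative P with P(0) = 0 makes P(p) smooth and zero outside K. The gradients are compared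
    through g - Q, the values through the mean value theorem applied to G - P on the interval
    between 0 and p x. *)
Lemma H10supp_comp (R : realType) (K : set (R * R)) (G g : R -> R) (p : R * R -> R) (T : R) :
  compact K -> smooth p -> (forall x, ~ K x -> p x = 0) -> 0 < T ->
  (forall x, `|p x| <= T) -> continuous g -> G 0 = 0 ->
  (forall t : R, `|t| <= T -> is_derive t 1 G (g t)) ->
  H10supp K (fun x => G (p x)) (fun k x => g (p x) * 'D_(basis2 R k) p x).
Proof.
move=> cK sp p0 T0 pT cg G0 dG.
have [cp cdp dp pK] := smooth_C1supp cK sp p0.
split.
  split.
  - move=> x; apply: continuous_comp; first exact: cp.
    by apply/differentiable_continuous/derivable1_diffP; have [] := dG _ (pT x).
  - move=> k x; apply: cvgM; last exact: cdp.
    by apply: continuous_comp; [exact: cp|exact: cg].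
  - by move=> k x; apply: is_derive_comp_dir (dG _ (pT x)) (dp k x).
  - by move=> x /pK [-> dp0]; split=> // k; rewrite dp0 mulr0.
move=> e e0.
have [B B0 HB] := C1supp_bounded cK (smooth_C1supp cK sp p0).
(* B bounds the partial derivatives of p, and T the length of the interval used in the mean value
   theorem. *)
pose d := e / (B + T).
have BT0 : 0 < B + T by rewrite addr_gt0.
have d0 : 0 < d by rewrite divr_gt0.
have [Q HQ] := weierstrass T0 d0 cg.
have [P P0 dP] := poly_antiderivative Q.
exists (horner P \o p).
have sP : smooth (horner P \o p) by apply: smooth_comp => // n; exact: Ck1_horner.
split=> //; first by move=> x Kx /=; rewrite p0.
have dd : d * (B + T) = e by rewrite divfK ?gt_eqF.
move=> x; split; last first.
  move=> k; have := is_derive_comp_dir (is_derive_poly P (p x)) (dp k x) => -[_ ->].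
  rewrite dP -mulrBl normrM -dd; apply: ler_pM => //; first exact: HQ.
  by have [_ /(_ k)] := HB x; lra.
pose H := G - horner P.
have dH (t : R) : `|t| <= T -> is_derive t 1 H (g t - Q.[t]).
  by move=> /dG ?; rewrite -dP; exact: is_deriveB.
have H0 : H 0 = 0 by rewrite /H/= !fctE G0 P0 subr0.
rewrite -[_ - _]/(H (p x)) -[H _]subr0 -H0.
have := pT x; set y := p x => yT.
have Hc a b : `|a| <= T -> `|b| <= T -> {within `[a, b], continuous H}.
  move=> aT bT; apply: derivable_within_continuous => t; rewrite in_itv/= => /andP[ta tb].
  by have [] := dH t (ltac:(move: aT bT; rewrite !ler_norml; lra)).
have dT : d * T <= e by rewrite -dd ler_pM2l//; lra.
have fin c : `|c| <= T -> `|(g c - Q.[c]) * y| <= e.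
  by move=> cT; rewrite normrM (le_trans _ dT)// ler_pM//; exact: HQ.
have T00 : `|0 : R| <= T by rewrite normr0 ltW.
have [y0|y0|->] := ltgtP y 0; last by rewrite subrr normr0 ltW.
  have [c] := MVT y0 (fun t tI => dH t (ltac:(move: tI yT; rewrite in_itv/= !ler_norml; lra))) (Hc _ _ yT T00).
  rewrite in_itv/= => /andP[yc c0]; rewrite sub0r mulrN => E.
  have -> : H y - H 0 = (g c - Q.[c]) * y by rewrite -opprB E opprK.
  by apply: fin; move: yT; rewrite !ler_norml; lra.
have [c] := MVT y0 (fun t tI => dH t (ltac:(move: tI yT; rewrite in_itv/= !ler_norml; lra))) (Hc _ _ T00 yT).
rewrite in_itv/= subr0 => /andP[yc c0] ->.
by apply: fin; move: yT; rewrite !ler_norml; lra.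
Qed.

Lemma test_fun_supp (R : realType) (Omega K : set (R * R)) (p q : R * R -> R) :
  compact K -> K `<=` Omega -> smooth p -> smooth q ->
  (forall x, ~ K x -> p x = 0) -> (forall x, ~ K x -> q x = 0) ->
  test_fun Omega (fun x => p x +i* q x).
Proof.
move=> cK KO sp sq p0 q0.
have cl : closure [set x | p x +i* q x != 0] `<=` K.
  have /closure_id -> : closed K by apply: compact_closed => //; exact: norm_hausdorff.
  apply: closureS => x /= nz; apply: contrapT => Kx.
  by move: nz; rewrite p0// q0// eqxx.
split => //; last exact: subset_trans cl KO.
by apply: subclosed_compact cl => //; exact: closed_closure.
Qed.

Lemma normc_complex_sqr (R : realType) (x y : R) : Normc.normc (x +i* y) ^+ 2 = x ^+ 2 + y ^+ 2.
Proof. by rewrite /= sqr_sqrtr// addr_ge0 ?sqr_ge0. Qed.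

Lemma H10supp_sobolev_H10 (R : realType) (Omega K : set (R * R)) (f g : R * R -> R) df dg :
  open Omega -> compact K -> K `<=` Omega -> H10supp K f df -> H10supp K g dg ->
  sobolev_H10 Omega (fun x => f x +i* g x) (fun k x => df k x +i* dg k x).
Proof.
move=> oO cK KO [Cf Af] [Cg Ag]; have [cf cdf Df f0] := Cf; have [cg cdg Dg g0] := Cg.
split; first split.
- by apply: (C1supp_cLfun2 cK KO) => // x; [case/f0|case/g0].
- move=> k; split; last exact: (C1supp_weak_partial _ cK KO Cf Cg).
  by apply: (C1supp_cLfun2 cK KO) => // x; [case/f0 => _|case/g0 => _].
move=> eps eps0.
have [M M0 HM] := compact_supp_norm cK.
have mS : measurable (square M : set (mplane R)) by exact: square_measurable.
have fS : (@leb2 R (square M) \is a fin_num).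
  by rewrite ge0_fin_numE ?measure_ge0//; exact: square_finite.
pose m := fine (@leb2 R (square M)).
have m0 : 0 <= m by exact/fine_ge0/measure_ge0.
(* Six squares are integrated, for the real and imaginary parts of the function and of its two
   partial derivatives, so the total is at most 6 m d^2, which is less than d^2 (6 m + 1)^2 =
   eps^2. *)
pose d := eps / (6 * m + 1).
have n0 : 0 < 6 * m + 1 by lra.
have d0 : 0 < d by exact: divr_gt0.
have [p [sp p0 Hp]] := Af _ d0; have [q [sq q0 Hq]] := Ag _ d0.
exists (fun x => p x +i* q x); first exact: (test_fun_supp cK KO).
pose F x := (f x - p x) ^+ 2 + (g x - q x) ^+ 2 +
  \sum_(k < 2) ((df k x - 'D_(basis2 R k) p x) ^+ 2 + (dg k x - 'D_(basis2 R k) q x) ^+ 2).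
have -> : (fun x => (Normc.normc ((f x +i* g x) - (p x +i* q x)) ^+ 2 + \sum_(k < 2) Normc.normc ((df k x +i* dg k x) - cpartial k (fun x => p x +i* q x) x) ^+ 2)%:E) = EFin \o F.
  apply/funext => x; rewrite -[RHS]/((F x)%:E) /F -normc_complex_sqr; congr EFin.
  by congr (_ + _); apply: eq_bigr => k _; rewrite -[RHS]normc_complex_sqr.
have F0 x : 0 <= F x.
  by rewrite !addr_ge0 ?sqr_ge0 ?sumr_ge0// => k _; rewrite addr_ge0 ?sqr_ge0.
have cF : continuous F.
  have cB (u v : R * R -> R) : continuous u -> continuous v -> continuous (fun x => (u x - v x) ^+ 2).
    by move=> cu cv x; apply: cvgM; apply: cvgB; [exact: cu|exact: cv|exact: cu|exact: cv].
  have cD (u v : R * R -> R) : continuous u -> continuous v -> continuous (fun x => u x + v x).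
    by move=> cu cv x; apply: cvgD; [exact: cu|exact: cv].
  have cS (u : 'I_2 -> R * R -> R) : (forall k, continuous (u k)) ->
      continuous (fun x => \sum_(k < 2) u k x).
    move=> cu; rewrite (_ : (fun x => _) = (fun x => u ord0 x + u (lift ord0 ord0) x)); first exact: cD.
    by apply/funext => x; rewrite !big_ord_recl big_ord0 addr0.
  have cp := smooth_continuous sp; have cq := smooth_continuous sq.
  apply: (cD (fun x => (f x - p x) ^+ 2 + (g x - q x) ^+ 2)).
    by apply: (cD (fun x => (f x - p x) ^+ 2)); apply: cB.
  apply: (cS (fun k x => (df k x - 'D_(basis2 R k) p x) ^+ 2 + (dg k x - 'D_(basis2 R k) q x) ^+ 2)) => k.
  have cdp := @smooth_derive_continuous _ _ k sp; have cdq := @smooth_derive_continuous _ _ k sq.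
  by apply: (cD (fun x => (df k x - 'D_(basis2 R k) p x) ^+ 2)); apply: cB.
have bnd x : F x <= 6 * d ^+ 2.
  have S s : `|s| <= d -> s ^+ 2 <= d ^+ 2.
    by move=> sd; rewrite -(real_normK (num_real s)) ler_sqr ?nnegrE// ltW.
  rewrite /F !big_ord_recl big_ord0 addr0.
  have [/S ? Hp1] := Hp x; have [/S ? Hq1] := Hq x.
  have := S _ (Hp1 ord0); have := S _ (Hp1 (lift ord0 ord0)).
  have := S _ (Hq1 ord0); have := S _ (Hq1 (lift ord0 ord0)).
  rewrite /=; lra.
have zero x : ~ K x -> F x = 0.
  move=> Kx; have [f0x Hf] := f0 x Kx; have [g0x Hg] := g0 x Kx.
  rewrite /F f0x g0x p0// q0// big1 ?subrr ?expr0n ?addr0// => k _.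
  rewrite Hf Hg (smooth_partial_supp k cK p0 Kx) (smooth_partial_supp k cK q0 Kx).
  by rewrite subrr expr0n addr0.
apply: (@le_lt_trans _ _ (\int[@leb2 R]_(x in square M) (6 * d ^+ 2)%:E)%E).
  rewrite integral_mkcond [leRHS]integral_mkcond.
  have -> : (EFin \o F) \_ Omega = EFin \o F.
    apply/funext => x; rewrite patchE; case: ifPn => // /negP; rewrite inE => Ox /=.
    by rewrite zero// => /KO.
  apply: ge0_le_integral => //.
  - by move=> x _; rewrite lee_fin.
  - by apply/measurable_EFinP; exact: continuous_plane_measurable.
  - by apply/(measurable_restrictT _ mS); exact: measurable_cst.
  - move=> x _; rewrite patchE; case: ifPn => [_|/negP xS]; first by rewrite lee_fin.
    rewrite /= zero//; apply: HM; rewrite ltNge; apply/negP => xM; apply: xS.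
    by rewrite inE squareE.
rewrite integral_cst// -(fineK fS) -EFinM lte_fin -/m.
have -> : 6 * d ^+ 2 * m = d ^+ 2 * (6 * m) by ring.
have E : d * (6 * m + 1) = eps by rewrite divfK ?gt_eqF.
rewrite -E; move: (d) d0 => t t0; rewrite exprMn ltr_pM2l ?exprn_gt0//; nra.
Qed.

(** * Profiles of class C^1 along powers of the cutoff and along lines *)

Lemma is_derive_exprn (R : realType) (n : nat) (x : R) :
  is_derive x 1 (fun t : R => t ^+ n.+1) (n.+1%:R * x ^+ n).
Proof.
have -> : (fun t : R => t ^+ n.+1) = id ^+ n.+1 by apply/funext => t; rewrite exprfctE.
by have := is_deriveX n.+1 (is_derive_id x (1 : R)); rewrite /GRing.scale /= mulr1.
Qed.

Lemma near0_lt (R : realType) (e : R) : 0 < e -> \forall x \near (0 : R), `|x| < e.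
Proof. exact: nbhs0_lt. Qed.

Lemma near_eq_continuous (T U : topologicalType) (f g : T -> U) (x : T) :
  (\near x, f x = g x) -> {for x, continuous f} -> {for x, continuous g}.
Proof.
move=> E; rewrite /prop_for /continuous_at (nbhs_singleton E).
exact: cvg_trans (near_eq_cvg E).
Qed.

(* [Phi] may blow up at 0; raising the cutoff to a large power compensates for it. *)
Lemma power_profile_C1 (R : realType) (Phi dPhi : R -> R) (p C t0 : R) (N : nat) :
  0 < p -> 0 < t0 ->
  (forall s : R, 0 < s -> is_derive s 1 Phi (dPhi s) /\ {for s, continuous dPhi}) ->
  (forall t : R, 0 < t < t0 -> `|Phi (p * t ^+ N.+1) * t ^+ N.+1| <= C * t ^+ 2 /\
     `|p * t ^+ N.+1 * dPhi (p * t ^+ N.+1) * t ^+ N.+1| <= C * t ^+ 2) ->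
  exists2 g : R -> R, continuous g &
    forall t : R, is_derive t 1 (fun t => if 0 < t then Phi (p * t ^+ N.+1) * t ^+ N.+1 else 0) (g t).
Proof.
move=> p0 t00 HPhi HC.
set G := fun t : R => _.
pose g (t : R) := if 0 < t then
   (Phi (p * t ^+ N.+1) + p * t ^+ N.+1 * dPhi (p * t ^+ N.+1)) * (N.+1%:R * t ^+ N) else 0.
have pos (t : R) : 0 < t -> 0 < p * t ^+ N.+1 by move=> t1; rewrite mulr_gt0 ?exprn_gt0.
have dX (t : R) := is_derive_exprn N t.
have dpX (t : R) : is_derive t 1 (fun t : R => p * t ^+ N.+1) (p * (N.+1%:R * t ^+ N)).
  exact: (is_deriveZ p (dX t)).
have C0 : 0 <= C.
  have [|+ _] := HC (t0 / 2); first by apply/andP; split; lra.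
  have t2 : 0 < (t0 / 2) ^+ 2 by rewrite exprn_gt0// divr_gt0.
  by move=> /(le_trans (normr_ge0 _)); rewrite pmulr_lge0.
have gb (t : R) : 0 < t < t0 -> `|g t| <= 2 * C * N.+1%:R * t.
  move=> /[dup] /andP[t1 _] /HC[H1 H2]; rewrite /g t1.
  (* Multiplied by t, the two summands of g become N + 1 times the two quantities that [HC] bounds
     by C t^2. *)
  rewrite -(ler_pM2r t1).
  set gt := (X in `|X|); have -> : `|gt| * t = `|gt * t| by rewrite (normrM gt t) (gtr0_norm t1).
  rewrite {}/gt.
  set a := Phi _ in H1 *; set b := _ * dPhi _ in H2 *.
  have -> : (a + b) * (N.+1%:R * t ^+ N) * t = N.+1%:R * (a * t ^+ N.+1 + b * t ^+ N.+1).
    by rewrite exprSr; ring.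
  rewrite normrM ger0_norm//.
  have -> : 2 * C * N.+1%:R * t * t = N.+1%:R * (C * t ^+ 2 + C * t ^+ 2) by ring.
  rewrite ler_wpM2l//; apply: le_trans (ler_normD _ _) _; exact: lerD.
exists g.
  move=> t; case: (ltgtP t 0) => tz.
  - have E : \near t, (cst 0 : R -> R) t = g t.
      near=> s; rewrite /g ltNge (_ : s <= 0)//; apply: ltW; near: s; exact: lt_nbhsl.
    by apply: near_eq_continuous E _; exact: cvg_cst.
  - have cs : {for t, continuous (fun t : R => p * t ^+ N.+1)}.
      by apply/differentiable_continuous/derivable1_diffP; have [] := dpX t.
    have [dP cdP] := HPhi _ (pos _ tz).
    have cP : {for p * t ^+ N.+1, continuous Phi}.
      by apply/differentiable_continuous/derivable1_diffP; have [] := dP.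
    have E : \near t, (fun t => (Phi (p * t ^+ N.+1) + p * t ^+ N.+1 * dPhi (p * t ^+ N.+1)) * (N.+1%:R * t ^+ N)) t = g t.
      near=> s; rewrite /g (_ : 0 < s)//; near: s; exact: lt_nbhsr.
    apply: near_eq_continuous E _; apply: cvgM; last by apply: cvgM; [exact: cvg_cst|exact: exprn_continuous].
    apply: cvgD; first exact: (continuous_comp cs cP).
    by apply: cvgM => //; exact: (continuous_comp cs cdP).
  - suff cg0 : g x @[x --> (0 : R)] --> (0 : R).
      by rewrite tz /continuous_at (_ : g 0 = 0)// /g ltxx.
    have K0 : 0 < 2 * C * N.+1%:R + 1 by rewrite ltr_wpDl// !mulr_ge0.
    apply/cvgr0Pnorm_lt => e e0; near=> s.
    have [s0|s0] := ltP 0 s; last by rewrite /g (ltNge 0) s0 normr0.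
    have st : `|s| < t0 by near: s; exact: (near0_lt t00).
    rewrite gtr0_norm// in st.
    apply: le_lt_trans (gb s _) _; first by rewrite s0.
    have : `|s| < e / (2 * C * N.+1%:R + 1) by near: s; exact: (near0_lt (divr_gt0 e0 K0)).
    rewrite gtr0_norm// ltr_pdivlMr// mulrDr mulr1 [s * _]mulrC; lra.
move=> t; case: (ltgtP t 0) => tz.
- have E : \near t, (cst 0 : R -> R) t = G t.
    near=> s; rewrite /G ltNge (_ : s <= 0)//; apply: ltW; near: s; exact: lt_nbhsl.
  rewrite /g ltNge (ltW tz) /=.
  by split; [apply: near_eq_derivable E _|rewrite -(near_eq_derive _ E) derive_cst].
- have [dP cdP] := HPhi _ (pos _ tz).
  have E : \near t, ((Phi \o (fun t => p * t ^+ N.+1)) * (fun t => t ^+ N.+1)) t = G t.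
    near=> s; rewrite /G (_ : 0 < s)//; near: s; exact: lt_nbhsr.
  have [d1 d2] := is_deriveM (@is_derive1_comp R Phi (fun t => p * t ^+ N.+1) t _ _ dP (dpX t)) (dX t).
  split; first exact: near_eq_derivable E d1.
  by rewrite -(near_eq_derive _ E) d2 /g tz /GRing.scale /= exprS; ring.
- rewrite tz {1}/g ltxx; apply: (@is_derive_sqr_bound _ _ _ C); near=> h.
  rewrite addr0 /G ltxx subr0.
  have [h0|h0] := ltP 0 h; last by rewrite normr0 mulr_ge0// sqr_ge0.
  have ht : `|h| < t0 by near: h; exact: (near0_lt t00).
  by rewrite gtr0_norm// in ht; have [|] := HC h; first by rewrite h0.
Unshelve. all: by end_near. Qed.

Definition clip (R : realType) (T t : R) : R := Num.max (- T) (Num.min t T).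

Lemma clip_continuous (R : realType) (T : R) : continuous (clip T).
Proof.
apply: (@max_fun_continuous _ R R (cst (- T)) (id \min cst T)); first by move=> x; exact: cvg_cst.
by apply: (@min_fun_continuous _ R R id (cst T)) => x; [exact: cvg_id|exact: cvg_cst].
Qed.

Lemma clip_id (R : realType) (T t : R) : `|t| <= T -> clip T t = t.
Proof. by rewrite ler_norml => /andP[t1 t2]; rewrite /clip min_l// max_r. Qed.

Lemma clip_le (R : realType) (T t : R) : 0 <= T -> `|clip T t| <= T.
Proof.
move=> T0; rewrite /clip ler_norml le_max lexx /= ge_max ge_min lexx orbT andbT; lra.
Qed.

(* The derivative at [s = clip T t] of [s |-> Phi |U + s eta| (a + s b)], where [A + 2 B s + C s ^+ 2]
   is the square of [|U + s eta|]. Clipping makes it continuous and bounded on the whole line. *)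
Definition radial_deriv (R : realType) (Phi dPhi : R -> R) (A B C T a b t : R) : R :=
  let s := clip T t in let n := Num.sqrt (A + 2 * B * s + C * s ^+ 2) in
  dPhi n * ((B + C * s) / n) * (a + s * b) + Phi n * b.

Section radial.
Variables (R : realType) (Phi dPhi : R -> R) (A B C T : R).
Hypothesis HPhi : forall s : R, 0 < s -> is_derive s 1 Phi (dPhi s) /\ {for s, continuous dPhi}.
Hypothesis T0 : 0 <= T.
Hypothesis pos : forall t, `|t| <= T -> 0 < A + 2 * B * t + C * t ^+ 2.
Let n (t : R) := Num.sqrt (A + 2 * B * t + C * t ^+ 2).

Lemma radial_deriv_continuous (a b : R) : continuous (radial_deriv Phi dPhi A B C T a b).
Proof.
move=> t.
have cc := @clip_continuous R T t.
have s0 := pos (clip_le t T0).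
have cq : {for t, continuous (fun t => n (clip T t))}.
  apply: (@continuous_comp _ _ _ (fun t => A + 2 * B * clip T t + C * clip T t ^+ 2) Num.sqrt).
    apply: cvgD; last by apply: cvgM; [exact: cvg_cst|apply: cvgM; exact: cc].
    by apply: cvgD; [exact: cvg_cst|apply: cvgM; [exact: cvg_cst|exact: cc]].
  exact: sqrt_continuous.
have n0 : 0 < n (clip T t) by rewrite sqrtr_gt0.
have [dP cdP] := HPhi n0.
have cP : {for n (clip T t), continuous Phi}.
  by apply/differentiable_continuous/derivable1_diffP; have [] := dP.
apply: cvgD; last first.
  by apply: cvgM; [exact: (continuous_comp cq cP)|exact: cvg_cst].
apply: cvgM; last first.
  by apply: cvgD; [exact: cvg_cst|apply: cvgM; [exact: cc|exact: cvg_cst]].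
apply: cvgM; first exact: (continuous_comp cq cdP).
apply: cvgM; last by apply: cvgV; [rewrite gt_eqF|exact: cq].
by apply: cvgD; [exact: cvg_cst|apply: cvgM; [exact: cvg_cst|exact: cc]].
Qed.

Lemma radial_deriv0 (a b : R) : radial_deriv Phi dPhi A B C T a b 0 =
  dPhi (Num.sqrt A) * (B / Num.sqrt A) * a + Phi (Num.sqrt A) * b.
Proof.
by rewrite /radial_deriv clip_id ?normr0// expr0n /= !mulr0 !addr0 mul0r addr0.
Qed.

Lemma is_derive_radial (a b t : R) : `|t| <= T ->
  is_derive t 1 (fun t => Phi (Num.sqrt (A + 2 * B * t + C * t ^+ 2)) * (a + t * b))
    (radial_deriv Phi dPhi A B C T a b t).
Proof.
move=> tT; have s0 := pos tT.
have n0 : 0 < n t by rewrite sqrtr_gt0.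
have [dP _] := HPhi n0.
have dl (u v : R) : is_derive t 1 (fun t : R => u + t * v) v.
  by under eq_fun do rewrite addrC; exact: is_derive_affine.
have dq : is_derive t 1 (fun t : R => A + 2 * B * t + C * t ^+ 2) (2 * B + C * (2 * t)).
  have := is_deriveD (dl A (2 * B)) (is_deriveZ C (is_derive_exprn 1 t)).
  rewrite expr1 /GRing.scale /=.
  rewrite (_ : (_ + _) = (fun t : R => A + 2 * B * t + C * t ^+ 2))//.
  by apply/funext => x; rewrite /= !fctE [x * _]mulrC.
have dn : is_derive t 1 n ((2 * n t)^-1 * (2 * B + C * (2 * t))).
  exact: (@is_derive1_comp R Num.sqrt (fun t => A + 2 * B * t + C * t ^+ 2) t _ _ (is_derive1_sqrt s0) dq).
have H := is_deriveM (@is_derive1_comp R Phi n t _ _ dP dn) (dl a b).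
suff -> : radial_deriv Phi dPhi A B C T a b t = Phi (n t) *: b +
    (a + t * b) *: (dPhi (n t) * ((2 * n t)^-1 * (2 * B + C * (2 * t)))) by exact: H.
rewrite /radial_deriv clip_id// /GRing.scale /= -/(n t).
by field; rewrite gt_eqF.
Qed.
End radial.

Lemma positive_quadratic_near0 (R : realType) (A B C : R) : 0 < A ->
  exists2 T : R, 0 < T & forall t, `|t| <= T -> 0 < A + 2 * B * t + C * t ^+ 2.
Proof.
(* Including A in D forces |t| <= 1 on the chosen interval, so that t^2 <= |t| and the two lower
   terms together stay below A. *)
move=> A0; pose D := 2 * `|B| + `|C| + A.
have D0 : 0 < D by rewrite /D; have := normr_ge0 B; have := normr_ge0 C; lra.
exists (A / (2 * D)); first by rewrite divr_gt0// mulr_gt0.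
move=> t; rewrite ler_pdivlMr ?mulr_gt0// => tT.
have t0 : 0 <= `|t| by [].
have t1 : `|t| <= 1.
  have : `|t| * (2 * D) <= 1 * (2 * D) by apply: le_trans tT _; rewrite /D; have := normr_ge0 B; have := normr_ge0 C; lra.
  by rewrite ler_pM2r// mulr_gt0.
have H : `|2 * B * t + C * t ^+ 2| < A.
  apply: le_lt_trans (ler_normD _ _) _; rewrite [X in _ + X]normrM normrX 2!normrM (@ger0_norm _ 2)//.
  have : `|C| * `|t| ^+ 2 <= `|C| * `|t| by rewrite ler_wpM2l// expr2 ler_piMr.
  move: tT; rewrite /D => tT H.
  have : 0 <= `|t| * A by rewrite mulr_ge0// ltW.
  have := normr_ge0 B; have := normr_ge0 C; nra.
by have := ler_norm (- (2 * B * t + C * t ^+ 2)); rewrite normrN; lra.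
Qed.

(** * The function phi and the limit of Lambda *)

Section phi.
Variables (R : realType) (phi : R -> R).
Hypothesis phiP : phi_conditions phi.

Lemma phi_is_derive (s : R) : 0 < s ->
  is_derive s 1 phi (phi^`()%classic s) /\ {for s, continuous phi^`()%classic}.
Proof.
move=> s0; have [d c] := phi_C1 phiP s0; split; last exact: c.
by rewrite derive1E; exact: derivableP d.
Qed.

Lemma phi_continuous (s : R) : 0 < s -> {for s, continuous phi}.
Proof. by move=> s0; apply/differentiable_continuous/derivable1_diffP; exact: (phi_C1 phiP s0).1. Qed.

Lemma mul_phi_is_derive (s : R) : 0 < s ->
  is_derive s 1 (fun t : R => t * phi t) (phi s + s * phi^`()%classic s).
Proof.
move=> s0; have [d _] := phi_is_derive s0.
have := is_deriveM (is_derive_id s (1 : R)) d.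
by rewrite /GRing.scale /= mulr1 addrC.
Qed.

Lemma phiD_gt0 (s : R) : 0 < s -> 0 < phi s + s * phi^`()%classic s.
Proof.
move=> s0; have := phi_mul_incr phiP s0; rewrite derive1E.
by have [_ ->] := mul_phi_is_derive s0.
Qed.

Lemma mul_phi_lt (s t : R) : 0 < s -> s < t -> s * phi s < t * phi t.
Proof.
move=> s0 st.
have pos (x : R) : x \in `]s / 2, (t + 1)[ -> 0 < x.
  by rewrite in_itv/= => /andP[+ _]; apply: lt_trans; lra.
apply: (@gtr0_derive1_lt_oo R (fun t => t * phi t) (s / 2) (t + 1)) => //.
- by move=> x /pos /mul_phi_is_derive[].
- by move=> x /pos /(phi_mul_incr phiP).
- move=> x; rewrite inE => /pos x0.
  by apply/differentiable_continuous/derivable1_diffP; have [] := mul_phi_is_derive x0.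
- by rewrite in_itv/=; apply/andP; split; lra.
- by rewrite in_itv/=; apply/andP; split; lra.
Qed.

(** By condition (iii) the function s phi(s) takes arbitrarily small values; this is the boundary
    condition at 0 under which the differential inequality (iv) is integrated. *)
Lemma mul_phi_small (e : R) : 0 < e -> exists2 s : R, 0 < s & s * phi s < e.
Proof.
move=> e0; have : [set s * phi s | s in `]0, +oo[%classic] (e / 2).
  by rewrite (phi_mul_range phiP) /= in_itv/= andbT; lra.
by move=> [s /=]; rewrite in_itv/= andbT => s0 E; exists s => //; rewrite E; lra.
Qed.

(** The exponent is that of condition (iv) plus one, hence positive. The difference D between C2
    s^(r+1) / (r+1) and s phi(s) is non-decreasing near 0 by (iv), and a negative value of D would
    contradict the smallness of s phi(s) near 0. *)
Lemma mul_phi_le_powR : exists C r s0 : R, [/\ 0 < C, 0 < r, 0 < s0 &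
  forall s, 0 < s < s0 -> s * phi s <= C * s `^ r].
Proof.
have [C1 [C2 [r [s0 [[C10 C20 r1 s00] H _ _]]]]] := phi_zero_infty phiP.
have r0 : 0 < r + 1 by lra.
exists (C2 / (r + 1)), (r + 1), s0; split => //; first exact: divr_gt0.
move=> s /andP[sp ss0].
pose D (t : R) := C2 / (r + 1) * t `^ (r + 1) - t * phi t.
have dD (t : R) : 0 < t -> is_derive t 1 D (C2 * t `^ r - (phi t + t * phi^`()%classic t)).
  move=> t0; apply: is_deriveB; last exact: mul_phi_is_derive.
  have := is_deriveZ (C2 / (r + 1)) (is_derive1_powR (r + 1) t0).
  by rewrite /GRing.scale /= addrK mulrA divfK// gt_eqF.
suff : 0 <= D s by rewrite /D subr_ge0.
rewrite leNgt; apply/negP => Ds.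
have hs : 0 < s * phi s by rewrite mulr_gt0// (phi_gt0 phiP).
(* Being below - D s contradicts D e <= D s, and being below s phi(s) forces e < s. *)
have [|e e0 he] := @mul_phi_small (Num.min (- D s) (s * phi s)).
  by rewrite lt_min hs andbT; lra.
move: he; rewrite lt_min => /andP[he1 he2].
have es : e < s.
  by rewrite ltNge le_eqVlt; apply/negP => /predU1P[E|/(mul_phi_lt sp)]; [move: he2; rewrite E ltxx|lra].
have De : D e <= D s.
  have pos (x : R) : x \in `]e, s[ -> 0 < x < s0.
    by rewrite in_itv/= => /andP[? ?]; apply/andP; split; lra.
  apply: (@ger0_derive1_le R D e s _ _ true false).
  - by move=> x /pos /andP[/dD[]].
  - move=> x /pos /[dup] /andP[x0 _] xs; rewrite derive1E; have [_ ->] := dD _ x0.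
    by have /andP[_] := H _ xs; rewrite derive1E; have [_ ->] := mul_phi_is_derive x0; lra.
  - apply: derivable_within_continuous => x; rewrite in_itv/= => /andP[ex _].
    by have [] := dD x (lt_le_trans e0 ex).
  - by rewrite in_itv/= lexx ltW.
  - by rewrite in_itv/= lexx ltW.
  - exact: ltW.
have : 0 <= C2 / (r + 1) * e `^ (r + 1) by rewrite mulr_ge0 ?powR_ge0// divr_ge0// ltW.
by move: De Ds he1; rewrite [D e]/D; lra.
Qed.

(** By condition (vi), |s phi'(s) / phi(s)| is bounded on (0, 1] by its value at 1. *)
Lemma phi_log_deriv_bounded : exists2 c : R, 0 <= c &
  forall s, 0 < s <= 1 -> `|s * phi^`()%classic s| <= c * phi s.
Proof.
exists `|1 * phi^`()%classic 1 / phi 1| => // s /andP[s0 s1].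
have := phi_ratio phiP s0 s1; have p0 := phi_gt0 phiP s0.
by rewrite normrM normfV (gtr0_norm p0) ler_pdivrMr.
Qed.

(** With s = p t^(N+1) and s phi(s) <= C s^r, one has phi(s) t^(N+1) = s phi(s) / p <= (C / p) p^r
    t^((N+1) r), and the last power is at most t^2 as soon as (N+1) r >= 2 and t <= 1. The choice of
    N does not depend on p. *)
Lemma phi_profile : exists2 N : nat, (0 < N)%N & forall p : R, 0 < p ->
  exists C t0 : R, [/\ 0 < C, 0 < t0 <= 1 & forall t, 0 < t < t0 -> 0 < p * t ^+ N.+1 <= 1 /\
    phi (p * t ^+ N.+1) * t ^+ N.+1 <= C * t ^+ 2].
Proof.
have [C [r [s0 [C0 r0 s00 HC]]]] := mul_phi_le_powR.
pose N := (Num.truncn (2 / r)).+1.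
have Nr : 2 <= N.+1%:R * r.
  have : 2 / r < N%:R by exact: truncnS_gt.
  by rewrite ltr_pdivrMr// => H; rewrite -[N.+1%:R]natr1 mulrDl mul1r; lra.
exists N => // p p0.
(* The bound on t keeps p t^(N+1) below s0, for the power bound, and below 1, for the bound on s
   phi'(s) / phi(s). *)
exists (C / p * p `^ r), (Num.min 1 (Num.min (s0 / p) p^-1)); split.
- by rewrite mulr_gt0 ?powR_gt0 ?divr_gt0.
- have i0 : 0 < p^-1 by rewrite invr_gt0.
  have sp : 0 < s0 / p by exact: divr_gt0.
  by apply/andP; split; [rewrite !lt_min ltr01 sp|rewrite ge_min lexx].
move=> t; rewrite !lt_min => /and4P[t0 t1 ts tp].
have tN : 0 < t ^+ N.+1 by rewrite exprn_gt0.
have tNt : t ^+ N.+1 <= t by rewrite exprS; apply: ler_piMr; [exact: ltW|apply: exprn_ile1; exact: ltW].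
have s1 : p * t ^+ N.+1 <= p * t by rewrite ler_pM2l.
have s2 : p * t < s0 by rewrite mulrC -ltr_pdivlMr.
have s3 : p * t <= 1 by rewrite mulrC -ler_pdivlMr// div1r ltW.
split; first by rewrite mulr_gt0//= (le_trans s1).
have := HC (p * t ^+ N.+1); rewrite mulr_gt0//= => /(_ (le_lt_trans s1 s2)) H.
rewrite powRM ?(ltW p0) ?(ltW tN)// -[leLHS]mulrA in H.
have tr : (t ^+ N.+1) `^ r <= t ^+ 2.
  have -> : (t ^+ N.+1) `^ r = (t ^+ 2) `^ (N.+1%:R * r / 2).
    rewrite -(powR_mulrn N.+1 (ltW t0)) -(powR_mulrn 2 (ltW t0)) -!powRrM; congr powR.
    by rewrite mulrCA mulfV// mulr1.
  apply: ge1r_powR; last by rewrite ler_pdivlMr// mul1r.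
  by rewrite exprn_gt0//=; apply: exprn_ile1; exact: ltW.
have E : phi (p * t ^+ N.+1) * t ^+ N.+1 = p^-1 * (p * (t ^+ N.+1 * phi (p * t ^+ N.+1))).
  by rewrite mulKf ?gt_eqF// mulrC.
rewrite E mulrC ler_pdivrMr//.
have -> : C / p * p `^ r * t ^+ 2 * p = C * (p `^ r * t ^+ 2) by field; rewrite gt_eqF.
apply: le_trans H _.
by rewrite ler_pM2l// ler_pM2l ?powR_gt0.
Qed.
End phi.

Section sqrt_phi.
Variables (R : realType) (phi : R -> R).
Hypothesis phiP : phi_conditions phi.

Lemma sqrt_phi_is_derive (s : R) : 0 < s ->
  is_derive s 1 (fun t => Num.sqrt (phi t)) (phi^`()%classic s / (2 * Num.sqrt (phi s))) /\
  {for s, continuous (fun s => phi^`()%classic s / (2 * Num.sqrt (phi s)))}.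
Proof.
move=> s0; have [d c] := phi_is_derive phiP s0; have p0 := phi_gt0 phiP s0; split.
  by rewrite mulrC; apply: (@is_derive1_comp R Num.sqrt phi) d; exact: is_derive1_sqrt.
apply: cvgM; first exact: c.
apply: cvgV; first by rewrite mulf_neq0// gt_eqF// sqrtr_gt0.
apply: cvgM; first exact: cvg_cst.
apply: (@continuous_comp _ _ _ phi Num.sqrt); last exact: sqrt_continuous.
exact: phi_continuous phiP _ s0.
Qed.

(** The derivative terms are controlled by the function itself, since |s phi'(s)| <= c phi(s) near
    0. The square root costs nothing: (sqrt(phi(s)) t^(N+1))^2 = phi(s) t^(N+1) t^(N+1) <= C t^2
    t^2, because N > 0 and t < 1. *)
Lemma phi_profiles_C1 : exists2 N : nat, (0 < N)%N & forall p : R, 0 < p ->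
  (exists2 g : R -> R, continuous g & forall t : R,
    is_derive t 1 (fun t => if 0 < t then phi (p * t ^+ N.+1) * t ^+ N.+1 else 0) (g t)) /\
  (exists2 g : R -> R, continuous g & forall t : R,
    is_derive t 1 (fun t => if 0 < t then Num.sqrt (phi (p * t ^+ N.+1)) * t ^+ N.+1 else 0) (g t)).
Proof.
have [N N0 HN] := phi_profile phiP; have [c c0 Hc] := phi_log_deriv_bounded phiP.
exists N => // p p0; have [C [t0 [C0 /andP[t00 t01] HC]]] := HN _ p0.
split.
- apply: (@power_profile_C1 R phi phi^`()%classic p (C * (1 + c)) t0) => //.
    by move=> s; exact: phi_is_derive phiP s.
  move=> t tt; have [/[dup] /andP[s0 _] sI Ht] := HC _ tt.
  have [ta tb] := andP tt.
  have tN0 : 0 < t ^+ N.+1 by rewrite exprn_gt0.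
  have f0 := phi_gt0 phiP s0; have := Hc _ sI.
  set s := p * _ in s0 f0 sI Ht *; move=> H.
  have Ct : 0 <= C * t ^+ 2 by rewrite mulr_ge0 ?sqr_ge0// ltW.
  rewrite [C * _ * _]mulrAC.
  split; first by rewrite gtr0_norm ?mulr_gt0//; nra.
  rewrite normrM (gtr0_norm tN0); apply: le_trans (ler_wpM2r (ltW tN0) H) _; nra.
- apply: (@power_profile_C1 R (fun t => Num.sqrt (phi t)) (fun s => phi^`()%classic s / (2 * Num.sqrt (phi s)))
    p (Num.sqrt C * (1 + c)) t0) => //.
    by move=> s; exact: sqrt_phi_is_derive s.
  move=> t tt; have [/[dup] /andP[s0 _] sI Ht] := HC _ tt.
  have [ta tb] := andP tt.
  have tN0 : 0 < t ^+ N.+1 by rewrite exprn_gt0.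
  have f0 := phi_gt0 phiP s0; have := Hc _ sI.
  set s := p * _ in s0 f0 sI Ht *; move=> H.
  have sq0 : 0 < Num.sqrt (phi s) by rewrite sqrtr_gt0.
  have tN2 : t ^+ N.+1 <= t ^+ 2.
    by apply: ler_wiXn2l => //; [exact: ltW|exact: le_trans (ltW tb) t01].
  have B : Num.sqrt (phi s) * t ^+ N.+1 <= Num.sqrt C * t ^+ 2.
    have l0 : 0 <= Num.sqrt (phi s) * t ^+ N.+1 by rewrite mulr_ge0 ?sqrtr_ge0 ?(ltW tN0).
    have r0 : 0 <= Num.sqrt C * t ^+ 2 by rewrite (mulr_ge0 (sqrtr_ge0 _) (sqr_ge0 _)).
    rewrite -ler_sqr ?nnegrE//.
    rewrite !exprMn !sqr_sqrtr ?(ltW f0) ?(ltW C0)//.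
    rewrite [leLHS](_ : _ = phi s * t ^+ N.+1 * t ^+ N.+1); last by rewrite -mulrA -expr2.
    rewrite [leRHS](_ : _ = C * t ^+ 2 * t ^+ 2); last by rewrite -mulrA -expr2.
    by apply: ler_pM => //; rewrite ?mulr_ge0 ?ltW.
  have Ct : 0 <= Num.sqrt C * t ^+ 2 by rewrite mulr_ge0 ?sqr_ge0 ?sqrtr_ge0.
  rewrite [Num.sqrt C * _ * _]mulrAC.
  split; first by rewrite gtr0_norm ?mulr_gt0//; nra.
  have E : `|s * (phi^`()%classic s / (2 * Num.sqrt (phi s)))| <= c * Num.sqrt (phi s).
    rewrite mulrA normrM normfV (@gtr0_norm _ (2 * _)) ?mulr_gt0//.
    rewrite ler_pdivrMr ?mulr_gt0//; apply: le_trans H _.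
    rewrite -{1}(sqr_sqrtr (ltW f0)); nra.
  rewrite normrM (gtr0_norm tN0); apply: le_trans (ler_wpM2r (ltW tN0) E) _; nra.
Qed.
End sqrt_phi.

Section Lambda.
Variables (R : realType) (phi Lambda : R -> R).
Hypothesis phiP : phi_conditions phi.
Hypothesis LambdaP : is_Lambda phi Lambda.
Let k (s : R) := s * Num.sqrt (phi s).

(** Transfers the monotonicity of s phi(s) to s sqrt(phi(s)). *)
Lemma mul_sqrt_phiE (s : R) : 0 < s -> k s = Num.sqrt (s * (s * phi s)).
Proof.
by move=> s0; rewrite mulrA -expr2 sqrtrM ?sqr_ge0// sqrtr_sqr gtr0_norm.
Qed.

Lemma mul_sqrt_phi_lt (s t : R) : 0 < s -> s < t -> k s < k t.
Proof.
move=> s0 st; have t0 := lt_trans s0 st.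
have hs : 0 < s * phi s by rewrite mulr_gt0// (phi_gt0 phiP).
have H := mul_phi_lt phiP s0 st.
rewrite !mul_sqrt_phiE// ltr_sqrt ?mulr_gt0 ?(phi_gt0 phiP)//.
by apply: ltr_pM => //; exact: ltW.
Qed.

Lemma mul_sqrt_phi_unbounded (A : R) : exists2 s0 : R, 1 <= s0 & forall s, s0 <= s -> A <= k s.
Proof.
have p1 : 0 < phi 1 by exact: (phi_gt0 phiP).
(* For s >= 1 the square of k s is s (s phi(s)) >= s phi(1). *)
exists (1 + `|A| ^+ 2 / phi 1); first by rewrite lerDl divr_ge0 ?sqr_ge0 ?ltW.
move=> s Hs; have s1 : 1 <= s.
  by apply: le_trans Hs; rewrite lerDl divr_ge0 ?sqr_ge0 ?ltW.
have s0 : 0 < s by exact: lt_le_trans s1.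
apply: le_trans (ler_norm A) _; rewrite mul_sqrt_phiE// -(sqrtr_sqr A) ler_wsqrtr//.
apply: (@le_trans _ _ (s * phi 1)).
  by rewrite -ler_pdivrMr// -(real_normK (num_real A)); lra.
rewrite ler_wpM2l ?(ltW s0)//.
have [->|] := eqVneq s 1; first by rewrite mul1r.
move=> ns; apply/ltW; rewrite -[ltLHS]mul1r; apply: mul_phi_lt => //.
by rewrite lt_neqAle eq_sym ns.
Qed.

Lemma mul_sqrt_phi_onto (s1 y : R) : 0 < s1 -> k s1 <= y -> exists2 s, s1 <= s & k s = y.
Proof.
move=> s10 ky; have [s2 s21 H] := mul_sqrt_phi_unbounded y.
have m1 : s1 <= Num.max s1 s2 by rewrite le_max lexx.
have ky2 : y <= k (Num.max s1 s2) by apply: H; rewrite le_max lexx orbT.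
have [||c] := @IVT R k s1 (Num.max s1 s2) y m1.
- apply: derivable_within_continuous => s; rewrite in_itv/= => /andP[ss _].
  have s0 : 0 < s by exact: lt_le_trans ss.
  by have [d _] := sqrt_phi_is_derive phiP s0; have [] := is_deriveM (is_derive_id s (1 : R)) d.
- by rewrite ge_min ky /= le_max ky2 orbT.
by rewrite in_itv/= => /andP[sc _] kc; exists c.
Qed.

Let q (s : R) := s * phi^`()%classic s / phi s.

Lemma Lambda_mul_sqrt_phi (s : R) : 0 < s -> Lambda (k s) = - (q s / (q s + 2)).
Proof.
move=> s0; rewrite /k LambdaP//; congr (- _).
have p0 := phi_gt0 phiP s0; have := phiD_gt0 phiP s0; rewrite /q => H.
field; rewrite !gt_eqF//; lra.
Qed.

Lemma phi_ratio_gtN1 (s : R) : 0 < s -> -1 < q s.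
Proof.
move=> s0; have p0 := phi_gt0 phiP s0; have H := phiD_gt0 phiP s0.
by rewrite /q ltr_pdivlMr// mulN1r; lra.
Qed.

(** Composing with t -> max(a, t) makes f monotone on the whole line without changing it near
    infinity. *)
Lemma nondecreasing_cvgr_from (f : R -> R) (a b : R) :
  (forall x y, a <= x -> x <= y -> f x <= f y) -> (forall x, a <= x -> f x <= b) ->
  cvg (f t @[t --> +oo]).
Proof.
move=> fm fb.
have H : (fun t => f (Num.max a t)) t @[t --> +oo] --> sup (range (fun t => f (Num.max a t))).
  apply: nondecreasing_cvgr.
    by move=> x y xy; apply: fm; [rewrite le_max lexx|rewrite ge_max !le_max lexx xy orbT].
  by exists b => _ [t _ <-]; apply: fb; rewrite le_max lexx.
apply/cvg_ex; exists (sup (range (fun t => f (Num.max a t)))).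
apply: cvg_trans H; apply: near_eq_cvg; near=> t.
by rewrite max_r//; near: t; exact: nbhs_pinfty_ge.
Unshelve. all: by end_near. Qed.

Lemma ratio_le (x y : R) : -1 < x -> x <= y -> x / (x + 2) <= y / (y + 2).
Proof.
move=> x1 xy; rewrite ler_pdivrMr; last lra.
rewrite mulrAC ler_pdivlMr; last lra.
nra.
Qed.

(** Condition (v) fixes the sign of q = s phi'(s) / phi(s) beyond s1, so the monotonicity of |q| in
    (vi) becomes that of q. Since q > -1 by (ii), the map q -> q / (q + 2) is increasing on the
    range of q and bounded there on the relevant side. *)
Lemma Lambda_cvg : cvg (Lambda t @[t --> +oo]).
Proof.
have [_ [_ [_ [s0 [[_ _ _ s00] _ _ [s1 s01 sgn]]]]]] := phi_zero_infty phiP.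
have s10 : 0 < s1 by exact: lt_trans s01.
have par y : k s1 <= y -> exists2 s, s1 <= s & y = k s.
  by move=> /(mul_sqrt_phi_onto s10)[s ss <-]; exists s.
have mono s t : s1 <= s -> s1 <= t -> k s <= k t -> s <= t.
  move=> ss st; rewrite leNgt => kk; rewrite leNgt; apply: contra kk.
  by apply: mul_sqrt_phi_lt; exact: lt_le_trans st.
have pos s : s1 <= s -> 0 < s by exact: lt_le_trans.
case: sgn => sgn.
- have q0 s : s1 <= s -> 0 <= q s.
    move=> ss; apply: divr_ge0; last exact: ltW (phi_gt0 phiP (pos _ ss)).
    by apply: mulr_ge0; [exact: ltW (pos _ ss)|exact: sgn].
  rewrite -(_ : (fun t => - - Lambda t) = Lambda); last by apply/funext => t; rewrite opprK.
  apply: is_cvgN; apply: (@nondecreasing_cvgr_from (fun t => - Lambda t) (k s1) 1).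
    move=> x y kx xy; have [s ss xs] := par _ kx; have [t st yt] := par _ (le_trans kx xy).
    rewrite xs yt in xy *; rewrite !Lambda_mul_sqrt_phi ?pos// !opprK.
    have := phi_ratio phiP (pos _ ss) (mono _ _ ss st xy); rewrite -/(q s) -/(q t).
    rewrite !ger0_norm ?q0// => qq; apply: ratio_le qq; exact: phi_ratio_gtN1 (pos _ ss).
  move=> x /par[s ss ->]; rewrite Lambda_mul_sqrt_phi ?pos// opprK; have := q0 _ ss => q1.
  rewrite ler_pdivrMr; lra.
- have q0 s : s1 <= s -> q s <= 0.
    move=> ss; rewrite /q pmulr_lle0 ?invr_gt0; last by apply: (phi_gt0 phiP); exact: pos.
    by rewrite pmulr_rle0 ?pos// sgn.
  apply: (@nondecreasing_cvgr_from Lambda (k s1) 1).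
    move=> x y kx xy; have [s ss xs] := par _ kx; have [t st yt] := par _ (le_trans kx xy).
    rewrite xs yt in xy *; rewrite !Lambda_mul_sqrt_phi ?pos//.
    have := phi_ratio phiP (pos _ ss) (mono _ _ ss st xy); rewrite -/(q s) -/(q t).
    rewrite !ler0_norm ?q0// lerN2 => qq.
    by rewrite lerN2; apply: ratio_le qq; exact: phi_ratio_gtN1 (pos _ st).
  move=> x /par[s ss ->]; rewrite Lambda_mul_sqrt_phi ?pos//.
  have := phi_ratio_gtN1 (pos _ ss); have := q0 _ ss => q1 q2.
  rewrite -mulNr ler_pdivrMr; lra.
Qed.

Lemma Lambda_infty_cvg :
  Lambda (k n.+1%:R) @[n --> \oo] --> Lambda_infty Lambda.
Proof.
have H : Lambda t @[t --> +oo] --> Lambda_infty Lambda by exact: Lambda_cvg.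
apply: (@cvg_comp _ _ _ (fun n => k n.+1%:R) Lambda _ (+oo%R : set_system R)) => //.
apply/cvgryPge => A; have [s0 s01 Hs] := mul_sqrt_phi_unbounded A.
near=> n; apply: Hs; apply: (@le_trans _ _ n%:R); last by rewrite ler_nat.
near: n; exact: nbhs_infty_ger.
Unshelve. all: by end_near. Qed.
End Lambda.

(** * Cutoffs *)

(** With f(t) = e exp(-1/t) for t > 0 and f = 0 elsewhere, this is f(1 - f(1 - t)). As f(1) = 1, f =
    0 on the left of 0 and f >= 1 on the right of 1, the composition is a smooth step written
    without any quotient. *)
Definition smooth_step (R : realType) (t : R) : R :=
  expR 1 * flat_exp 1 (1 - expR 1 * flat_exp 1 (1 - t)).

Lemma flat_exp1E (R : realType) (t : R) :
  flat_exp 1 t = if 0 < t then expR (- t^-1) else 0.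
Proof. by rewrite /flat_exp hornerC mul1r. Qed.

Lemma flat_exp1_ge0 (R : realType) (t : R) : 0 <= flat_exp 1 t.
Proof. by rewrite flat_exp1E; case: ifP => // _; exact: expR_ge0. Qed.

Lemma flat_exp1_ge (R : realType) (t : R) : 1 <= t -> 1 <= expR 1 * flat_exp 1 t.
Proof.
move=> t1; have t0 : 0 < t by exact: lt_le_trans t1.
rewrite flat_exp1E t0 -expRD -[leLHS]expR0 ler_expR.
by rewrite subr_ge0 invf_le1.
Qed.

Lemma flat_exp1_le (R : realType) (t : R) : t <= 1 -> expR 1 * flat_exp 1 t <= 1.
Proof.
move=> t1; rewrite flat_exp1E; case: ifP => t0; last by rewrite mulr0.
rewrite -expRD -[leRHS]expR0 ler_expR subr_le0.
by rewrite -[leLHS]invr1 lef_pV2// posrE.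
Qed.

Lemma smooth_step0 (R : realType) (t : R) : t <= 0 -> smooth_step t = 0.
Proof.
move=> t0; rewrite /smooth_step; have H : 1 <= expR 1 * flat_exp 1 (1 - t).
  by apply: flat_exp1_ge; lra.
by rewrite [flat_exp 1 _]flat_exp1E ltNge subr_le0 H mulr0.
Qed.

Lemma smooth_step1 (R : realType) (t : R) : 1 <= t -> smooth_step t = 1.
Proof.
move=> t1; rewrite /smooth_step [flat_exp 1 (1 - t)]flat_exp1E ltNge subr_le0 t1 /=.
by rewrite mulr0 subr0 flat_exp1E ltr01 invr1 -expRD subrr expR0.
Qed.

Lemma smooth_step_ge0 (R : realType) (t : R) : 0 <= smooth_step t.
Proof. by rewrite mulr_ge0 ?expR_ge0 ?flat_exp1_ge0. Qed.

Lemma smooth_step_le1 (R : realType) (t : R) : smooth_step t <= 1.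
Proof.
by apply: flat_exp1_le; rewrite gerBl mulr_ge0 ?expR_ge0 ?flat_exp1_ge0.
Qed.

Lemma smooth_smooth_step (R : realType) (p : R * R -> R) : smooth p -> smooth (fun x => smooth_step (p x)).
Proof.
have sf q : smooth q -> smooth (fun x : R * R => expR 1 * flat_exp 1 (q x)).
  move=> sq; apply: smoothM (smooth_cst _) _; apply: (smooth_comp (h := flat_exp 1)) => // n.
  exact: Ck1_flat_exp.
have sB q : smooth q -> smooth (fun x : R * R => 1 - q x).
  move=> sq; rewrite (_ : (fun x => _) = (fun x => 1 + (-1) * q x)).
    by apply: smoothD (smooth_cst _) _; exact: smoothM (smooth_cst _) _.
  by apply/funext => x; rewrite mulN1r.
by move=> sp; apply: (sf (fun x => 1 - expR 1 * flat_exp 1 (1 - p x))); apply/sB/(sf (fun x => 1 - p x))/sB.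
Qed.

(** The transition zones lie inside the rectangle and have width 1 / c. *)
Definition cutoff (R : realType) (c l1 u1 l2 u2 : R) (x : R * R) : R :=
  (smooth_step (c * (x.1 - l1)) * smooth_step (c * (u1 - x.1))) *
  (smooth_step (c * (x.2 - l2)) * smooth_step (c * (u2 - x.2))).

Lemma smooth_affine (R : realType) (a b1 b2 : R) : smooth (fun x : R * R => a + (b1 * x.1 + b2 * x.2)).
Proof.
have sc i : smooth (fun x : R * R => coord2 x i) by apply/smoothP => n; exact: Ck_coord2.
apply: smoothD (smooth_cst _) _; apply: smoothD; apply: smoothM; do ?exact: smooth_cst.
- exact: (sc ord0).
- exact: (sc (lift ord0 ord0)).
Qed.

Section cutoff.
Variables (R : realType) (c l1 u1 l2 u2 : R).
Hypothesis c0 : 0 < c.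

Lemma smooth_cutoff : smooth (cutoff c l1 u1 l2 u2).
Proof.
have sa a b1 b2 (p : R * R -> R) : p =1 (fun x => a + (b1 * x.1 + b2 * x.2)) -> smooth (fun x => smooth_step (p x)).
  by move=> /funext ->; apply: smooth_smooth_step; exact: smooth_affine.
apply: smoothM; apply: smoothM.
- by apply: (sa (- (c * l1)) c 0) => x; ring.
- by apply: (sa (c * u1) (- c) 0) => x; ring.
- by apply: (sa (- (c * l2)) 0 c) => x; ring.
- by apply: (sa (c * u2) 0 (- c)) => x; ring.
Qed.

Lemma cutoff_ge0 (x : R * R) : 0 <= cutoff c l1 u1 l2 u2 x.
Proof. by apply: mulr_ge0; apply: mulr_ge0; exact: smooth_step_ge0. Qed.

Lemma cutoff_le1 (x : R * R) : cutoff c l1 u1 l2 u2 x <= 1.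
Proof.
have H (a b : R) : 0 <= a <= 1 -> 0 <= b <= 1 -> 0 <= a * b <= 1.
  by move=> /andP[? ?] /andP[? ?]; rewrite mulr_ge0//= mulr_ile1.
have S (t : R) : 0 <= smooth_step t <= 1 by rewrite smooth_step_ge0 smooth_step_le1.
by have /andP[] := H _ _ (H _ _ (S (c * (x.1 - l1))) (S (c * (u1 - x.1))))
  (H _ _ (S (c * (x.2 - l2))) (S (c * (u2 - x.2)))).
Qed.

Lemma cutoff_eq0 (x : R * R) : ~ (`[l1, u1]%classic `*` `[l2, u2]%classic) x ->
  cutoff c l1 u1 l2 u2 x = 0.
Proof.
have S (t : R) : t < 0 -> smooth_step (c * t) = 0.
  by move=> t0; rewrite smooth_step0// pmulr_rle0// ltW.
rewrite /setX /= !in_itv/= => /not_andP[]/negP; rewrite negb_and -!ltNge => /orP[] H.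
all: rewrite /cutoff.
- by rewrite S ?subr_lt0// !mul0r.
- by rewrite [X in _ * X * _]S ?subr_lt0// !(mulr0, mul0r).
- by rewrite [X in _ * (X * _)]S ?subr_lt0// !(mulr0, mul0r).
- by rewrite [X in _ * (_ * X)]S ?subr_lt0// !(mulr0, mul0r).
Qed.

Lemma cutoff_eq1 (x : R * R) : l1 + c^-1 <= x.1 <= u1 - c^-1 -> l2 + c^-1 <= x.2 <= u2 - c^-1 ->
  cutoff c l1 u1 l2 u2 x = 1.
Proof.
have S (t : R) : c^-1 <= t -> smooth_step (c * t) = 1.
  by move=> tc; rewrite smooth_step1// mulrC -ler_pdivrMr// div1r.
move=> /andP[a1 a2] /andP[a3 a4].
by rewrite /cutoff !S ?mulr1//; lra.
Qed.
End cutoff.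

(** Since [smooth_step] vanishes at 0, every cutoff is 0 on the boundary of the rectangle, so the
    limit at every point is the indicator of the open rectangle. *)
Lemma cutoff_cvg (R : realType) (l1 u1 l2 u2 : R) (x : R * R) :
  cutoff n.+1%:R l1 u1 l2 u2 x @[n --> \oo] -->
  (\1_(`]l1, u1[%classic `*` `]l2, u2[%classic) x : R).
Proof.
rewrite indicE; have [|] := boolP (x \in _).
  rewrite inE /setX/= !in_itv/= => -[/andP[a1 a2] /andP[a3 a4]].
  pose d := Num.min (Num.min (x.1 - l1) (u1 - x.1)) (Num.min (x.2 - l2) (u2 - x.2)).
  have d0 : 0 < d by rewrite !lt_min !subr_gt0 a1 a2 a3 a4.
  apply: cvg_near_cst; near=> n.
  have nd : n.+1%:R^-1 <= d.
    rewrite -[d]invrK lef_pV2 ?posrE ?invr_gt0//.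
    by apply: (@le_trans _ _ n%:R); [near: n; exact: nbhs_infty_ger|rewrite ler_nat].
  move: nd; rewrite !le_min => /andP[/andP[h1 h2] /andP[h3 h4]].
  have L1 (e s t : R) : e <= s - t -> t + e <= s by lra.
  have L2 (e s t : R) : e <= s - t -> t <= s - e by lra.
  apply: cutoff_eq1; first exact: ltr0Sn.
    by apply/andP; split; [exact: L1|exact: L2].
  by apply/andP; split; [exact: L1|exact: L2].
move=> /negP; rewrite inE /setX/= !in_itv/= => H.
suff E n : cutoff n.+1%:R l1 u1 l2 u2 x = 0 by under eq_fun do rewrite E; exact: cvg_cst.
have S (t : R) : t <= 0 -> smooth_step (n.+1%:R * t) = 0.
  by move=> t0; rewrite smooth_step0// pmulr_rle0.
move: H => /not_andP[]/negP; rewrite negb_and -!leNgt => /orP[] H.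
all: rewrite /cutoff.
- by rewrite S ?subr_le0// !mul0r.
- by rewrite [X in _ * X * _]S ?subr_le0// !(mulr0, mul0r).
- by rewrite [X in _ * (X * _)]S ?subr_le0// !(mulr0, mul0r).
- by rewrite [X in _ * (_ * X)]S ?subr_le0// !(mulr0, mul0r).
Unshelve. all: by end_near. Qed.

(** * Almost everywhere bounded sequences and dominated convergence *)

Lemma leb2_ae_mono (R : realType) (P Q : R * R -> Prop) : (forall x, P x -> Q x) ->
  {ae @leb2 R, forall x, P x} -> {ae @leb2 R, forall x, Q x}.
Proof. by move=> PQ [A [mA A0 sA]]; exists A; split=> // x /= nQ; apply: sA => /= /PQ. Qed.

Lemma leb2_ae_mono2 (R : realType) (P Q S : R * R -> Prop) : (forall x, P x -> Q x -> S x) ->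
  {ae @leb2 R, forall x, P x} -> {ae @leb2 R, forall x, Q x} -> {ae @leb2 R, forall x, S x}.
Proof.
have FF : Filter (almost_everywhere (@leb2 R)) by exact: ae_filter_ringOfSetsType.
by move=> PQS; exact: filterS2.
Qed.

(** One null set and one bound serve all n. The notion is stable under sums and products, and a
    single function is treated as a constant sequence. *)
Definition ae_bounded_seq (R : realType) (Omega : set (R * R)) (F : nat -> R * R -> R) : Prop :=
  (forall n, measurable_fun (Omega : set (mplane R)) (F n)) /\
  exists M : R, {ae @leb2 R, forall x, Omega x -> forall n, `|F n x| <= M}.

Lemma ae_bounded_seqD (R : realType) (Omega : set (R * R)) F G : @ae_bounded_seq R Omega F ->
  ae_bounded_seq Omega G -> ae_bounded_seq Omega (fun n x => F n x + G n x).
Proof.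
move=> [mF [M HM]] [mG [N HN]]; split; first by move=> n; exact: measurable_funD.
exists (M + N); apply: leb2_ae_mono2 HM HN => x HF HG Ox n.
by apply: le_trans (ler_normD _ _) _; apply: lerD; [exact: HF|exact: HG].
Qed.

Lemma ae_bounded_seqM (R : realType) (Omega : set (R * R)) F G : @ae_bounded_seq R Omega F ->
  ae_bounded_seq Omega G -> ae_bounded_seq Omega (fun n x => F n x * G n x).
Proof.
move=> [mF [M HM]] [mG [N HN]]; split; first by move=> n; exact: measurable_funM.
exists (M * N); apply: leb2_ae_mono2 HM HN => x HF HG Ox n.
by rewrite normrM ler_pM//; [exact: HF|exact: HG].
Qed.

Lemma ae_bounded_seq_cst (R : realType) (Omega : set (R * R)) (c : R) : ae_bounded_seq Omega (fun _ _ => c).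
Proof.
split; first by move=> n; exact: measurable_cst.
by exists `|c|; exact: aeW.
Qed.

Lemma ae_bounded_seq_sum (R : realType) (Omega : set (R * R)) (I : finType) (F : I -> nat -> R * R -> R) :
  (forall i, ae_bounded_seq Omega (F i)) -> ae_bounded_seq Omega (fun n x => \sum_i F i n x).
Proof.
move=> HF.
suff H (s : seq I) : ae_bounded_seq Omega (fun n x => \sum_(i <- s) F i n x) by exact: H.
elim: s => [|i s IH].
  rewrite (_ : (fun n x => _) = (fun _ _ => 0)); first exact: ae_bounded_seq_cst.
  by apply/funext => n; apply/funext => x; rewrite big_nil.
rewrite (_ : (fun n x => _) = (fun n x => F i n x + \sum_(i <- s) F i n x)); first exact: ae_bounded_seqD.
by apply/funext => n; apply/funext => x; rewrite big_cons.
Qed.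

Lemma ae_bounded_seq_continuous (R : realType) (Omega : set (R * R)) (M : R) (F : nat -> R * R -> R) :
  (forall n, continuous (F n)) -> (forall n x, `|F n x| <= M) -> ae_bounded_seq Omega F.
Proof.
move=> cF bF; split.
  by move=> n; apply: measurable_funS (continuous_plane_measurable (cF n)).
by exists M; apply: aeW => x _ n; exact: bF.
Qed.

Lemma ae_bounded_seq_Linfty (R : realType) (Omega : set (R * R)) (f : R * R -> R) : open Omega ->
  f \_ Omega \in Lfun (@leb2 R) +oo%E -> ae_bounded_seq Omega (fun _ => f).
Proof.
move=> oO; rewrite inE => /andP[]; rewrite !inE /= => mf nf.
have mO : measurable (Omega : set (mplane R)) by exact: open_plane_measurable.
split; first by move=> _; exact/(measurable_restrictT _ mO).
(* The norm is an essential supremum only when the total measure is positive; in the other case the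
   whole plane is a null set. *)
move: nf; rewrite /finite_norm unlock; case: ifPn => [_|].
  have := @ess_sup_ge _ _ _ (@leb2 R) (abse \o (EFin \o f \_ Omega)).
  case: (ess_sup _ _) => [r| |] //= H _; first exists r; last exists 0.
    by apply: leb2_ae_mono H => x; rewrite lee_fin patchE => + Ox n; rewrite mem_set.
  by apply: leb2_ae_mono H => x; rewrite leeNy_eq.
rewrite -leNgt measure_le0 => /eqP T0 _; exists 0.
by exists [set: mplane R]; split.
Qed.

(** The common bound, restricted to a square that contains K, is the dominating function. For a
    constant sequence the first conclusion is a criterion of integrability. *)
Lemma dominated_cvg_supp (R : realType) (Omega K : set (R * R)) (F : nat -> R * R -> R) (f : R * R -> R) :
  open Omega -> compact K -> ae_bounded_seq Omega F ->
  (forall n x, Omega x -> ~ K x -> F n x = 0) ->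
  (forall x, Omega x -> F n x @[n --> \oo] --> f x) ->
  (@leb2 R).-integrable (Omega : set (mplane R)) (fun x => (f x)%:E) /\
  \int[@leb2 R]_(x in Omega) F n x @[n --> \oo] --> \int[@leb2 R]_(x in Omega) f x.
Proof.
move=> oO cK [mF [M HM]] F0 Ff.
have mO : measurable (Omega : set (mplane R)) by exact: open_plane_measurable.
have [N _ HN] := compact_supp_norm cK.
pose g := (EFin \o (cst `|M| : R * R -> R)) \_ (square N).
have mS : measurable (square N : set (mplane R)) by exact: square_measurable.
have ig : (@leb2 R).-integrable (Omega : set (mplane R)) g.
  apply: (integrableS (E := [set: mplane R])) => //.
  apply: (integrable_mkcond _ mS).1; apply: measurable_bounded_integrable => //.
  - exact: square_finite.
  - by exists `|M|; split; [exact: num_real|move=> y My x _ /=; rewrite normr_id ltW].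
have mf : measurable_fun (Omega : set (mplane R)) f by exact: (measurable_fun_cvg mF Ff).
have h1 n : measurable_fun (Omega : set (mplane R)) (fun x => (F n x)%:E) by exact/measurable_EFinP.
have h2 : measurable_fun (Omega : set (mplane R)) (fun x => (f x)%:E) by exact/measurable_EFinP.
have h3 : {ae @leb2 R, forall x, Omega x -> (F n x)%:E @[n --> \oo] --> (f x)%:E}.
  by apply: aeW => x Ox; apply: cvg_EFin; [exact: nearW|exact: Ff].
have h4 : {ae @leb2 R, forall x n, Omega x -> (`|(F n x)%:E| <= g x)%E}.
  apply: leb2_ae_mono HM => x Hx n Ox; rewrite /g patchE; case: ifPn => [_|/negP xS] /=.
    by rewrite lee_fin; apply: le_trans (Hx Ox n) (ler_norm M).
  rewrite F0// ?normr0//; apply: HN; rewrite ltNge; apply/negP => xM; apply: xS.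
  by rewrite inE squareE.
have [i1 _ i3] := dominated_convergence mO h1 h2 h3 ig h4.
split => //; apply: fine_cvg.
rewrite /Rintegral fineK; first exact: i3.
exact: integrable_fin_num.
Qed.

Lemma ae_bounded_seq_integrable (R : realType) (Omega K : set (R * R)) (f : R * R -> R) :
  open Omega -> compact K -> ae_bounded_seq Omega (fun _ => f) ->
  (forall x, Omega x -> ~ K x -> f x = 0) ->
  (@leb2 R).-integrable (Omega : set (mplane R)) (fun x => (f x)%:E).
Proof.
move=> oO cK bf f0.
have [] := dominated_cvg_supp oO cK bf (fun=> f0) (fun x _ => cvg_cst (f x)).
by [].
Qed.

(** * Radial perturbations of a plateau *)

Lemma ReD (R : realType) (x y : R[i]) : complex.Re (x + y) = complex.Re x + complex.Re y.
Proof. by case: x; case: y. Qed.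

Lemma Re_sum (R : realType) (I : finType) (F : I -> R[i]) :
  complex.Re (\sum_i F i) = \sum_i complex.Re (F i).
Proof. exact: (big_morph _ (@ReD R)). Qed.

(** The Euclidean inner product of C^m seen as a real space of dimension 2m. *)
Definition rdot (R : realType) (m : nat) (v w : 'cV[R[i]]_m) : R := complex.Re (hdot v w).

Lemma rdotE (R : realType) (m : nat) (v w : 'cV[R[i]]_m) :
  rdot v w = \sum_i (complex.Re (v i ord0) * complex.Re (w i ord0) +
                     complex.Im (v i ord0) * complex.Im (w i ord0)).
Proof.
rewrite /rdot /hdot Re_sum; apply: eq_bigr => i _.
by case: (v i ord0) => a b; case: (w i ord0) => c d /=; rewrite mulrN opprK.
Qed.

Lemma rdotC (R : realType) (m : nat) (v w : 'cV[R[i]]_m) : rdot v w = rdot w v.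
Proof. by rewrite !rdotE; apply: eq_bigr => i _; rewrite mulrC [X in _ + X]mulrC. Qed.

Lemma rdotDl (R : realType) (m : nat) (v v' w : 'cV[R[i]]_m) : rdot (v + v') w = rdot v w + rdot v' w.
Proof.
rewrite !rdotE -big_split /=; apply: eq_bigr => i _; rewrite !mxE.
by case: (v i ord0) => a b; case: (v' i ord0) => a' b' /=; ring.
Qed.

Lemma rdotZl (R : realType) (m : nat) (s : R) (v w : 'cV[R[i]]_m) : rdot (s%:C *: v) w = s * rdot v w.
Proof.
rewrite !rdotE mulr_sumr; apply: eq_bigr => i _; rewrite !mxE.
by case: (v i ord0) => a b /=; ring.
Qed.

Lemma rdotDr (R : realType) (m : nat) (v w w' : 'cV[R[i]]_m) : rdot v (w + w') = rdot v w + rdot v w'.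
Proof. by rewrite rdotC rdotDl !(rdotC v). Qed.

Lemma rdotZr (R : realType) (m : nat) (s : R) (v w : 'cV[R[i]]_m) : rdot v (s%:C *: w) = s * rdot v w.
Proof. by rewrite rdotC rdotZl rdotC. Qed.

Lemma rdot_ge0 (R : realType) (m : nat) (v : 'cV[R[i]]_m) : 0 <= rdot v v.
Proof. by rewrite rdotE sumr_ge0// => i _; rewrite -!expr2 addr_ge0 ?sqr_ge0. Qed.

Lemma vnormE (R : realType) (m : nat) (v : 'cV[R[i]]_m) : vnorm v = Num.sqrt (rdot v v).
Proof.
rewrite /vnorm rdotE; congr Num.sqrt; apply: eq_bigr => i _.
by case: (v i ord0) => a b; rewrite normc_complex_sqr /= -!expr2.
Qed.

Lemma sqr_vnorm (R : realType) (m : nat) (v : 'cV[R[i]]_m) : vnorm v ^+ 2 = rdot v v.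
Proof. by rewrite vnormE sqr_sqrtr ?rdot_ge0. Qed.

Lemma vnormZ (R : realType) (m : nat) (s : R) (v : 'cV[R[i]]_m) : 0 <= s -> vnorm (s%:C *: v) = s * vnorm v.
Proof.
by move=> s0; rewrite !vnormE rdotZl rdotZr mulrA -expr2 sqrtrM ?sqr_ge0// sqrtr_sqr ger0_norm.
Qed.

Lemma vnorm_line (R : realType) (m : nat) (U eta : 'cV[R[i]]_m) (t : R) :
  vnorm (U + t%:C *: eta) = Num.sqrt (rdot U U + 2 * rdot U eta * t + rdot eta eta * t ^+ 2).
Proof.
rewrite vnormE rdotDl !rdotDr !rdotZl !rdotZr (rdotC eta U); congr Num.sqrt; ring.
Qed.

(* Derivative of [s |-> Phi |U + s eta| (U + s eta)] at [s = clip T t]. *)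
Definition radial_vec (R : realType) (m : nat) (Phi dPhi : R -> R) (U eta : 'cV[R[i]]_m) (T t : R)
    : 'cV[R[i]]_m :=
  \col_i (radial_deriv Phi dPhi (rdot U U) (rdot U eta) (rdot eta eta) T
            (complex.Re (U i ord0)) (complex.Re (eta i ord0)) t
      +i* radial_deriv Phi dPhi (rdot U U) (rdot U eta) (rdot eta eta) T
            (complex.Im (U i ord0)) (complex.Im (eta i ord0)) t).

(* Then [tau U + psi eta] is, near each point, either [U + psi eta] or a multiple of [U]. *)
Definition plateau_on (R : realType) (tau psi : R * R -> R) : Prop :=
  forall x : R * R, (\near x, tau x = 1) \/ (\near x, psi x = 0).

Section modulate.
Variables (R : realType) (m : nat) (Phi dPhi g1 : R -> R) (U eta : 'cV[R[i]]_m) (T : R) (N : nat).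
Hypothesis HPhi : forall s : R, 0 < s -> is_derive s 1 Phi (dPhi s) /\ {for s, continuous dPhi}.
Hypothesis T0 : 0 < T.
Hypothesis pos : forall t, `|t| <= T -> 0 < rdot U U + 2 * rdot U eta * t + rdot eta eta * t ^+ 2.
Hypothesis cg1 : continuous g1.
Hypothesis dG1 : forall t : R,
    is_derive t 1 (fun t => if 0 < t then Phi (vnorm U * t ^+ N.+1) * t ^+ N.+1 else 0) (g1 t).
Variables (Omega K : set (R * R)) (tau psi : R * R -> R).
Hypothesis oO : open Omega.
Hypothesis cK : compact K.
Hypothesis KO : K `<=` Omega.
Hypothesis stau : smooth tau.
Hypothesis tau01 : forall x, 0 <= tau x <= 1.
Hypothesis tau0 : forall x, ~ K x -> tau x = 0.
Hypothesis spsi : smooth psi.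
Hypothesis psiT : forall x, `|psi x| <= T.
Hypothesis sep : plateau_on tau psi.

Let u (x : R * R) : 'cV[R[i]]_m := (tau x ^+ N.+1)%:C *: U + (psi x)%:C *: eta.

(** The terms of the two regions are simply added: near each point tau is constant or psi vanishes,
    so at most one of them is nonzero. *)
Definition modulate_grad (k : 'I_2) (x : R * R) : 'cV[R[i]]_m :=
  (g1 (tau x) * 'D_(basis2 R k) tau x)%:C *: U +
  ('D_(basis2 R k) psi x)%:C *: radial_vec Phi dPhi U eta T (psi x).

Let G1 (t : R) := if 0 < t then Phi (vnorm U * t ^+ N.+1) * t ^+ N.+1 else 0.
Let Rf (a b t : R) := Phi (Num.sqrt (rdot U U + 2 * rdot U eta * t + rdot eta eta * t ^+ 2)) * (a + t * b).

Lemma plateau_on_supp x : ~ K x -> psi x = 0.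
Proof.
by move=> /tau0 t0; case: (sep x) => /nbhs_singleton // t1; move: t1; rewrite t0 => /eqP; rewrite eq_sym oner_eq0.
Qed.

(** A function of tau plus a function of psi, both vanishing at 0, which is the form [H10supp_comp]
    requires. On the plateau the subtracted value at 0 cancels the term in tau; elsewhere psi = 0
    and only the term in tau survives. *)
Lemma modulate_component (i : 'I_m) (x : R * R) : modulate Phi u x i ord0 =
  (complex.Re (U i ord0) * G1 (tau x) + (Rf (complex.Re (U i ord0)) (complex.Re (eta i ord0)) (psi x) -
     Rf (complex.Re (U i ord0)) (complex.Re (eta i ord0)) 0))
  +i* (complex.Im (U i ord0) * G1 (tau x) + (Rf (complex.Im (U i ord0)) (complex.Im (eta i ord0)) (psi x) -
     Rf (complex.Im (U i ord0)) (complex.Im (eta i ord0)) 0)).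
Proof.
have Rf0 a b : Rf a b 0 = a * (Phi (vnorm U)).
  by rewrite /Rf expr0n /= !mulr0 mul0r !addr0 -vnormE mulrC.
rewrite /modulate /u !mxE; case: (sep x) => /nbhs_singleton E.
  rewrite E expr1n scale1r vnorm_line /G1 ltr01 expr1n !mulr1 !Rf0.
  rewrite [X in X +i* _](_ : _ = Rf (complex.Re (U i ord0)) (complex.Re (eta i ord0)) (psi x)); last by ring.
  rewrite [X in _ +i* X](_ : _ = Rf (complex.Im (U i ord0)) (complex.Im (eta i ord0)) (psi x)); last by ring.
  by rewrite /Rf; case: (U i ord0) => a b; case: (eta i ord0) => c d; apply/eqP; rewrite eq_complex /=; apply/andP; split; apply/eqP; ring.
rewrite E scale0r addr0 !subrr !addr0 mul0r addr0.
have /andP[t0 _] := tau01 x.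
rewrite vnormZ ?exprn_ge0// /G1 [_ * vnorm U]mulrC.
move: t0; rewrite le_eqVlt => /predU1P[<-|t0].
  by rewrite ltxx expr0n /= mul0r !mulr0.
rewrite t0; case: (U i ord0) => a b.
by apply/eqP; rewrite eq_complex /=; apply/andP; split; apply/eqP; ring.
Qed.

Lemma modulate_H10supp (a b : R) :
  H10supp K (fun x => a * G1 (tau x) + (Rf a b (psi x) - Rf a b 0))
    (fun k x => a * (g1 (tau x) * 'D_(basis2 R k) tau x) +
       radial_deriv Phi dPhi (rdot U U) (rdot U eta) (rdot eta eta) T a b (psi x) * 'D_(basis2 R k) psi x).
Proof.
apply: (@H10suppD R K (fun x => a * G1 (tau x)) (fun k x => a * (g1 (tau x) * 'D_(basis2 R k) tau x))
  (fun x => Rf a b (psi x) - Rf a b 0)).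
  apply: (@H10suppZ R K (fun x => G1 (tau x)) (fun k x => g1 (tau x) * 'D_(basis2 R k) tau x)).
  apply: (@H10supp_comp R K G1 g1 tau 1) => //.
  - by move=> x; rewrite ger0_norm; have /andP[] := tau01 x.
  - by rewrite /G1 ltxx.
apply: (@H10supp_comp R K (fun t => Rf a b t - Rf a b 0)
  (radial_deriv Phi dPhi (rdot U U) (rdot U eta) (rdot eta eta) T a b) psi T) => //.
- exact: plateau_on_supp.
- by apply: radial_deriv_continuous => //; exact: ltW.
- by rewrite subrr.
- move=> t tT; have := is_derive_radial HPhi pos a b tT => H.
  have := is_deriveB H (is_derive_cst (Rf a b 0) t (1 : R)).
  by rewrite subr0.
Qed.

Lemma modulate_vsobolev_H10 : vsobolev_H10 Omega (modulate Phi u) modulate_grad.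
Proof.
move=> i.
rewrite (funext (modulate_component i)).
have := H10supp_sobolev_H10 oO cK KO (modulate_H10supp (complex.Re (U i ord0)) (complex.Re (eta i ord0)))
  (modulate_H10supp (complex.Im (U i ord0)) (complex.Im (eta i ord0))).
congr sobolev_H10; apply/funext => k; apply/funext => x; rewrite !mxE.
case: (U i ord0) => a b; case: (eta i ord0) => c d /=.
by apply/eqP; rewrite eq_complex /=; apply/andP; split; apply/eqP; ring.
Qed.
End modulate.

Lemma eq_ae_bounded_seq (R : realType) (Omega : set (R * R)) (F G : nat -> R * R -> R) :
  (forall n x, G n x = F n x) -> ae_bounded_seq Omega F -> ae_bounded_seq Omega G.
Proof. by move=> FG; rewrite (_ : G = F)//; apply/funext => n; apply/funext => x. Qed.

Section radial_bounds.
Variables (R : realType) (m : nat) (Phi dPhi : R -> R) (U eta : 'cV[R[i]]_m) (T : R).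
Hypothesis HPhi : forall s : R, 0 < s -> is_derive s 1 Phi (dPhi s) /\ {for s, continuous dPhi}.
Hypothesis T0 : 0 < T.
Hypothesis pos : forall t, `|t| <= T -> 0 < rdot U U + 2 * rdot U eta * t + rdot eta eta * t ^+ 2.

(** The dependence on t is through [clip] alone, so the maximum over [-T, T] bounds it
    everywhere. *)
Lemma radial_deriv_bounded (a b : R) : exists M : R, forall t,
  `|radial_deriv Phi dPhi (rdot U U) (rdot U eta) (rdot eta eta) T a b t| <= M.
Proof.
have cr := @radial_deriv_continuous R Phi dPhi _ _ _ T HPhi (ltW T0) pos a b.
have [M _ HM] := continuous_bounded_on (@segment_compact R (- T) T) cr.
exists M => t; have -> : radial_deriv Phi dPhi (rdot U U) (rdot U eta) (rdot eta eta) T a b t =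
    radial_deriv Phi dPhi (rdot U U) (rdot U eta) (rdot eta eta) T a b (clip T t).
  by rewrite /radial_deriv [clip T (clip T t)]clip_id// clip_le// ltW.
by apply: HM; rewrite /= in_itv/= -ler_norml clip_le// ltW.
Qed.

Variables (Omega : set (R * R)) (psi : nat -> R * R -> R).
Hypothesis cpsi : forall n, continuous (psi n).

Lemma ae_bounded_radial_deriv (a b : R) : ae_bounded_seq Omega (fun n x =>
  radial_deriv Phi dPhi (rdot U U) (rdot U eta) (rdot eta eta) T a b (psi n x)).
Proof.
have [M HM] := radial_deriv_bounded a b.
apply: (@ae_bounded_seq_continuous _ _ M) => [n x|n x]; last exact: HM.
by apply: continuous_comp; [exact: cpsi|exact: (@radial_deriv_continuous R Phi dPhi _ _ _ T HPhi (ltW T0) pos a b)].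
Qed.

Lemma ae_bounded_radial_sqr : ae_bounded_seq Omega (fun n x =>
  rdot (radial_vec Phi dPhi U eta T (psi n x)) (radial_vec Phi dPhi U eta T (psi n x))).
Proof.
pose r a b n x := radial_deriv Phi dPhi (rdot U U) (rdot U eta) (rdot eta eta) T a b (psi n x).
have Hr a b : ae_bounded_seq Omega (r a b) by exact: ae_bounded_radial_deriv.
apply: (@eq_ae_bounded_seq _ _ (fun n x => \sum_i
  (r (complex.Re (U i ord0)) (complex.Re (eta i ord0)) n x * r (complex.Re (U i ord0)) (complex.Re (eta i ord0)) n x +
   r (complex.Im (U i ord0)) (complex.Im (eta i ord0)) n x * r (complex.Im (U i ord0)) (complex.Im (eta i ord0)) n x))).
  by move=> n x; rewrite rdotE; apply: eq_bigr => i _; rewrite !mxE.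
by apply: ae_bounded_seq_sum => i; apply: ae_bounded_seqD; apply: ae_bounded_seqM; exact: Hr.
Qed.

Lemma ae_bounded_mulmx (M : R * R -> 'M[R[i]]_m) (v : 'cV[R[i]]_m) (w : nat -> R * R -> 'cV[R[i]]_m) :
  open Omega -> (forall i j, cLfun Omega +oo%E (fun x => M x i j)) ->
  (forall i, ae_bounded_seq Omega (fun n x => complex.Re (w n x i ord0))) ->
  (forall i, ae_bounded_seq Omega (fun n x => complex.Im (w n x i ord0))) ->
  ae_bounded_seq Omega (fun n x => rdot (M x *m v) (w n x)).
Proof.
move=> oO HM Hr Hi.
have E x i : complex.Re ((M x *m v) i ord0) = \sum_j (complex.Re (M x i j) * complex.Re (v j ord0) +
    - complex.Im (v j ord0) * complex.Im (M x i j)) /\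
  complex.Im ((M x *m v) i ord0) = \sum_j (complex.Re (M x i j) * complex.Im (v j ord0) +
    complex.Im (M x i j) * complex.Re (v j ord0)).
  have Im_sum (F : 'I_m -> R[i]) : complex.Im (\sum_j F j) = \sum_j complex.Im (F j).
    by apply: (big_morph _ (id1 := 0)) => // -[? ?] [? ?].
  rewrite mxE Re_sum Im_sum; split; apply: eq_bigr => j _;
    by case: (M x i j) => ? ?; case: (v j ord0) => ? ? /=; ring.
apply: (@eq_ae_bounded_seq _ _ (fun n x => \sum_i (
    (\sum_j (complex.Re (M x i j) * complex.Re (v j ord0) +
    - complex.Im (v j ord0) * complex.Im (M x i j))) * complex.Re (w n x i ord0) +
    (\sum_j (complex.Re (M x i j) * complex.Im (v j ord0) +
    complex.Im (M x i j) * complex.Re (v j ord0))) * complex.Im (w n x i ord0)))).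
  move=> n x; rewrite rdotE; apply: eq_bigr => i _.
  by have [-> ->] := E x i.
have HMr i j := ae_bounded_seq_Linfty oO (HM i j).1.
have HMi i j := ae_bounded_seq_Linfty oO (HM i j).2.
have Hc c : ae_bounded_seq Omega (fun _ _ => c : R) := ae_bounded_seq_cst Omega c.
apply: ae_bounded_seq_sum => i; apply: ae_bounded_seqD; apply: ae_bounded_seqM => //.
- by apply: ae_bounded_seq_sum => j; apply: ae_bounded_seqD; apply: ae_bounded_seqM.
- by apply: ae_bounded_seq_sum => j; apply: ae_bounded_seqD; apply: ae_bounded_seqM.
Qed.

Lemma ae_bounded_mulmx_radial (M : R * R -> 'M[R[i]]_m) (v : 'cV[R[i]]_m) :
  open Omega -> (forall i j, cLfun Omega +oo%E (fun x => M x i j)) ->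
  ae_bounded_seq Omega (fun n x => rdot (M x *m v) (radial_vec Phi dPhi U eta T (psi n x))).
Proof.
move=> oO HM.
pose r a b n x := radial_deriv Phi dPhi (rdot U U) (rdot U eta) (rdot eta eta) T a b (psi n x).
have Hr a b : ae_bounded_seq Omega (r a b) by exact: ae_bounded_radial_deriv.
apply: (@ae_bounded_mulmx M v (fun n x => radial_vec Phi dPhi U eta T (psi n x))) => // i.
- apply: (@eq_ae_bounded_seq _ _ (r (complex.Re (U i ord0)) (complex.Re (eta i ord0)))) => //.
  by move=> n x; rewrite mxE.
- apply: (@eq_ae_bounded_seq _ _ (r (complex.Im (U i ord0)) (complex.Im (eta i ord0)))) => //.
  by move=> n x; rewrite mxE.
Qed.
End radial_bounds.

(** The weight 1 makes u itself an instance of [modulate], so its gradient is covered by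
    [modulate_grad]. *)
Lemma radial_vec_cst1 (R : realType) (m : nat) (U eta : 'cV[R[i]]_m) (T t : R) :
  radial_vec (fun=> 1) (fun=> 0) U eta T t = eta.
Proof.
apply/matrixP => i j; rewrite !mxE (ord1 j) /radial_deriv !mul0r !add0r !mul1r.
by case: (eta i ord0).
Qed.

Lemma plateau_on_partial (R : realType) (tau psi : R * R -> R) (x : R * R) : plateau_on tau psi ->
  (forall k, 'D_(basis2 R k) tau x = 0) \/ (forall k, 'D_(basis2 R k) psi x = 0).
Proof.
move=> /(_ x)[H|H]; [left|right] => k.
  have E : \near x, tau x = (cst 1 : R * R -> R) x by exact: H.
  by rewrite (near_eq_derive _ E) derive_cst.
have E : \near x, psi x = (cst 0 : R * R -> R) x by exact: H.
by rewrite (near_eq_derive _ E) derive_cst.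
Qed.

Lemma ae_bounded_C1supp (R : realType) (Omega K : set (R * R)) (f : R * R -> R) df k :
  compact K -> C1supp K f df -> ae_bounded_seq Omega (fun _ => df k).
Proof.
move=> cK Cf; have [B B0 HB] := C1supp_bounded cK Cf; have [_ cdf _ _] := Cf.
by apply: (@ae_bounded_seq_continuous _ _ B) => // _ x; have [_ /(_ k)] := HB x.
Qed.

(** * The energy inequality for perturbations of a plateau *)

Section energy.
Variables (R : realType) (m : nat) (Omega : set (R * R)) (a : 'I_2 -> 'I_2 -> R * R -> 'M[R[i]]_m).
Variables (phi : R -> R) (kappa : R).
Hypothesis oO : open Omega.
Hypothesis a_bounded : forall h k i j, cLfun Omega +oo%E (fun x => a h k x i j).
Hypothesis phiP : phi_conditions phi.
Hypothesis kappa0 : 0 < kappa.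
Hypothesis dissA : forall (u : R * R -> 'cV[R[i]]_m) (du dw dv : 'I_2 -> R * R -> 'cV[R[i]]_m),
      vsobolev_H10 Omega u du ->
      vsobolev_H10 Omega (modulate phi u) dw ->
      vweak_grad Omega (modulate (fun s => Num.sqrt (phi s)) u) dv ->
      (kappa%:E * \int[@leb2 R]_(x in Omega)
         (\sum_(k < 2) vnorm (dv k x) ^+ 2)%:E
       <= (complex.Re (cintegral Omega (fun x =>
             \sum_(h < 2) \sum_(k < 2)
               hdot (a h k x *m du k x) (dw h x))))%:E)%E.
Variables (U eta : 'cV[R[i]]_m) (T : R).
Hypothesis U0 : 0 < rdot U U.
Hypothesis T0 : 0 < T.
Hypothesis pos : forall t, `|t| <= T -> 0 < rdot U U + 2 * rdot U eta * t + rdot eta eta * t ^+ 2.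

Definition wvec := radial_vec phi phi^`()%classic U eta T.
Definition vvec := radial_vec (fun s => Num.sqrt (phi s))
  (fun s => phi^`()%classic s / (2 * Num.sqrt (phi s))) U eta T.

(* [C0] accounts for the gradient of [tau], which lives where [psi] vanishes. *)
Lemma energy_inequality (K : set (R * R)) (tau : R * R -> R) :
  compact K -> K `<=` Omega -> smooth tau -> (forall x, 0 <= tau x <= 1) -> (forall x, ~ K x -> tau x = 0) ->
  exists C0 : R, forall psi, smooth psi -> (forall x, `|psi x| <= T) -> plateau_on tau psi ->
    kappa * \int[@leb2 R]_(x in Omega) (\sum_(k < 2) 'D_(basis2 R k) psi x ^+ 2 * rdot (vvec (psi x)) (vvec (psi x)))
    <= C0 + \int[@leb2 R]_(x in Omega) (\sum_(h < 2) \sum_(k < 2)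
         'D_(basis2 R k) psi x * 'D_(basis2 R h) psi x * rdot (a h k x *m eta) (wvec (psi x))).
Proof.
move=> cK KO stau tau01 tau0.
have [N N0 prof] := phi_profiles_C1 phiP.
have p0 : 0 < vnorm U by rewrite vnormE sqrtr_gt0.
have [[g1 cg1 dg1] [g2 cg2 dg2]] := prof _ p0.
have H1 (s : R) : 0 < s -> is_derive s 1 (fun=> 1 : R) ((fun=> 0) s) /\ {for s, continuous (fun=> 0 : R)}.
  by move=> _; split; [exact: is_derive_cst|exact: cvg_cst].
have Hp (s : R) : 0 < s -> is_derive s 1 phi (phi^`()%classic s) /\ {for s, continuous phi^`()%classic}.
  by move=> s0; exact: phi_is_derive.
have Hs (s : R) : 0 < s -> is_derive s 1 (fun s => Num.sqrt (phi s)) ((fun s => phi^`()%classic s / (2 * Num.sqrt (phi s))) s) /\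
    {for s, continuous (fun s => phi^`()%classic s / (2 * Num.sqrt (phi s)))}.
  by move=> s0; exact: sqrt_phi_is_derive.
(* For the weight 1 the required bounds reduce to t^(N+1) <= t^2, which holds because N > 0 and t <
   1. *)
have [g0 cg0 dg0] := @power_profile_C1 R (fun=> 1) (fun=> 0) (vnorm U) 1 1 N p0 ltr01 H1 (ltac:(
  by move=> t /andP[t0 t1]; rewrite mulr0 mul0r normr0 !mul1r sqr_ge0 gtr0_norm ?exprn_gt0//;
     split=> //; apply: ler_wiXn2l => //; exact: ltW)).
pose s0 k x := g0 (tau x) * 'D_(basis2 R k) tau x.
pose s1 k x := g1 (tau x) * 'D_(basis2 R k) tau x.
pose s2 k x := g2 (tau x) * 'D_(basis2 R k) tau x.
pose F1 x := \sum_(h < 2) \sum_(k < 2) s0 k x * s1 h x * rdot (a h k x *m U) U.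
exists (\int[@leb2 R]_(x in Omega) F1 x) => psi spsi psiT sep.
set V2 := (X in kappa * \int[_]_(x in _) X x).
set F2 := (X in _ <= _ + \int[_]_(x in _) X x).
pose V1 x := \sum_(k < 2) s2 k x ^+ 2 * rdot U U.
have psi0 x : ~ K x -> psi x = 0 by apply: (plateau_on_supp tau0 sep).
have tb k : ae_bounded_seq Omega (fun _ => 'D_(basis2 R k) tau).
  by have := ae_bounded_C1supp Omega k cK (smooth_C1supp cK stau tau0).
have pb k : ae_bounded_seq Omega (fun _ => 'D_(basis2 R k) psi).
  by have := ae_bounded_C1supp Omega k cK (smooth_C1supp cK spsi psi0).
have gb (g : R -> R) : continuous g -> ae_bounded_seq Omega (fun _ x => g (tau x)).
  move=> cg; have [M _ HM] := continuous_bounded_on (@segment_compact R 0 1) cg.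
  apply: (@ae_bounded_seq_continuous _ _ M) => [_ x|_ x].
    by apply: continuous_comp; [exact: smooth_continuous|exact: cg].
  by apply: HM; rewrite /= in_itv/= tau01.
have sb (g : R -> R) (k : 'I_2) : continuous g -> ae_bounded_seq Omega (fun _ x => g (tau x) * 'D_(basis2 R k) tau x).
  by move=> cg; apply: ae_bounded_seqM (tb k); exact: gb.
have tK k x : ~ K x -> 'D_(basis2 R k) tau x = 0 by exact: smooth_partial_supp cK tau0.
have pK k x : ~ K x -> 'D_(basis2 R k) psi x = 0 by exact: smooth_partial_supp cK psi0.
have cpsi : forall n : nat, continuous psi by move=> _; exact: smooth_continuous.
have iF1 : (@leb2 R).-integrable (Omega : set (mplane R)) (fun x => (F1 x)%:E).
  apply: (ae_bounded_seq_integrable oO cK).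
    apply: ae_bounded_seq_sum => h; apply: ae_bounded_seq_sum => k.
    apply: ae_bounded_seqM; first by apply: ae_bounded_seqM; exact: sb.
    apply: (@ae_bounded_mulmx R m Omega (a h k) U (fun _ _ => U)) => // i; exact: ae_bounded_seq_cst.
  by move=> x _ Kx; rewrite /F1 big1// => h _; rewrite big1// => k _; rewrite /s0 tK// mulr0 !mul0r.
have iF2 : (@leb2 R).-integrable (Omega : set (mplane R)) (fun x => (F2 x)%:E).
  apply: (ae_bounded_seq_integrable oO cK).
    apply: ae_bounded_seq_sum => h; apply: ae_bounded_seq_sum => k.
    apply: ae_bounded_seqM; first by apply: ae_bounded_seqM; exact: pb.
    exact: (ae_bounded_mulmx_radial Hp T0 pos (psi := fun _ => psi)).
  by move=> x _ Kx; rewrite /F2 big1// => h _; rewrite big1// => k _; rewrite pK// !mul0r.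
have iV1 : (@leb2 R).-integrable (Omega : set (mplane R)) (fun x => (V1 x)%:E).
  apply: (ae_bounded_seq_integrable oO cK).
    apply: ae_bounded_seq_sum => k; apply: ae_bounded_seqM; last exact: ae_bounded_seq_cst.
    by apply: ae_bounded_seqM; exact: sb.
  by move=> x _ Kx; rewrite /V1 big1// => k _; rewrite /s2 tK// mulr0 expr0n mul0r.
have iV2 : (@leb2 R).-integrable (Omega : set (mplane R)) (fun x => (V2 x)%:E).
  apply: (ae_bounded_seq_integrable oO cK).
    apply: ae_bounded_seq_sum => k; apply: ae_bounded_seqM; first by apply: ae_bounded_seqM; exact: pb.
    exact: (@ae_bounded_radial_sqr R m _ _ U eta T Hs T0 pos Omega (fun _ => psi) cpsi).
  by move=> x _ Kx; rewrite /V2 big1// => k _; rewrite pK// expr0n mul0r.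
pose u x : 'cV[R[i]]_m := (tau x ^+ N.+1)%:C *: U + (psi x)%:C *: eta.
pose du := modulate_grad (fun=> 1) (fun=> 0) g0 U eta T tau psi.
pose dw := modulate_grad phi phi^`()%classic g1 U eta T tau psi.
pose dv := modulate_grad (fun s => Num.sqrt (phi s)) (fun s => phi^`()%classic s / (2 * Num.sqrt (phi s))) g2 U eta T tau psi.
have Hu : vsobolev_H10 Omega u du.
  have E1 : modulate (fun=> 1) u = u by apply/funext => x; rewrite /modulate scale1r.
  by have := modulate_vsobolev_H10 H1 T0 pos cg0 dg0 oO cK KO stau tau01 tau0 spsi psiT sep; rewrite -/u E1.
have Hw : vsobolev_H10 Omega (modulate phi u) dw 
  by exact: (modulate_vsobolev_H10 Hp T0 pos cg1 dg1 oO cK KO stau tau01 tau0 spsi psiT sep).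
have Hv : vsobolev_H10 Omega (modulate (fun s => Num.sqrt (phi s)) u) dv.
  exact: (modulate_vsobolev_H10 Hs T0 pos cg2 dg2 oO cK KO stau tau01 tau0 spsi psiT sep).
have := dissA Hu Hw (fun i k => ((Hv i).1.2 k).2).
rewrite /cintegral [complex.Re (_ +i* _)]/=.
have -> : \int[@leb2 R]_(x in Omega) complex.Re (\sum_(h < 2) \sum_(k < 2) hdot (a h k x *m du k x) (dw h x)) =
    \int[@leb2 R]_(x in Omega) (F1 x + F2 x).
  apply: eq_Rintegral => x _; rewrite /F1 /F2 -big_split /= Re_sum; apply: eq_bigr => h _.
  rewrite -big_split /= Re_sum; apply: eq_bigr => k _.
  rewrite -/(rdot _ _) /du /dw /modulate_grad radial_vec_cst1 mulmxDr -!scalemxAr.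
  rewrite rdotDl !rdotDr !rdotZl !rdotZr /s0 /s1 /wvec.
  (* One of the two gradients vanishes at x, which kills the cross terms. *)
  by case: (plateau_on_partial x sep) => D0; rewrite !D0 ?(mulr0, mul0r, addr0, add0r)//; ring.
have -> : (\int[@leb2 R]_(x in Omega) (\sum_(k < 2) vnorm (dv k x) ^+ 2)%:E = (\int[@leb2 R]_(x in Omega) (V1 x + V2 x))%:E)%E.
  rewrite /Rintegral fineK; last first.
    have mO := open_plane_measurable oO; apply: (integrable_fin_num mO).
    exact: (integrableD mO iV1 iV2).
  apply: eq_integral => x _; congr EFin; rewrite /V1 /V2 -big_split /=; apply: eq_bigr => k _.
  rewrite sqr_vnorm /dv /modulate_grad rdotDl !rdotDr !rdotZl !rdotZr /s2 /vvec.
  by case: (plateau_on_partial x sep) => D0; rewrite !D0 ?(mulr0, mul0r, addr0, add0r, expr0n)//=; ring.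
rewrite -EFinM lee_fin !RintegralD//; try exact: open_plane_measurable.
have : 0 <= kappa * \int[@leb2 R]_(x in Omega) V1 x.
  rewrite mulr_ge0 ?(ltW kappa0)//; apply: Rintegral_ge0 => x _.
  by rewrite sumr_ge0// => k _; rewrite mulr_ge0 ?sqr_ge0// ltW.
rewrite mulrDr; lra.
Qed.
End energy.

(** * Oscillating test functions *)

(** The pairs (1, 0) and (0, 1) give the cosine and the sine; the family also contains their
    derivatives, so both oscillations are treated at once. *)
Definition harmonic (R : realType) (p q t : R) : R := p * cos t + q * sin t.

Lemma harmonic_bound (R : realType) (p q t : R) : `|harmonic p q t| <= `|p| + `|q|.
Proof.
apply: le_trans (ler_normD _ _) _; rewrite !normrM lerD// ler_piMr// ler_norml.
  by rewrite cos_geN1 cos_le1.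
by rewrite sin_geN1 sin_le1.
Qed.

Lemma harmonic_is_derive (R : realType) (p q t : R) :
  is_derive t 1 (harmonic p q) (harmonic q (- p) t).
Proof.
have -> : harmonic p q = (p \*: cos) + (q \*: sin) by [].
apply: is_derive_eq; rewrite /GRing.scale /= /harmonic; ring.
Qed.

Lemma cvg_fin_sum (R : realType) (I : finType) (F : I -> nat -> R) (l : I -> R) :
  (forall i, F i n @[n --> \oo] --> l i) -> \sum_i F i n @[n --> \oo] --> \sum_i l i.
Proof. by move=> H; apply: cvg_big => [|i _]; [exact: add_continuous|exact: H]. Qed.

Section oscillation.
Variables (R : realType) (Omega K : set (R * R)) (tau chi : R * R -> R) (T kappa C0 : R).
Variables (X : 'I_2 -> 'I_2 -> R * R -> R -> R) (b : R -> R) (xi : R * R).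
Hypothesis oO : open Omega.
Hypothesis cK : compact K.
Hypothesis tau0 : forall x, ~ K x -> tau x = 0.
Hypothesis T0 : 0 < T.
Hypothesis energy : forall psi, smooth psi -> (forall x, `|psi x| <= T) -> plateau_on tau psi ->
    kappa * \int[@leb2 R]_(x in Omega) (\sum_(k < 2) 'D_(basis2 R k) psi x ^+ 2 * b (psi x))
    <= C0 + \int[@leb2 R]_(x in Omega) (\sum_(h < 2) \sum_(k < 2)
         'D_(basis2 R k) psi x * 'D_(basis2 R h) psi x * X h k x (psi x)).
Hypothesis bX : forall h k (psi : nat -> R * R -> R), (forall n, continuous (psi n)) ->
  ae_bounded_seq Omega (fun n x => X h k x (psi n x)).
Hypothesis cX : forall h k x, {for 0, continuous (X h k x)}.
Hypothesis bb : forall psi : nat -> R * R -> R, (forall n, continuous (psi n)) ->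
  ae_bounded_seq Omega (fun n x => b (psi n x)).
Hypothesis cb : {for 0, continuous b}.
Hypothesis schi : smooth chi.
Hypothesis sep : plateau_on tau chi.

Let M (n : nat) : R := n.+1%:R.
(** The leading 0 gives the shape of [smooth_affine]. Frequency [M n ^+ 2] against amplitude 1 /
    [M n] lets the function tend to 0 while its gradient grows like [M n]. *)
Let phase n x := 0 + (M n ^+ 2 * xi.1 * x.1 + M n ^+ 2 * xi.2 * x.2).
Let psi (p q : R) (n : nat) (x : R * R) : R := chi x * ((M n)^-1 * harmonic p q (phase n x)).
(* [P] is the gradient of [psi] divided by [M n]. *)
Let P (p q : R) (k : 'I_2) (n : nat) (x : R * R) : R :=
  'D_(basis2 R k) chi x * ((M n ^- 2) * harmonic p q (phase n x)) + chi x * (coord2 xi k * harmonic q (- p) (phase n x)).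

Let M0 n : 0 < M n. Proof. exact: ltr0Sn. Qed.

Let sphase n : smooth (phase n).
Proof. exact: smooth_affine. Qed.

Let sharm p q n : smooth (fun x => harmonic p q (phase n x)).
Proof. by apply: (smooth_comp (h := harmonic p q)); [move=> k; exact: Ck1_cos_sin|exact: sphase]. Qed.

Let spsi p q n : smooth (psi p q n).
Proof. by apply: (smoothM schi); apply: smoothM (sharm p q n); exact: smooth_cst. Qed.

Let chi0 x : ~ K x -> chi x = 0.
Proof. by apply: (plateau_on_supp tau0 sep). Qed.

Lemma phase_partial k n x : is_derive x (basis2 R k) (phase n) (M n ^+ 2 * coord2 xi k).
Proof.
apply/is_derive_slice.
rewrite (_ : (fun t => _) = (fun t : R => t * (M n ^+ 2 * coord2 xi k) + phase n x)); first exact: is_derive_affine.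
apply/funext => t; rewrite coord2_basis2 /phase /coord2.
by case: ifP => _ /=; ring.
Qed.

Lemma psi_partial p q k n x : 'D_(basis2 R k) (psi p q n) x = M n * P p q k n x.
Proof.
have dh := is_derive_comp_dir (harmonic_is_derive p q (phase n x)) (phase_partial k n x).
have d := is_deriveM (smooth_is_derive k x schi) (is_deriveZ (M n)^-1 dh).
have -> : 'D_(basis2 R k) (psi p q n) x = 'D_(basis2 R k) (chi * ((M n)^-1 \*: (harmonic p q \o phase n))) x by [].
have [_ ->] := d; rewrite /P /GRing.scale /=
  -[_ *: harmonic p q (phase n x)]/((M n)^-1 * harmonic p q (phase n x)).
by field; rewrite gt_eqF.
Qed.

Lemma psi_plateau_on p q n : plateau_on tau (psi p q n).
Proof.
move=> x; case: (sep x) => H; [by left|right].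
by apply: filterS H => y; rewrite /psi => ->; rewrite mul0r.
Qed.

Lemma P_supp p q k n x : ~ K x -> P p q k n x = 0.
Proof.
by move=> Kx; rewrite /P chi0// (smooth_partial_supp k cK chi0 Kx) !mul0r addr0.
Qed.

Lemma chi_bounded : exists2 B, 0 < B & forall x, `|chi x| <= B /\ forall k, `|'D_(basis2 R k) chi x| <= B.
Proof. exact: (C1supp_bounded cK (smooth_C1supp cK schi chi0)). Qed.

Lemma P_bounded p q k : exists B, forall n x, `|P p q k n x| <= B.
Proof.
have [B B0 HB] := chi_bounded.
exists (B * (1 * (`|p| + `|q|)) + B * (`|coord2 xi k| * (`|q| + `|p|))) => n x.
have [h1 /(_ k) h2] := HB x.
apply: le_trans (ler_normD _ _) _; rewrite !normrM; apply: lerD.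
  apply: ler_pM; rewrite ?mulr_ge0//; apply: ler_pM; rewrite ?harmonic_bound//.
  by rewrite ger0_norm ?invr_ge0 ?exprn_ge0 ?(ltW (M0 n))// invf_le1 ?exprn_gt0// exprn_ege1// ler1n.
apply: ler_pM; rewrite ?mulr_ge0// ler_wpM2l//.
by rewrite -[`|p|]normrN harmonic_bound.
Qed.

Lemma ae_bounded_P p q k : ae_bounded_seq Omega (P p q k).
Proof.
have [B HB] := P_bounded p q k; apply: (@ae_bounded_seq_continuous _ _ B) => // n x.
apply: cvgD; apply: cvgM.
- exact: smooth_derive_continuous.
- by apply: cvgM; [exact: cvg_cst|apply: smooth_continuous; exact: sharm].
- exact: smooth_continuous.
- by apply: cvgM; [exact: cvg_cst|apply: smooth_continuous; exact: sharm].
Qed.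

Lemma invM_cvg0 : (M n)^-1 @[n --> \oo] --> (0 : R).
Proof. exact: cvg_harmonic. Qed.

Lemma psi_cvg0 p q x : psi p q n x @[n --> \oo] --> (0 : R).
Proof.
rewrite -(mulr0 (chi x)); apply: cvgM; first exact: cvg_cst.
apply/norm_cvg0P.
have H : (M n)^-1 * (`|p| + `|q|) @[n --> \oo] --> (0 : R).
  by rewrite -(mul0r (`|p| + `|q|)); apply: cvgM; [exact: invM_cvg0|exact: cvg_cst].
apply: (squeeze_cvgr _ (cvg_cst 0) H); apply: nearW => n.
rewrite normr_ge0 normrM ger0_norm ?invr_ge0 ?(ltW (M0 n))//.
by rewrite ler_wpM2l ?invr_ge0 ?(ltW (M0 n))// harmonic_bound.
Qed.

(* Adding the energies of the sine and the cosine removes the oscillation, so that pointwise limits suffice. *)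
Lemma P_sum k h n x : P 1 0 k n x * P 1 0 h n x + P 0 1 k n x * P 0 1 h n x =
  'D_(basis2 R k) chi x * 'D_(basis2 R h) chi x * ((M n)^-1) ^+ 4 + coord2 xi k * coord2 xi h * chi x ^+ 2.
Proof.
have H := cos2Dsin2 (phase n x); rewrite /P /harmonic -exprVn.
move: (cos _) (sin _) H => c s H.
have E : s ^+ 2 = 1 - c ^+ 2 by rewrite -H addrC addKr.
set A := 'D_(basis2 R k) chi x; set B := 'D_(basis2 R h) chi x.
transitivity ((A * B * (M n)^-1 ^+ 4 + coord2 xi k * coord2 xi h * chi x ^+ 2) * (c ^+ 2 + s ^+ 2)); first by ring.
by rewrite H mulr1.
Qed.

(** Neither u nor v converges, only their sum; as w and z have the same limit y, one writes u w + v
    z = u (w - y) + v (z - y) + (u + v) y. *)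
Lemma cvg_pair_mul (u v w z : nat -> R) (l y B : R) : (forall n, `|u n| <= B) -> (forall n, `|v n| <= B) ->
  u n + v n @[n --> \oo] --> l -> w n @[n --> \oo] --> y -> z n @[n --> \oo] --> y ->
  u n * w n + v n * z n @[n --> \oo] --> l * y.
Proof.
move=> ub vb uv wy zy.
have bnd (f g : nat -> R) : (forall n, `|f n| <= B) -> g n @[n --> \oo] --> y ->
    f n * (g n - y) @[n --> \oo] --> (0 : R).
  move=> fb gy; apply/norm_cvg0P.
  have H : B * `|g n - y| @[n --> \oo] --> (0 : R).
    rewrite -(mulr0 B); apply: cvgM; first exact: cvg_cst.
    by apply/norm_cvg0P; rewrite -(subrr y); apply: cvgB => //; exact: cvg_cst.
  apply: (squeeze_cvgr _ (cvg_cst 0) H); apply: nearW => n.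
  by rewrite normr_ge0 normrM ler_wpM2r.
rewrite (_ : (fun n => _) = (fun n => u n * (w n - y) + v n * (z n - y) + (u n + v n) * y)).
  rewrite -[X in _ --> X]add0r -[X in X + _]add0r; apply: cvgD; last exact: cvgM uv (cvg_cst y).
  by apply: cvgD; exact: bnd.
by apply/funext => n; ring.
Qed.

Lemma oscillation_limit_cvg k h x (Y : R -> R) : {for 0, continuous Y} ->
  P 1 0 k n x * P 1 0 h n x * Y (psi 1 0 n x) + P 0 1 k n x * P 0 1 h n x * Y (psi 0 1 n x) @[n --> \oo]
  --> coord2 xi k * coord2 xi h * chi x ^+ 2 * Y 0.
Proof.
move=> cY.
have [B1 H1] := P_bounded 1 0 k; have [B2 H2] := P_bounded 1 0 h.
have [B3 H3] := P_bounded 0 1 k; have [B4 H4] := P_bounded 0 1 h.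
have B10 : 0 <= B1 by exact: le_trans (normr_ge0 _) (H1 0%N x).
have B20 : 0 <= B2 by exact: le_trans (normr_ge0 _) (H2 0%N x).
have B30 : 0 <= B3 by exact: le_trans (normr_ge0 _) (H3 0%N x).
have B40 : 0 <= B4 by exact: le_trans (normr_ge0 _) (H4 0%N x).
apply: (@cvg_pair_mul _ _ _ _ _ _ (B1 * B2 + B3 * B4)).
- move=> n; rewrite normrM; apply: le_trans (ler_pM _ _ (H1 n x) (H2 n x)) _ => //.
  by rewrite lerDl mulr_ge0.
- move=> n; rewrite normrM; apply: le_trans (ler_pM _ _ (H3 n x) (H4 n x)) _ => //.
  by rewrite lerDr mulr_ge0.
- rewrite (_ : (fun n => _) = (fun n => 'D_(basis2 R k) chi x * 'D_(basis2 R h) chi x * ((M n)^-1) ^+ 4 +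
      coord2 xi k * coord2 xi h * chi x ^+ 2)); last by apply/funext => n; exact: P_sum.
  have H : (M n)^-1 ^+ 4 @[n --> \oo] --> (0 : R).
    have := @continuous_cvg _ _ _ \oo _ (fun n => (M n)^-1) (fun t : R => t ^+ 4) 0 (@exprn_continuous R 4 0) invM_cvg0.
    by rewrite expr0n; exact.
  have := cvgD (cvgM (cvg_cst ('D_(basis2 R k) chi x * 'D_(basis2 R h) chi x)) H)
    (cvg_cst (coord2 xi k * coord2 xi h * chi x ^+ 2)).
  by rewrite mulr0 add0r; exact.
- by apply: continuous_cvg => //; exact: psi_cvg0.
- by apply: continuous_cvg => //; exact: psi_cvg0.
Qed.

Let EX p q n x := \sum_(h < 2) \sum_(k < 2) P p q k n x * P p q h n x * X h k x (psi p q n x).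

Let EB p q n x := \sum_(k < 2) P p q k n x * P p q k n x * b (psi p q n x).

Lemma ae_bounded_EX p q : ae_bounded_seq Omega (EX p q).
Proof.
apply: ae_bounded_seq_sum => h; apply: ae_bounded_seq_sum => k.
apply: ae_bounded_seqM; first by apply: ae_bounded_seqM; exact: ae_bounded_P.
by apply: bX => n; exact: smooth_continuous (spsi p q n).
Qed.

Lemma ae_bounded_EB p q : ae_bounded_seq Omega (EB p q).
Proof.
apply: ae_bounded_seq_sum => k.
apply: ae_bounded_seqM; first by apply: ae_bounded_seqM; exact: ae_bounded_P.
by apply: bb => n; exact: smooth_continuous (spsi p q n).
Qed.

Lemma ae_bounded_seq_nth (F : nat -> R * R -> R) n : ae_bounded_seq Omega F -> ae_bounded_seq Omega (fun _ => F n).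
Proof.
move=> [mF [B HB]]; split; first by move=> _; exact: mF.
by exists B; apply: leb2_ae_mono HB => x Hx Ox _; exact: Hx.
Qed.

Lemma EX_supp p q n x : ~ K x -> EX p q n x = 0.
Proof. by move=> Kx; rewrite /EX big1// => h _; rewrite big1// => k _; rewrite P_supp// !mul0r. Qed.

Lemma EB_supp p q n x : ~ K x -> EB p q n x = 0.
Proof. by move=> Kx; rewrite /EB big1// => k _; rewrite P_supp// !mul0r. Qed.

Lemma EX_integrable p q n : (@leb2 R).-integrable (Omega : set (mplane R)) (fun x => (EX p q n x)%:E).
Proof.
apply: (ae_bounded_seq_integrable oO cK); first exact: ae_bounded_seq_nth (ae_bounded_EX p q).
by move=> x _; exact: EX_supp.
Qed.

Lemma EB_integrable p q n : (@leb2 R).-integrable (Omega : set (mplane R)) (fun x => (EB p q n x)%:E).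
Proof.
apply: (ae_bounded_seq_integrable oO cK); first exact: ae_bounded_seq_nth (ae_bounded_EB p q).
by move=> x _; exact: EB_supp.
Qed.

(** The energy inequality divided by [M n ^+ 2], available once the amplitude, at most B / [M n]
    with B a bound of |chi|, has fallen below T. *)
Lemma oscillation_energy p q : `|p| + `|q| = 1 -> \forall n \near \oo,
  kappa * \int[@leb2 R]_(x in Omega) EB p q n x <= C0 * (M n)^-1 ^+ 2 + \int[@leb2 R]_(x in Omega) EX p q n x.
Proof.
move=> pq; have [B B0 HB] := chi_bounded.
near=> n.
have psiT x : `|psi p q n x| <= T.
  have BT : B / T <= M n.
    by apply: (@le_trans _ _ n%:R); [near: n; exact: nbhs_infty_ger|rewrite ler_nat].
  have [hx _] := HB x; have Mi0 : 0 <= (M n)^-1 by rewrite invr_ge0 ltW.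
  rewrite !normrM (ger0_norm Mi0).
  have : `|chi x| * ((M n)^-1 * `|harmonic p q (phase n x)|) <= B * ((M n)^-1 * 1).
    apply: ler_pM; rewrite ?mulr_ge0//.
    by rewrite ler_wpM2l// -pq harmonic_bound.
  move=> /le_trans; apply; rewrite mulr1 ler_pdivrMr// mulrC -ler_pdivrMr//.
have := energy (spsi p q n) psiT (psi_plateau_on p q n).
have mO := open_plane_measurable oO.
have -> : \int[@leb2 R]_(x in Omega) (\sum_(k < 2) 'D_(basis2 R k) (psi p q n) x ^+ 2 * b (psi p q n x)) =
    M n ^+ 2 * \int[@leb2 R]_(x in Omega) EB p q n x.
  rewrite -RintegralZl//; last exact: EB_integrable.
  apply: eq_Rintegral => x _; rewrite mulr_sumr; apply: eq_bigr => k _.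
  by rewrite psi_partial; ring.
have -> : \int[@leb2 R]_(x in Omega) (\sum_(h < 2) \sum_(k < 2)
      'D_(basis2 R k) (psi p q n) x * 'D_(basis2 R h) (psi p q n) x * X h k x (psi p q n x)) =
    M n ^+ 2 * \int[@leb2 R]_(x in Omega) EX p q n x.
  rewrite -RintegralZl//; last exact: EX_integrable.
  apply: eq_Rintegral => x _; rewrite mulr_sumr; apply: eq_bigr => h _.
  by rewrite mulr_sumr; apply: eq_bigr => k _; rewrite !psi_partial; ring.
move=> H; rewrite -(ler_pM2l (_ : 0 < M n ^+ 2)) ?exprn_gt0//.
rewrite mulrDr mulrCA [X in _ <= X + _]mulrCA exprVn mulfV ?mulr1 ?gt_eqF ?exprn_gt0//.
Unshelve. all: by end_near. Qed.

Lemma oscillation_limit : (@leb2 R).-integrable (Omega : set (mplane R)) (fun x =>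
     ((\sum_(h < 2) \sum_(k < 2) coord2 xi k * coord2 xi h * X h k x 0 -
      kappa * \sum_(k < 2) coord2 xi k * coord2 xi k * b 0) * chi x ^+ 2)%:E) /\
  0 <= \int[@leb2 R]_(x in Omega)
    ((\sum_(h < 2) \sum_(k < 2) coord2 xi k * coord2 xi h * X h k x 0 -
      kappa * \sum_(k < 2) coord2 xi k * coord2 xi k * b 0) * chi x ^+ 2).
Proof.
have mO := open_plane_measurable oO.
pose LX x := \sum_(h < 2) \sum_(k < 2) coord2 xi k * coord2 xi h * chi x ^+ 2 * X h k x 0.
pose LB x := \sum_(k < 2) coord2 xi k * coord2 xi k * chi x ^+ 2 * b 0.
have [iX cvX] : (@leb2 R).-integrable (Omega : set (mplane R)) (fun x => (LX x)%:E) /\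
    \int[@leb2 R]_(x in Omega) (EX 1 0 n x + EX 0 1 n x) @[n --> \oo] --> \int[@leb2 R]_(x in Omega) LX x.
  apply: (dominated_cvg_supp oO cK).
  - by apply: ae_bounded_seqD; exact: ae_bounded_EX.
  - by move=> n x _ Kx; rewrite !EX_supp// addr0.
  - move=> x _; rewrite (_ : (fun n => _) = (fun n => \sum_(h < 2) \sum_(k < 2)
      (P 1 0 k n x * P 1 0 h n x * X h k x (psi 1 0 n x) + P 0 1 k n x * P 0 1 h n x * X h k x (psi 0 1 n x)))).
      by apply: cvg_fin_sum => h; apply: cvg_fin_sum => k; apply: oscillation_limit_cvg; exact: cX.
    by apply/funext => n; rewrite -big_split; apply: eq_bigr => h _; rewrite -big_split.
have [iB cvB] : (@leb2 R).-integrable (Omega : set (mplane R)) (fun x => (LB x)%:E) /\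
    \int[@leb2 R]_(x in Omega) (EB 1 0 n x + EB 0 1 n x) @[n --> \oo] --> \int[@leb2 R]_(x in Omega) LB x.
  apply: (dominated_cvg_supp oO cK).
  - by apply: ae_bounded_seqD; exact: ae_bounded_EB.
  - by move=> n x _ Kx; rewrite !EB_supp// addr0.
  - move=> x _; rewrite (_ : (fun n => _) = (fun n => \sum_(k < 2)
      (P 1 0 k n x * P 1 0 k n x * b (psi 1 0 n x) + P 0 1 k n x * P 0 1 k n x * b (psi 0 1 n x)))).
      by apply: cvg_fin_sum => k; apply: oscillation_limit_cvg; exact: cb.
    by apply/funext => n; rewrite -big_split.
have E x : (\sum_(h < 2) \sum_(k < 2) coord2 xi k * coord2 xi h * X h k x 0 -
      kappa * \sum_(k < 2) coord2 xi k * coord2 xi k * b 0) * chi x ^+ 2 = LX x - kappa * LB x.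
  rewrite mulrBl -mulrA !mulr_suml; congr (_ - _ * _); apply: eq_bigr => h _; last by ring.
  by rewrite mulr_suml; apply: eq_bigr => k _; ring.
have iKB : (@leb2 R).-integrable (Omega : set (mplane R)) (fun x => (kappa * LB x)%:E).
  exact: (integrableZl mO kappa iB).
split.
  rewrite (_ : (fun x => _) = (fun x => ((LX x)%:E - (kappa * LB x)%:E)%E)).
    exact: (integrableB mO iX iKB).
  by apply/funext => x; rewrite E EFinB.
rewrite (funext E).
rewrite RintegralB// RintegralZl// subr_ge0.
have c1 : kappa * \int[@leb2 R]_(x in Omega) (EB 1 0 n x + EB 0 1 n x) @[n --> \oo] -->
    kappa * \int[@leb2 R]_(x in Omega) LB x by apply: cvgM cvB; exact: cvg_cst.
(* The constant is doubled because the cosine and the sine inequalities are added. *)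
have c2 : 2 * C0 * (M n)^-1 ^+ 2 + \int[@leb2 R]_(x in Omega) (EX 1 0 n x + EX 0 1 n x) @[n --> \oo] -->
    \int[@leb2 R]_(x in Omega) LX x.
  rewrite -[X in _ --> X]add0r; apply: cvgD cvX.
  rewrite -[X in _ --> X](mulr0 (2 * C0)); apply: cvgM; first exact: cvg_cst.
  have := @continuous_cvg _ _ _ \oo _ (fun n => (M n)^-1) (fun t : R => t ^+ 2) 0 (@exprn_continuous R 2 0) invM_cvg0.
  by rewrite expr0n; exact.
apply: (ler_cvg_to c1 c2).
have e10 : `|1 : R| + `|0 : R| = 1 by rewrite normr1 normr0 addr0.
have e01 : `|0 : R| + `|1 : R| = 1 by rewrite normr1 normr0 add0r.
near=> n.
rewrite (RintegralD mO (EB_integrable 1 0 n) (EB_integrable 0 1 n)).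
rewrite (RintegralD mO (EX_integrable 1 0 n) (EX_integrable 0 1 n)).
have h1 : kappa * \int[@leb2 R]_(x in Omega) EB 1 0 n x <=
  C0 * (M n)^-1 ^+ 2 + \int[@leb2 R]_(x in Omega) EX 1 0 n x by near: n; exact: oscillation_energy.
have h2 : kappa * \int[@leb2 R]_(x in Omega) EB 0 1 n x <=
  C0 * (M n)^-1 ^+ 2 + \int[@leb2 R]_(x in Omega) EX 0 1 n x by near: n; exact: oscillation_energy.
rewrite mulrDr; apply: le_trans (lerD h1 h2) _; rewrite addrACA.
by rewrite -mulrA mulr_natl mulr2n.
Unshelve. all: by end_near. Qed.

End oscillation.

(** * From rectangles to almost every point *)

(** At almost every x, g x is the limit of its averages over any nicely shrinking sets; intervals
    with rational endpoints, at distances between r/2 and r from x, are such sets. *)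
Lemma ae_ge0_of_rat_itv (R : realType) (g : R -> R) :
  (@lebesgue_measure R).-integrable [set: R] (EFin \o g) ->
  (forall s t : rat, (0 <= \int[@lebesgue_measure R]_(x in `]ratr s, ratr t[%classic) (g x)%:E)%E) ->
  {ae @lebesgue_measure R, forall x, 0 <= g x}.
Proof.
move=> ig g0.
have lg : locally_integrable [set: R] g.
  by have := integrable_locally measurableT ig; rewrite patch_setT.
pose r n : R := n.+1%:R^-1.
have r0 n : 0 < r n by rewrite invr_gt0 ltr0n.
have ex (x : R) n : exists st : rat * rat, (x - r n < ratr st.1 < x - r n / 2) /\ (x + r n / 2 < ratr st.2 < x + r n).
  have [|s] := @rat_in_itvoo R (x - r n) (x - r n / 2); first by have := r0 n; lra.
  have [|t] := @rat_in_itvoo R (x + r n / 2) (x + r n); first by have := r0 n; lra.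
  by rewrite !in_itv => ht hs; exists (s, t).
pose st x n := projT1 (cid (ex x n)).
have stP x n := projT2 (cid (ex x n)).
pose E (x : R) n : set R := `]ratr (st x n).1, ratr (st x n).2[%classic.
have muE x n : ((r n)%:E <= lebesgue_measure (E x n))%E.
  have [/andP[h1 h2] /andP[h3 h4]] := stP x n; rewrite -/(st x n) in h1 h2 h3 h4.
  have /= -> := @lebesgue_measure_itv R `]ratr (st x n).1, ratr (st x n).2[.
  rewrite lte_fin ifT; last by have := r0 n; lra.
  by rewrite -EFinB lee_fin; lra.
have shrink x : nicely_shrinking x (E x).
  split; first by move=> n; exact: measurable_itv.
  (* The interval has length at least r and lies in the ball of radius r, whose measure is 2 r:
     hence the ratio 2. *)
  exists (2, fun n => PosNum (r0 n)); split => //=.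
  - exact: cvg_harmonic.
  - move=> n y; rewrite /E /= in_itv/= => /andP[y1 y2].
    have [/andP[h1 h2] /andP[h3 h4]] := stP x n; rewrite -/(st x n) in h1 h2 h3 h4.
    by rewrite /ball/= ltr_norml; lra.
  - move=> n; rewrite lebesgue_measure_ball ?(ltW (r0 n))//.
    apply: (@le_trans _ _ (2%:E * (r n)%:E)%E); first by rewrite -EFinM lee_fin mulr2n mulrDl mul1r.
    by apply: lee_wpmul2l; rewrite ?lee_fin.
have := lebesgue_differentiation lg.
move=> [A [mA A0 sA]]; exists A; split => // x /= nx; apply: sA => /= px; apply: nx.
have H := nice_lebesgue_differentiation shrink lg px.
rewrite -lee_fin -(cvg_lim _ H)//; apply: lime_ge; first by apply/cvg_ex; exists (g x)%:E.
apply: nearW => n; apply: mule_ge0; last exact: g0.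
by rewrite inve_ge0.
Qed.

Lemma ae_countable (R : realType) d (T : measurableType d) (mu : {measure set T -> \bar R})
    (I : countType) (P : I -> T -> Prop) :
  (forall i, {ae mu, forall x, P i x}) -> {ae mu, forall x, forall i, P i x}.
Proof.
move=> H.
have H' n : {ae mu, forall x, if unpickle n is Some i then P i x else True}.
  by case: (unpickle n) => [i|]; [exact: H|exact: aeW].
have [A [mA A0 sA]] := ae_foralln H'.
exists A; split => // x /= nx; apply: sA => /= Hn; apply: nx => i.
by have := Hn (pickle i); rewrite pickleK.
Qed.

(** The one-dimensional criterion is used twice: for each rational interval of the second variable,
    on the partial integral as a function of x; and, for almost every x, on the slice y -> F (x, y).
    The set where F < 0 then has null sections. *)
Lemma ae_ge0_of_rat_box (R : realType) (F : R * R -> R) :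
  (@leb2 R).-integrable [set: mplane R] (EFin \o F) ->
  (forall s1 t1 s2 t2 : rat, (0 <= \int[@leb2 R]_(z in `]ratr s1, ratr t1[%classic `*` `]ratr s2, ratr t2[%classic) (F z)%:E)%E) ->
  {ae @leb2 R, forall z, 0 <= F z}.
Proof.
move=> iF F0.
pose I (q : rat * rat) : set R := `]ratr q.1, ratr q.2[%classic.
have mI q : measurable (I q) by exact: measurable_itv.
have mTI q : measurable ([set: R] `*` I q : set (mplane R)) by apply: measurableX => //; exact: mI.
have mII q q' : measurable (I q `*` I q' : set (mplane R)) by apply: measurableX; exact: mI.
have ires (B : set (mplane R)) : measurable B -> (@leb2 R).-integrable [set: mplane R] ((EFin \o F) \_ B).
  by move=> mB; apply: (integrable_mkcond _ mB).1; exact: integrableS iF.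
pose FJ q := (EFin \o F) \_ ([set: R] `*` I q).
pose G q := fubini_F (@lebesgue_measure R) (FJ q).
have iG q : (@lebesgue_measure R).-integrable [set: R] (G q) by exact: (integrable_fubini_F (ires _ (mTI q))).
(* The partial integrals are finite only almost everywhere, while the criterion speaks of real
   functions; hence [fine]. *)
have G0 q : {ae @lebesgue_measure R, forall x, 0 <= fine (G q x)}.
  have mG := measurable_int _ (iG q).
  have mfG : measurable_fun [set: R] (fine \o G q) by apply: measurableT_comp.
  apply: ae_ge0_of_rat_itv.
    apply: le_integrable (iG q) => //; first exact/measurable_EFinP.
    by move=> x _ /=; case: (G q x) => //=; rewrite normr0 leey.
  move=> s t.
  have -> : (\int[@lebesgue_measure R]_(x in `]ratr s, ratr t[%classic) (fine (G q x))%:E =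
     \int[@lebesgue_measure R]_(x in I (s, t)) G q x)%E.
    have mst := mI (s, t).
    apply: (@ae_eq_integral _ (measurableTypeR R) R (@lebesgue_measure R) (I (s, t)) (G q) (fun x => (fine (G q x))%:E) mst).
    - by apply/measurable_EFinP; exact: measurable_funS mfG.
    - exact: measurable_funS mG.
    - have [A [mA A0 sA]] := integrable_ae measurableT (iG q); exists A; split => // x /= nx.
      by apply: sA => /= fx; apply: nx => _; rewrite fineK// fx.
  rewrite integral_mkcond.
  have -> : (G q) \_ (I (s, t)) = fubini_F (@lebesgue_measure R) ((EFin \o F) \_ (I (s, t) `*` I q)).
    apply/funext => x; rewrite patchE /G /fubini_F; case: ifPn => [/set_mem xI|/negP xI].
      apply: eq_integral => y _; rewrite /FJ !patchE.
      by congr (if _ then _ else _); apply/idP/idP; rewrite !inE => -[].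
    rewrite integral0_eq// => y _; rewrite patchE ifN//; apply/negP; rewrite inE => -[/= xx _].
    by apply: xI; rewrite inE.
  rewrite (integral12_prod_meas1 (ires _ (mII (s, t) q))).
  by have := F0 s t q.1 q.2; rewrite integral_mkcond.
have S1 : {ae @lebesgue_measure R, forall x, {ae @lebesgue_measure R, forall y, 0 <= F (x, y)}}.
  have [A [mA A0 sA]] := ae_countable G0.
  have [B [mB B0 sB]] := ae_integrable1 iF.
  exists (A `|` B); split; [exact: measurableU|by apply/null_set_setU|].
  move=> x /= nx; apply: contrapT => /not_orP[nA nB]; apply: nx.
  have ix : (@lebesgue_measure R).-integrable [set: R] (EFin \o (fun y => F (x, y))).
    by apply: contrapT => h; apply: nB; exact: sB.
  have gx q : 0 <= fine (G q x).
    by move: q; apply: contrapT => h; apply: nA; exact: sA.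
  apply: (ae_ge0_of_rat_itv ix) => s t.
  have E : G (s, t) x = (\int[@lebesgue_measure R]_(y in `]ratr s, ratr t[%classic) (F (x, y))%:E)%E.
    rewrite /G /fubini_F [RHS]integral_mkcond; apply: eq_integral => y _; rewrite /FJ !patchE.
    by congr (if _ then _ else _); apply/idP/idP; rewrite !inE => // -[].
  rewrite -E -(@fineK _ (G (s, t) x)) ?lee_fin//.
  rewrite E; apply: integrable_fin_num; first exact: measurable_itv.
  by apply: integrableS ix.
pose N : set (mplane R) := [set z | F z < 0].
have mF : measurable_fun [set: mplane R] F by apply/measurable_EFinP; exact: measurable_int iF.
have mN : measurable N.
  rewrite (_ : N = [set: mplane R] `&` F @^-1` `]-oo, 0[%classic); first exact: mF.
  by rewrite setTI; apply/seteqP; split => z; rewrite /N/= in_itv.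
exists N; split => //; last by move=> z /= /negP; rewrite -ltNge.
(* By definition of the product measure, N is null as soon as almost all its sections are. *)
rewrite /leb2 /= /product_measure1.
have -> : (\int[@lebesgue_measure R]_x (lebesgue_measure \o xsection N) x =
   \int[@lebesgue_measure R]_(x in [set: R]) (cst 0 x))%E.
  apply: ae_eq_integral => //; first exact: measurable_fun_xsection.
  have [A [mA A0 sA]] := S1; exists A; split => // x /= nx; apply: sA => /= Hx; apply: nx => _.
  have [B [mB B0 sB]] := Hx.
  apply: (subset_measure0 _ _ _ B0) => //; first exact: measurable_xsection.
  move=> y; rewrite /xsection /= inE /N /= => Fy; apply: sB => /= Fxy.
  by move: Fy; rewrite ltNge Fxy.
by rewrite integral0.
Qed.

(** * The quadratic inequality at almost every point *)

Lemma open_rectangle (R : realType) (l1 u1 l2 u2 : R) :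
  open (`]l1, u1[%classic `*` `]l2, u2[%classic : set (R * R)).
Proof.
rewrite (_ : _ `*` _ = fst @^-1` `]l1, u1[%classic `&` snd @^-1` `]l2, u2[%classic)//.
apply: openI; apply: open_comp => [x _|]; do ?exact: interval_open.
- exact: cvg_fst.
- exact: cvg_snd.
Qed.

(** The differential at U of V -> Phi(|V|) V, applied to eta, when U differs from 0 and [dPhi] is
    the derivative of [Phi]. *)
Definition radial_diff (R : realType) (m : nat) (Phi dPhi : R -> R) (U eta : 'cV[R[i]]_m) : 'cV[R[i]]_m :=
  (dPhi (vnorm U) * (rdot U eta / vnorm U))%:C *: U + (Phi (vnorm U))%:C *: eta.

Lemma radial_vec0 (R : realType) (m : nat) (Phi dPhi : R -> R) (U eta : 'cV[R[i]]_m) (T : R) : 0 <= T ->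
  radial_vec Phi dPhi U eta T 0 = radial_diff Phi dPhi U eta.
Proof.
move=> T0; apply/matrixP => i j; rewrite !mxE (ord1 j) !radial_deriv0// -!vnormE.
case: (U i ord0) => u1 u2; case: (eta i ord0) => e1 e2.
by apply/eqP; rewrite eq_complex /=; apply/andP; split; apply/eqP; ring.
Qed.

Definition sqrt_phi_deriv (R : realType) (phi : R -> R) (s : R) : R :=
  phi^`()%classic s / (2 * Num.sqrt (phi s)).

(** What the oscillation leaves of the integrand beside [chi ^+ 2]. It takes the matrices at a
    single point, so that its continuity in xi, U and eta is a pointwise statement. *)
Definition dissipation_form (R : realType) (m : nat) (A : 'I_2 -> 'I_2 -> 'M[R[i]]_m)
    (phi : R -> R) (kappa : R) (xi : R * R) (U eta : 'cV[R[i]]_m) : R :=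
  \sum_(h < 2) \sum_(k < 2) coord2 xi k * coord2 xi h *
     rdot (A h k *m eta) (radial_diff phi phi^`()%classic U eta) -
  kappa * \sum_(k < 2) coord2 xi k * coord2 xi k *
     rdot (radial_diff (fun s => Num.sqrt (phi s)) (sqrt_phi_deriv phi) U eta)
          (radial_diff (fun s => Num.sqrt (phi s)) (sqrt_phi_deriv phi) U eta).

Section pointwise.
Variables (R : realType) (m : nat) (Omega : set (R * R)) (a : 'I_2 -> 'I_2 -> R * R -> 'M[R[i]]_m).
Variables (phi : R -> R) (kappa : R).
Hypothesis oO : open Omega.
Hypothesis a_bounded : forall h k i j, cLfun Omega +oo%E (fun x => a h k x i j).
Hypothesis phiP : phi_conditions phi.
Hypothesis kappa0 : 0 < kappa.
Hypothesis dissA : forall (u : R * R -> 'cV[R[i]]_m) (du dw dv : 'I_2 -> R * R -> 'cV[R[i]]_m),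
      vsobolev_H10 Omega u du ->
      vsobolev_H10 Omega (modulate phi u) dw ->
      vweak_grad Omega (modulate (fun s => Num.sqrt (phi s)) u) dv ->
      (kappa%:E * \int[@leb2 R]_(x in Omega)
         (\sum_(k < 2) vnorm (dv k x) ^+ 2)%:E
       <= (complex.Re (cintegral Omega (fun x =>
             \sum_(h < 2) \sum_(k < 2)
               hdot (a h k x *m du k x) (dw h x))))%:E)%E.

Let q (xi : R * R) (U eta : 'cV[R[i]]_m) (x : R * R) : R :=
  dissipation_form (fun h k => a h k x) phi kappa xi U eta.

Lemma radial_vec_continuous0 (Phi dPhi : R -> R) (U eta v : 'cV[R[i]]_m) (T : R) :
  (forall s : R, 0 < s -> is_derive s 1 Phi (dPhi s) /\ {for s, continuous dPhi}) ->
  0 < T -> (forall t, `|t| <= T -> 0 < rdot U U + 2 * rdot U eta * t + rdot eta eta * t ^+ 2) ->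
  continuous (fun t => rdot v (radial_vec Phi dPhi U eta T t)) /\
  continuous (fun t => rdot (radial_vec Phi dPhi U eta T t) (radial_vec Phi dPhi U eta T t)).
Proof.
move=> HPhi T0 pos.
pose r c d (t : R) := radial_deriv Phi dPhi (rdot U U) (rdot U eta) (rdot eta eta) T c d t.
have cr c d : continuous (r c d) by exact: (@radial_deriv_continuous R Phi dPhi _ _ _ T HPhi (ltW T0) pos c d).
have csum (F : 'I_m -> R -> R) : (forall i, continuous (F i)) -> continuous (fun t => \sum_i F i t).
  by move=> cF t; apply: cvg_big => [|i _]; [exact: add_continuous|exact: cF].
split.
- rewrite (_ : (fun t => _) = (fun t => \sum_i (complex.Re (v i ord0) * r (complex.Re (U i ord0)) (complex.Re (eta i ord0)) t +
     complex.Im (v i ord0) * r (complex.Im (U i ord0)) (complex.Im (eta i ord0)) t))).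
    by apply: csum => i t; apply: cvgD; apply: cvgM; (exact: cvg_cst || exact: cr).
  by apply/funext => t; rewrite rdotE; apply: eq_bigr => i _; rewrite !mxE.
- rewrite (_ : (fun t => _) = (fun t => \sum_i (r (complex.Re (U i ord0)) (complex.Re (eta i ord0)) t * r (complex.Re (U i ord0)) (complex.Re (eta i ord0)) t +
     r (complex.Im (U i ord0)) (complex.Im (eta i ord0)) t * r (complex.Im (U i ord0)) (complex.Im (eta i ord0)) t))).
    by apply: csum => i t; apply: cvgD; apply: cvgM; exact: cr.
  by apply/funext => t; rewrite rdotE; apply: eq_bigr => i _; rewrite !mxE.
Qed.

Lemma ae_bounded_form (xi : R * R) (U eta : 'cV[R[i]]_m) : ae_bounded_seq Omega (fun _ => q xi U eta).
Proof.
have Hc c : ae_bounded_seq Omega (fun _ _ => c : R) := ae_bounded_seq_cst Omega c.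
apply: (@eq_ae_bounded_seq _ _ (fun _ x => \sum_(h < 2) \sum_(k < 2) coord2 xi k * coord2 xi h *
     rdot (a h k x *m eta) (radial_diff phi phi^`()%classic U eta) +
  - (kappa * \sum_(k < 2) coord2 xi k * coord2 xi k *
     rdot (radial_diff (fun s => Num.sqrt (phi s)) (sqrt_phi_deriv phi) U eta)
          (radial_diff (fun s => Num.sqrt (phi s)) (sqrt_phi_deriv phi) U eta)))) => //.
apply: ae_bounded_seqD => //; apply: ae_bounded_seq_sum => h; apply: ae_bounded_seq_sum => k.
apply: ae_bounded_seqM => //.
by apply: (@ae_bounded_mulmx R m Omega (a h k) eta (fun _ _ => _)).
Qed.

(** The margin d leaves room in Omega for the descent of tau around the rectangle that carries
    chi. *)
Lemma form_cutoff (l1 u1 l2 u2 d : R) (xi : R * R) (U eta : 'cV[R[i]]_m) (chi : R * R -> R) :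
  0 < d -> (`[l1 - d, u1 + d]%classic `*` `[l2 - d, u2 + d]%classic) `<=` Omega ->
  0 < rdot U U -> smooth chi ->
  (forall x, ~ (`[l1, u1]%classic `*` `[l2, u2]%classic) x -> chi x = 0) ->
  0 <= \int[@leb2 R]_(x in Omega) (q xi U eta x * chi x ^+ 2).
Proof.
move=> d0; set K := `[l1 - d, u1 + d]%classic `*` `[l2 - d, u2 + d]%classic => KO U0 schi chi0.
have cK : compact K by apply: compact_setX; exact: segment_compact.
have d20 : 0 < 2 / d by rewrite divr_gt0.
(* The transition has width d / 2: tau is 1 up to distance d / 2 from the rectangle and 0 beyond
   distance d. *)
pose tau := cutoff (2 / d) (l1 - d) (u1 + d) (l2 - d) (u2 + d).
have stau : smooth tau by exact: smooth_cutoff.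
have tau01 x : 0 <= tau x <= 1 by rewrite cutoff_ge0 cutoff_le1.
have tau0 x : ~ K x -> tau x = 0 by exact: cutoff_eq0.
have sep : plateau_on tau chi.
  (* The open rectangle enlarged by d / 2, where tau is 1, and the complement of the closed
     rectangle, where chi is 0, are open and cover the plane. *)
  move=> x; have [xO|xO] := pselect ((`]l1 - d / 2, u1 + d / 2[%classic `*` `]l2 - d / 2, u2 + d / 2[%classic) x).
    left; have : open_nbhs x (`]l1 - d / 2, u1 + d / 2[%classic `*` `]l2 - d / 2, u2 + d / 2[%classic).
      by split => //; exact: open_rectangle.
    move=> /open_nbhs_nbhs; apply: filterS => -[y1 y2] [] /=; rewrite !in_itv/= => /andP[h1 h2] /andP[h3 h4].
    by apply: cutoff_eq1 => //=; rewrite invf_div; apply/andP; split; lra.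
  right; have : open_nbhs x (~` (`[l1, u1]%classic `*` `[l2, u2]%classic)).
    split; last by move=> [h1 h2]; apply: xO; move: h1 h2; rewrite /= !in_itv/= => /andP[? ?] /andP[? ?]; split; apply/andP; split; lra.
    by apply: closed_openC; apply: compact_closed; [exact: norm_hausdorff|apply: compact_setX; exact: segment_compact].
  by move=> /open_nbhs_nbhs; apply: filterS => y; exact: chi0.
have [T T0 pos] := positive_quadratic_near0 (rdot U eta) (rdot eta eta) U0.
have [C0 HC] := energy_inequality oO a_bounded phiP kappa0 dissA U0 T0 pos cK KO stau tau01 tau0.
have Hp (s : R) : 0 < s -> is_derive s 1 phi (phi^`()%classic s) /\ {for s, continuous phi^`()%classic}.
  by move=> s0; exact: phi_is_derive.
have Hs (s : R) : 0 < s -> is_derive s 1 (fun s => Num.sqrt (phi s)) (sqrt_phi_deriv phi s) /\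
    {for s, continuous (sqrt_phi_deriv phi)}.
  by move=> s0; exact: sqrt_phi_is_derive.
have bX h k (psi : nat -> R * R -> R) : (forall n, continuous (psi n)) ->
    ae_bounded_seq Omega (fun n x => rdot (a h k x *m eta) (wvec phi U eta T (psi n x))).
  by move=> cpsi; exact: (@ae_bounded_mulmx_radial R m _ _ U eta T Hp T0 pos Omega psi cpsi (a h k) eta).
have bb (psi : nat -> R * R -> R) : (forall n, continuous (psi n)) ->
    ae_bounded_seq Omega (fun n x => rdot (vvec phi U eta T (psi n x)) (vvec phi U eta T (psi n x))).
  by move=> cpsi; exact: (@ae_bounded_radial_sqr R m _ _ U eta T Hs T0 pos Omega psi cpsi).
have cX h k x : {for 0, continuous (fun t => rdot (a h k x *m eta) (wvec phi U eta T t))}.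
  by have [+ _] := radial_vec_continuous0 (a h k x *m eta) Hp T0 pos; exact.
have cb : {for 0, continuous (fun t => rdot (vvec phi U eta T t) (vvec phi U eta T t))}.
  by have [_] := radial_vec_continuous0 0 Hs T0 pos; exact.
have [_] := @oscillation_limit R Omega K tau chi T kappa C0
  (fun h k x t => rdot (a h k x *m eta) (wvec phi U eta T t))
  (fun t => rdot (vvec phi U eta T t) (vvec phi U eta T t)) xi oO cK tau0 T0 HC bX cX bb cb schi sep.
by rewrite /wvec /vvec !radial_vec0 ?(ltW T0).
Qed.

Lemma itvoo_setI (l u s t : R) :
  `]l, u[%classic `&` `]s, t[%classic = `]Num.max l s, Num.min u t[%classic :> set R.
Proof.
apply/seteqP; split => x /=; rewrite !in_itv/= gt_max lt_min.
  by move=> [/andP[-> ->] /andP[-> ->]].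
by move=> /andP[/andP[-> ->] /andP[-> ->]].
Qed.

(** The squares of the cutoffs of the inner rectangle are bounded by 1 and converge to its
    indicator, so dominated convergence puts the indicator in place of [chi ^+ 2]. *)
Lemma form_rectangle (l1 u1 l2 u2 d s1 t1 s2 t2 : R) (xi : R * R) (U eta : 'cV[R[i]]_m) :
  0 < d -> (`[l1 - d, u1 + d]%classic `*` `[l2 - d, u2 + d]%classic) `<=` Omega ->
  0 < rdot U U -> l1 <= s1 -> t1 <= u1 -> l2 <= s2 -> t2 <= u2 ->
  (@leb2 R).-integrable (Omega : set (mplane R))
    (fun x => (q xi U eta x * \1_(`]s1, t1[%classic `*` `]s2, t2[%classic) x)%:E) /\
  0 <= \int[@leb2 R]_(x in Omega) (q xi U eta x * \1_(`]s1, t1[%classic `*` `]s2, t2[%classic) x).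
Proof.
move=> d0 KO U0 ls1 tu1 ls2 tu2.
pose K := `[l1 - d, u1 + d]%classic `*` `[l2 - d, u2 + d]%classic : set (R * R).
have cK : compact K by apply: compact_setX; exact: segment_compact.
pose chi n := @cutoff R n.+1%:R s1 t1 s2 t2.
have M0 n : 0 < n.+1%:R :> R by [].
have chi0 n x : ~ (`[l1, u1]%classic `*` `[l2, u2]%classic) x -> chi n x = 0.
  move=> H; apply: cutoff_eq0 => // -[h1 h2]; apply: H; move: h1 h2.
  by rewrite /= !in_itv/= => /andP[? ?] /andP[? ?]; split; apply/andP; split; lra.
have chiK n x : ~ K x -> chi n x = 0.
  move=> H; apply: chi0 => -[h1 h2]; apply: H; move: h1 h2.
  by rewrite /K /= !in_itv/= => /andP[? ?] /andP[? ?]; split; apply/andP; split; lra.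
have [i1 cv] : (@leb2 R).-integrable (Omega : set (mplane R))
    (fun x => (q xi U eta x * \1_(`]s1, t1[%classic `*` `]s2, t2[%classic) x)%:E) /\
    \int[@leb2 R]_(x in Omega) (q xi U eta x * chi n x ^+ 2) @[n --> \oo] -->
    \int[@leb2 R]_(x in Omega) (q xi U eta x * \1_(`]s1, t1[%classic `*` `]s2, t2[%classic) x).
  apply: (dominated_cvg_supp oO cK).
  - apply: ae_bounded_seqM; first exact: ae_bounded_form.
    have c1 : ae_bounded_seq Omega chi.
      apply: (@ae_bounded_seq_continuous _ _ 1) => [n|n x].
        by apply: smooth_continuous; exact: smooth_cutoff.
      by rewrite ger0_norm ?cutoff_ge0 ?cutoff_le1.
    exact: (ae_bounded_seqM c1 c1).
  - by move=> n x _ Kx; rewrite chiK// expr0n mulr0.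
  - move=> x _; apply: cvgM; first exact: cvg_cst.
    have H := @cutoff_cvg R s1 t1 s2 t2 x.
    have /= := (cvgM H H).
    have -> : \1_(`]s1, t1[%classic `*` `]s2, t2[%classic) x * \1_(`]s1, t1[%classic `*` `]s2, t2[%classic) x =
        \1_(`]s1, t1[%classic `*` `]s2, t2[%classic) x :> R.
      by rewrite indicE; case: (_ \in _); rewrite ?mulr1 ?mulr0.
    have -> : (fun n => chi n x ^+ 2) = (fun n => chi n x * chi n x) by apply/funext => n; rewrite expr2.
    exact.
split => //; rewrite -(cvg_lim _ cv)//; apply: limr_ge; first by apply/cvg_ex; eexists; exact: cv.
apply: nearW => n; apply: (@form_cutoff l1 u1 l2 u2 d xi U eta (chi n) d0 KO U0); [exact: smooth_cutoff|exact: chi0].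
Qed.

(** Multiplied by the indicator of the rectangle, the form is integrable on the plane, and its
    integral over a rational box is that over an intersection of two rectangles, to which
    [form_rectangle] applies. *)
Lemma form_ae_rectangle (l1 u1 l2 u2 d : R) (xi : R * R) (U eta : 'cV[R[i]]_m) :
  0 < d -> (`[l1 - d, u1 + d]%classic `*` `[l2 - d, u2 + d]%classic) `<=` Omega ->
  0 < rdot U U ->
  {ae @leb2 R, forall x, (`]l1, u1[%classic `*` `]l2, u2[%classic) x -> 0 <= q xi U eta x}.
Proof.
move=> d0 KO U0.
pose O : set (R * R) := `]l1, u1[%classic `*` `]l2, u2[%classic.
have OO : O `<=` Omega.
  move=> x [h1 h2]; apply: KO; move: h1 h2.
  by rewrite /= !in_itv/= => /andP[? ?] /andP[? ?]; split; apply/andP; split; lra.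
have mO : measurable (Omega : set (mplane R)) by exact: open_plane_measurable.
pose F x := q xi U eta x * \1_O x.
have [iF _] := form_rectangle xi eta d0 KO U0 (lexx l1) (lexx u1) (lexx l2) (lexx u2).
have F0 x : ~ O x -> F x = 0.
  by move=> Ox; rewrite /F indicE memNset// mulr0.
have iF' : (@leb2 R).-integrable [set: mplane R] (EFin \o F).
  rewrite (_ : EFin \o F = (EFin \o F) \_ Omega); first exact: (integrable_mkcond _ mO).1.
  by apply/funext => x; rewrite patchE; case: ifPn => // /negP; rewrite inE => Ox /=; rewrite F0// => /OO.
have := ae_ge0_of_rat_box iF'.
suff H (s1 t1 s2 t2 : rat) : (0 <= \int[@leb2 R]_(z in `]ratr s1, ratr t1[%classic `*` `]ratr s2, ratr t2[%classic) (F z)%:E)%E.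
  move=> /(_ H); apply: leb2_ae_mono => x Fx Ox; move: Fx.
  by rewrite /F indicE mem_set// mulr1.
have [l1' u1'] : l1 <= Num.max l1 (ratr s1) /\ Num.min u1 (ratr t1) <= u1 by rewrite le_max ge_min !lexx.
have [l2' u2'] : l2 <= Num.max l2 (ratr s2) /\ Num.min u2 (ratr t2) <= u2 by rewrite le_max ge_min !lexx.
have [i2 r2] := form_rectangle xi eta d0 KO U0 l1' u1' l2' u2'.
rewrite (_ : (\int[_]_(z in _) _)%E = (\int[@leb2 R]_(x in Omega) (q xi U eta x *
   \1_(`]Num.max l1 (ratr s1), Num.min u1 (ratr t1)[%classic `*` `]Num.max l2 (ratr s2), Num.min u2 (ratr t2)[%classic) x))%:E).
  by rewrite lee_fin.
rewrite /Rintegral fineK; last exact: (integrable_fin_num mO).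
rewrite [LHS]integral_mkcond [RHS]integral_mkcond; apply: eq_integral => x _.
rewrite -!itvoo_setI !patchE indicE.
have -> : (x \in (`]l1, u1[%classic `&` `]ratr s1, ratr t1[%classic) `*` (`]l2, u2[%classic `&` `]ratr s2, ratr t2[%classic)) =
    (x \in O) && (x \in `]ratr s1, ratr t1[%classic `*` `]ratr s2, ratr t2[%classic).
  by apply/idP/andP; rewrite !inE; [move=> [[? ?] [? ?]]|move=> [[? ?] [? ?]]].
rewrite /F indicE; have [xO|xO] := boolP (x \in O) => /=.
  have -> : x \in Omega by rewrite inE; apply: OO; rewrite inE in xO.
  by rewrite mulr1; case: ifP => _; rewrite ?mulr1 ?mulr0.
by rewrite mulr0; case: ifP => _; case: ifP.
Qed.

(** Omega is covered by the countably many rational rectangles that stay inside it when enlarged by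
    some positive rational margin. *)
Lemma form_ae (xi : R * R) (U eta : 'cV[R[i]]_m) : 0 < rdot U U ->
  {ae @leb2 R, forall x, Omega x -> 0 <= q xi U eta x}.
Proof.
move=> U0.
pose box (c : rat * rat * rat * rat) : set (R * R) :=
  `]ratr c.1.1.1, ratr c.1.1.2[%classic `*` `]ratr c.1.2, ratr c.2[%classic.
pose big (c : rat * rat * rat * rat) (d : rat) : set (R * R) :=
  `[ratr c.1.1.1 - ratr d, ratr c.1.1.2 + ratr d]%classic `*` `[ratr c.1.2 - ratr d, ratr c.2 + ratr d]%classic.
have H (cd : rat * rat * rat * rat * rat) : {ae @leb2 R, forall x, 0 < cd.2 -> big cd.1 cd.2 `<=` Omega ->
    box cd.1 x -> 0 <= q xi U eta x}.
  have [d0|d0] := ltP 0 cd.2; last by apply: aeW.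
  have [bO|bO] := pselect (big cd.1 cd.2 `<=` Omega); last by apply: aeW => x _ /bO.
  have d0' : 0 < ratr cd.2 :> R by rewrite ltr0q.
  by have := form_ae_rectangle xi eta d0' bO U0; apply: leb2_ae_mono => x Hx _ _; exact: Hx.
have := ae_countable H; apply: leb2_ae_mono => -[x y] Hx Ox.
have /nbhs_ballP[e /= e0 eO] := open_nbhs_nbhs (conj oO Ox).
have ratl (t : R) : exists c : rat, t - e / 4 < ratr c < t.
  have [|c] := @rat_in_itvoo R (t - e / 4) t; first by lra.
  by rewrite in_itv; exists c.
have ratu (t : R) : exists c : rat, t < ratr c < t + e / 4.
  have [|c] := @rat_in_itvoo R t (t + e / 4); first by lra.
  by rewrite in_itv; exists c.
have [[q1 /andP[q1l q1u]] [q2 /andP[q2l q2u]]] := (ratl x, ratu x).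
have [[q3 /andP[q3l q3u]] [q4 /andP[q4l q4u]]] := (ratl y, ratu y).
(* Endpoints within e / 4 of the point and a margin below e / 4 keep the enlarged box inside the
   ball of radius e. *)
have [dd /andP[dl du]] := ratu 0; rewrite add0r in du.
apply: (Hx ((q1, q2, q3, q4), dd)) => /=.
- by rewrite -(ltr0q R).
- move=> [s t] [] /=; rewrite !in_itv/= => /andP[h1 h2] /andP[h3 h4].
  by apply: eO; split; rewrite /ball/= ltr_norml; apply/andP; split; lra.
- by split; rewrite /= in_itv/=; apply/andP.
Qed.

End pointwise.

(** * Large amplitudes *)

Definition vcvg (R : realType) (m : nat) (V_ : nat -> 'cV[R[i]]_m) (V : 'cV[R[i]]_m) : Prop :=
  forall i, complex.Re (V_ n i ord0) @[n --> \oo] --> complex.Re (V i ord0) /\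
            complex.Im (V_ n i ord0) @[n --> \oo] --> complex.Im (V i ord0).

Lemma vcvgD (R : realType) (m : nat) (V_ W_ : nat -> 'cV[R[i]]_m) (V W : 'cV[R[i]]_m) :
  vcvg V_ V -> vcvg W_ W -> vcvg (fun n => V_ n + W_ n) (V + W).
Proof.
move=> cV cW i; have [v1 v2] := cV i; have [w1 w2] := cW i.
rewrite !mxE raddfD /= raddfD; split.
- rewrite (_ : (fun n => _) = (fun n => complex.Re (V_ n i ord0) + complex.Re (W_ n i ord0))); first exact: cvgD.
  by apply/funext => n; rewrite mxE ReD.
- rewrite (_ : (fun n => _) = (fun n => complex.Im (V_ n i ord0) + complex.Im (W_ n i ord0))); first exact: cvgD.
  by apply/funext => n; rewrite mxE raddfD.
Qed.

Lemma vcvgZ (R : realType) (m : nat) (c_ : nat -> R) (c : R) (V_ : nat -> 'cV[R[i]]_m) (V : 'cV[R[i]]_m) :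
  c_ n @[n --> \oo] --> c -> vcvg V_ V -> vcvg (fun n => (c_ n)%:C *: V_ n) (c%:C *: V).
Proof.
move=> cc cV i; have [v1 v2] := cV i.
have E (s : R) (v : 'cV[R[i]]_m) : complex.Re ((s%:C *: v) i ord0) = s * complex.Re (v i ord0) /\
    complex.Im ((s%:C *: v) i ord0) = s * complex.Im (v i ord0).
  by rewrite mxE; case: (v i ord0) => x y /=; split; ring.
rewrite (E _ _).1 (E _ _).2; split.
- by under eq_cvg do rewrite (E _ _).1; exact: cvgM.
- by under eq_cvg do rewrite (E _ _).2; exact: cvgM.
Qed.

Lemma vcvg_mulmx (R : realType) (m : nat) (A : 'M[R[i]]_m) (V_ : nat -> 'cV[R[i]]_m) (V : 'cV[R[i]]_m) :
  vcvg V_ V -> vcvg (fun n => A *m V_ n) (A *m V).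
Proof.
move=> cV i.
have E (v : 'cV[R[i]]_m) : complex.Re ((A *m v) i ord0) =
    \sum_j (complex.Re (A i j) * complex.Re (v j ord0) - complex.Im (A i j) * complex.Im (v j ord0)) /\
  complex.Im ((A *m v) i ord0) =
    \sum_j (complex.Re (A i j) * complex.Im (v j ord0) + complex.Im (A i j) * complex.Re (v j ord0)).
  rewrite mxE !raddf_sum; split; apply: eq_bigr => j _;
    by case: (A i j) => ? ?; case: (v j ord0).
rewrite (E V).1 (E V).2; split.
- under eq_cvg do rewrite (E _).1; apply: cvg_fin_sum => j; have [v1 v2] := cV j.
  by apply: cvgB; apply: cvgM => //; exact: cvg_cst.
- under eq_cvg do rewrite (E _).2; apply: cvg_fin_sum => j; have [v1 v2] := cV j.
  by apply: cvgD; apply: cvgM => //; exact: cvg_cst.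
Qed.

Lemma cvg_rdot (R : realType) (m : nat) (V_ W_ : nat -> 'cV[R[i]]_m) (V W : 'cV[R[i]]_m) :
  vcvg V_ V -> vcvg W_ W -> rdot (V_ n) (W_ n) @[n --> \oo] --> rdot V W.
Proof.
move=> cV cW; rewrite rdotE; under eq_cvg do rewrite rdotE.
apply: cvg_fin_sum => i; have [v1 v2] := cV i; have [w1 w2] := cW i.
by apply: cvgD; apply: cvgM.
Qed.

Lemma cvg_vnorm (R : realType) (m : nat) (V_ : nat -> 'cV[R[i]]_m) (V : 'cV[R[i]]_m) :
  vcvg V_ V -> vnorm (V_ n) @[n --> \oo] --> vnorm V.
Proof.
move=> cV; rewrite vnormE; under eq_cvg do rewrite vnormE.
by apply: continuous_cvg; [exact: sqrt_continuous|exact: cvg_rdot].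
Qed.

Lemma vcvg_radial_diff (R : realType) (m : nat) (Phi dPhi : R -> R)
    (U_ eta_ : nat -> 'cV[R[i]]_m) (U eta : 'cV[R[i]]_m) :
  0 < rdot U U -> {for vnorm U, continuous Phi} -> {for vnorm U, continuous dPhi} ->
  vcvg U_ U -> vcvg eta_ eta ->
  vcvg (fun n => radial_diff Phi dPhi (U_ n) (eta_ n)) (radial_diff Phi dPhi U eta).
Proof.
move=> U0 cPhi cdPhi cU ceta; have cN := cvg_vnorm cU.
have N0 : vnorm U != 0 by rewrite vnormE gt_eqF// sqrtr_gt0.
apply: vcvgD; apply: vcvgZ => //.
- apply: cvgM; first exact: continuous_cvg cN.
  by apply: cvgM; [exact: cvg_rdot|exact: cvgV].
- exact: continuous_cvg cN.
Qed.

(** Continuity in all parameters away from U = 0; the derivative of phi at |U| enters through the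
    radial terms, so condition (i) is used here. *)
Lemma cvg_dissipation_form (R : realType) (m : nat) (A : 'I_2 -> 'I_2 -> 'M[R[i]]_m)
    (phi : R -> R) (kappa : R) (xi_ : nat -> R * R) (U_ eta_ : nat -> 'cV[R[i]]_m)
    (xi : R * R) (U eta : 'cV[R[i]]_m) :
  phi_conditions phi -> 0 < rdot U U ->
  (forall k, coord2 (xi_ n) k @[n --> \oo] --> coord2 xi k) -> vcvg U_ U -> vcvg eta_ eta ->
  dissipation_form A phi kappa (xi_ n) (U_ n) (eta_ n) @[n --> \oo] -->
  dissipation_form A phi kappa xi U eta.
Proof.
move=> phiP U0 cxi cU ceta.
have N0 : 0 < vnorm U by rewrite vnormE sqrtr_gt0.
have [d1 c1] := phi_is_derive phiP N0; have [d2 c2] := sqrt_phi_is_derive phiP N0.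
have cp := phi_continuous phiP N0.
have cs : {for vnorm U, continuous (fun s => Num.sqrt (phi s))}.
  by apply: continuous_comp => //; exact: sqrt_continuous.
have cW : vcvg (fun n => radial_diff phi phi^`()%classic (U_ n) (eta_ n)) (radial_diff phi phi^`()%classic U eta).
  exact: vcvg_radial_diff.
have cV : vcvg (fun n => radial_diff (fun s => Num.sqrt (phi s)) (sqrt_phi_deriv phi) (U_ n) (eta_ n))
    (radial_diff (fun s => Num.sqrt (phi s)) (sqrt_phi_deriv phi) U eta).
  exact: vcvg_radial_diff.
apply: cvgB.
- apply: cvg_fin_sum => h; apply: cvg_fin_sum => k; apply: cvgM.
    by apply: cvgM; exact: cxi.
  by apply: cvg_rdot => //; exact: vcvg_mulmx.
- apply: cvgM; first exact: cvg_cst.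
  apply: cvg_fin_sum => k; apply: cvgM; last exact: cvg_rdot.
  by apply: cvgM; exact: cxi.
Qed.

Lemma rat_cvg (R : realType) (x : R) : {q : nat -> rat | ratr (q n) @[n --> \oo] --> x}.
Proof.
have H n : exists q : rat, x - n.+1%:R^-1 <= ratr q <= x.
  have [|q] := @rat_in_itvoo R (x - n.+1%:R^-1) x; first by rewrite ltrBlDr ltrDl invr_gt0.
  by rewrite in_itv/= => /andP[q1 q2]; exists q; rewrite !ltW.
exists (fun n => projT1 (cid (H n))).
apply: (@squeeze_cvgr _ _ _ _ (fun n => x - n.+1%:R^-1) (fun _ => x)); last exact: cvg_cst.
- by apply: nearW => n; exact: (projT2 (cid (H n))).
- rewrite -[X in _ --> X]subr0; apply: cvgB; first exact: cvg_cst.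
  exact: (@cvg_harmonic R).
Qed.

Definition rat_vec (R : realType) (m : nat) (f : {ffun 'I_m -> rat * rat}) : 'cV[R[i]]_m :=
  \col_i (ratr (f i).1 +i* ratr (f i).2).

Lemma rat_vec_cvg (R : realType) (m : nat) (V : 'cV[R[i]]_m) :
  exists f : nat -> {ffun 'I_m -> rat * rat}, vcvg (fun n => rat_vec R (f n)) V.
Proof.
exists (fun n => [ffun i => (projT1 (rat_cvg (complex.Re (V i ord0))) n, projT1 (rat_cvg (complex.Im (V i ord0))) n)]).
move=> i; split.
- by under eq_cvg do rewrite mxE ffunE /=; exact: (projT2 (rat_cvg _)).
- by under eq_cvg do rewrite mxE ffunE /=; exact: (projT2 (rat_cvg _)).
Qed.

Section pointwise_all.
Variables (R : realType) (m : nat) (Omega : set (R * R)) (a : 'I_2 -> 'I_2 -> R * R -> 'M[R[i]]_m).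
Variables (phi : R -> R) (kappa : R).
Hypothesis phiP : phi_conditions phi.
Hypothesis form_ae : forall (xi : R * R) (U eta : 'cV[R[i]]_m), 0 < rdot U U ->
  {ae @leb2 R, forall x, Omega x -> 0 <= dissipation_form (fun h k => a h k x) phi kappa xi U eta}.

(** The null set depends on xi, U and eta, so it is taken once for the countably many rational
    parameters; density and continuity at a fixed x extend the inequality to all. *)
Lemma form_ae_all : {ae @leb2 R, forall x, Omega x -> forall (xi : R * R) (U eta : 'cV[R[i]]_m),
  0 < rdot U U -> 0 <= dissipation_form (fun h k => a h k x) phi kappa xi U eta}.
Proof.
have H (c : (rat * rat) * ({ffun 'I_m -> rat * rat} * {ffun 'I_m -> rat * rat})) :
    {ae @leb2 R, forall x, 0 < rdot (rat_vec R c.2.1) (rat_vec R c.2.1) -> Omega x ->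
      0 <= dissipation_form (fun h k => a h k x) phi kappa (ratr c.1.1, ratr c.1.2) (rat_vec R c.2.1) (rat_vec R c.2.2)}.
  have [U0|U0] := ltP 0 (rdot (rat_vec R c.2.1) (rat_vec R c.2.1)); last by apply: aeW.
  by have := form_ae (ratr c.1.1, ratr c.1.2) (rat_vec R c.2.2) U0; apply: leb2_ae_mono => x Hx _; exact: Hx.
have := ae_countable H; apply: leb2_ae_mono => x Hx Ox xi U eta U0.
have [U_ cU] := rat_vec_cvg U; have [eta_ ceta] := rat_vec_cvg eta.
pose xi_ n := (projT1 (rat_cvg xi.1) n, projT1 (rat_cvg xi.2) n).
have cxi k : coord2 (ratr (xi_ n).1, ratr (xi_ n).2) k @[n --> \oo] --> coord2 xi k.
  by rewrite /coord2; case: ifP => _; exact: (projT2 (rat_cvg _)).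
have cF := @cvg_dissipation_form R m (fun h k => a h k x) phi kappa _ _ _ xi U eta phiP U0 cxi cU ceta.
rewrite -(cvg_lim _ cF)//; apply: limr_ge; first by apply/cvg_ex; eexists; exact: cF.
(* The approximations of U may be zero for small n; they are eventually nonzero because U is. *)
near=> n; apply: (Hx (xi_ n, (U_ n, eta_ n))) => //=.
near: n; exact: (cvgr_gt _ (cvg_rdot cU cU) _ U0).
Unshelve. all: by end_near. Qed.

End pointwise_all.

(** * Directions adapted to Lambda, and the conclusion *)

Lemma rdot_symbol (R : realType) (m : nat) (a : 'I_2 -> 'I_2 -> R * R -> 'M[R[i]]_m) (x xi : R * R)
    (v w : 'cV[R[i]]_m) :
  rdot (symbol a x xi *m v) w = \sum_(h < 2) \sum_(k < 2) coord2 xi k * coord2 xi h * rdot (a h k x *m v) w.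
Proof.
have rdot_sum (F : 'I_2 -> 'cV[R[i]]_m) : rdot (\sum_h F h) w = \sum_h rdot (F h) w.
  by rewrite !big_ord_recl !big_ord0 !addr0 rdotDl.
rewrite /symbol mulmx_suml rdot_sum; apply: eq_bigr => h _.
rewrite mulmx_suml rdot_sum; apply: eq_bigr => k _.
by rewrite -scalemxAl rdotZl [coord2 xi h * _]mulrC.
Qed.

(** L is kept free to display the coefficient of the radial part; the value of [Lambda] is the one
    that makes this coefficient vanish when Phi is sqrt(phi). *)
Lemma radial_diff_direction (R : realType) (m : nat) (Phi dPhi : R -> R) (s L : R) (zeta omega : 'cV[R[i]]_m) :
  0 < s -> rdot omega omega = 1 ->
  radial_diff Phi dPhi (s%:C *: omega) (zeta + (L * rdot zeta omega)%:C *: omega) =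
  (Phi s)%:C *: zeta +
  ((Phi s * L + s * dPhi s * (1 + L)) * rdot zeta omega)%:C *: omega.
Proof.
move=> s0 w1; have vs : vnorm (s%:C *: omega) = s.
  by rewrite vnormZ ?ltW// vnormE w1 sqrtr1 mulr1.
rewrite /radial_diff vs rdotZl rdotDr rdotZr w1 (rdotC omega zeta).
have -> : s * (rdot zeta omega + L * rdot zeta omega * 1) / s = (1 + L) * rdot zeta omega.
  by field; rewrite gt_eqF.
rewrite scalerDr !scalerA addrCA -scalerDl; congr (_ + _ *: _).
by rewrite -!rmorphM -rmorphD; congr (_%:C); ring.
Qed.

(* For this [eta], the gradient of [sqrt (phi |u|) u] at [U + t eta] loses its radial part: only [zeta] remains. *)
Lemma form_direction (R : realType) (m : nat) (a : 'I_2 -> 'I_2 -> R * R -> 'M[R[i]]_m)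
    (phi Lambda : R -> R) (kappa s : R) (x xi : R * R) (zeta omega : 'cV[R[i]]_m) :
  phi_conditions phi -> is_Lambda phi Lambda -> 0 < s -> rdot omega omega = 1 ->
  let L := Lambda (s * Num.sqrt (phi s)) in let c := rdot zeta omega in
  dissipation_form (fun h k => a h k x) phi kappa xi (s%:C *: omega) (zeta + (L * c)%:C *: omega) =
  phi s * (rdot (symbol a x xi *m zeta) zeta
   - L ^+ 2 * rdot (symbol a x xi *m omega) omega * c ^+ 2
   + L * (rdot (symbol a x xi *m omega) zeta - rdot (symbol a x xi *m zeta) omega) * c
   - kappa * (\sum_(k < 2) coord2 xi k ^+ 2) * rdot zeta zeta).
Proof.
move=> phiP LP s0 w1 /=; set L := Lambda _; set c := rdot zeta omega.
have p0 := phi_gt0 phiP s0; have D0 := phiD_gt0 phiP s0.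
have LE : L = - (s * phi^`()%classic s / phi s / (s * phi^`()%classic s / phi s + 2)).
  exact: (Lambda_mul_sqrt_phi phiP LP s0).
(* With q = s phi'(s) / phi(s), L = - q / (q + 2) and 1 + L = 2 / (q + 2), so the second term equals
   - 2 phi(s) L. *)
have HL : phi s * L + s * phi^`()%classic s * (1 + L) = - (phi s * L).
  rewrite LE; field; rewrite !gt_eqF//; lra.
have r0 : 0 < Num.sqrt (phi s) by rewrite sqrtr_gt0.
have rr : Num.sqrt (phi s) ^+ 2 = phi s by rewrite sqr_sqrtr// ltW.
(* The derivative of sqrt(phi) halves phi', so after multiplication by sqrt(phi(s)) this reads
   phi(s) L - phi(s) L = 0. *)
have HS : Num.sqrt (phi s) * L + s * sqrt_phi_deriv phi s * (1 + L) = 0.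
  apply: (mulIf (lt0r_neq0 r0)); rewrite /sqrt_phi_deriv mul0r.
  transitivity ((Num.sqrt (phi s) ^+ 2 * L + (Num.sqrt (phi s) ^+ 2 * L + s * phi^`()%classic s * (1 + L))) / 2).
    by field; rewrite gt_eqF.
  by rewrite rr HL subrr mul0r.
rewrite /dissipation_form !radial_diff_direction// HL HS mul0r scale0r addr0 -rdot_symbol.
rewrite rdotZl rdotZr mulrA -expr2 rr.
rewrite mulmxDr -scalemxAr !rdotDl !rdotDr !rdotZl !rdotZr.
have -> : \sum_(k < 2) coord2 xi k * coord2 xi k * (phi s * rdot zeta zeta) =
    (\sum_(k < 2) coord2 xi k ^+ 2) * (phi s * rdot zeta zeta).
  by rewrite mulr_suml; apply: eq_bigr => k _; rewrite expr2.
by ring.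
Qed.

Theorem theorem2 (R : realType) (m : nat) (Omega : set (R * R))
    (a : 'I_2 -> 'I_2 -> R * R -> 'M[R[i]]_m) (phi Lambda : R -> R)
    (domOmega : domain Omega)
    (a_bounded : forall (h k : 'I_2) (i j : 'I_m),
       cLfun Omega +oo%E (fun x => a h k x i j))
    (phiP : phi_conditions phi)
    (LambdaP : is_Lambda phi Lambda)
    (dissA : strict_dissipative Omega a phi) :
  exists2 kappa : R, 0 < kappa &
    {ae @leb2 R, forall x : R * R, Omega x ->
      forall (xi : R * R) (eta omega : 'cV[R[i]]_m), vnorm omega = 1 ->
        kappa * (\sum_(h < 2) coord2 xi h ^+ 2) * vnorm eta ^+ 2 <=
        complex.Re
          (hdot (symbol a x xi *m eta) eta
           - (Lambda_infty Lambda ^+ 2)%:C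
             * hdot (symbol a x xi *m omega) omega
             * (complex.Re (hdot eta omega) ^+ 2)%:C
           + (Lambda_infty Lambda)%:C
             * (hdot (symbol a x xi *m omega) eta
                - hdot (symbol a x xi *m eta) omega)
             * (complex.Re (hdot eta omega))%:C)}.
Proof.
have [_ oO _] := domOmega; have [kappa kappa0 Hk] := dissA; exists kappa => //.
have form_ge0 xi (U eta : 'cV[R[i]]_m) : 0 < rdot U U ->
    {ae @leb2 R, forall x, Omega x -> 0 <= dissipation_form (fun h k => a h k x) phi kappa xi U eta}.
  exact: form_ae.
have := form_ae_all phiP form_ge0; apply: leb2_ae_mono => x Hx Ox xi eta omega w1.
have w2 : rdot omega omega = 1 by rewrite -sqr_vnorm w1 expr1n.
pose P (L : R) := rdot (symbol a x xi *m eta) eta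
   - L ^+ 2 * rdot (symbol a x xi *m omega) omega * rdot eta omega ^+ 2
   + L * (rdot (symbol a x xi *m omega) eta - rdot (symbol a x xi *m eta) omega) * rdot eta omega
   - kappa * (\sum_(k < 2) coord2 xi k ^+ 2) * rdot eta eta.
have P0 n : 0 <= P (Lambda (n.+1%:R * Num.sqrt (phi n.+1%:R))).
  have n0 : 0 < n.+1%:R :> R by [].
  rewrite -(pmulr_rge0 _ (phi_gt0 phiP n0)) -(form_direction _ _ _ _ _ phiP LambdaP n0 w2).
  by apply: Hx => //; rewrite rdotZl rdotZr w2 mulr1 mulr_gt0.
have cL := Lambda_infty_cvg phiP LambdaP.
(* At the fixed x, P is a polynomial in L, so letting the amplitude grow creates no further
   exceptional set. *)
have cP : P (Lambda (n.+1%:R * Num.sqrt (phi n.+1%:R))) @[n --> \oo] --> P (Lambda_infty Lambda).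
  apply: cvgB; last exact: cvg_cst.
  apply: cvgD; last by apply: cvgMl; apply: cvgMl.
  apply: cvgB; first exact: cvg_cst.
  do 2!apply: cvgMl; rewrite expr2; under eq_cvg do rewrite expr2.
  exact: cvgM.
have PL : 0 <= P (Lambda_infty Lambda).
  rewrite -(cvg_lim _ cP)//; apply: limr_ge; first by apply/cvg_ex; eexists; exact: cP.
  exact: nearW.
have ReZ (s c : R) (z : R[i]) : complex.Re (s%:C * z * c%:C) = s * complex.Re z * c.
  by case: z => p q /=; ring.
rewrite sqr_vnorm -subr_ge0 ReD raddfB /= !ReZ raddfB /=.
exact: PL.
Qed.
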